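(* Let $h\in C^\infty(S^1;\mathbb R)$, set $\gamma(\theta)=-e^{-i\theta}h(\theta)$, and let $m\in C^\infty(S^1;\mathbb C)$. Assume there exists some constant $\delta_0>0$ such that $|\gamma'(\theta)|\ge\delta_0$ for all $\theta$, and that $\gamma'$ has a winding number $n\in\mathbb N$ about the origin. In particular, $W(\theta):=\mathrm{Arg}(\gamma'(\theta))$ is well-defined as an $n$-to-1 map on $S^1$. Next, assume $\beta>\frac12$. Define the constants $\kappa^{(\infty)},\kappa^{(1)},\kappa^{(\$)}>0$ by the formulas $$\kappa^{(\infty)}:=\left\|\frac{1}{|\gamma'(\theta)|^{\beta}}\left(1+\frac{|\gamma''(\theta)|}{|\gamma'(\theta)|}\right)\left|\frac{m(\theta)}{W'(\theta)}\right|\right\|_{L^\infty},$$ $$\kappa^{(1)}:=\left\|\frac{1}{|\gamma'(\theta)|}\left(\left(1+\frac{|\gamma''(\theta)|}{|\gamma'(\theta)|}\right)m(\theta)+m'(\theta)\right)\right\|_{L^1},$$ $$\kappa^{(\$)}:=\|m'\|_{L^1}+\|\gamma'\|_{L^\infty}.$$ Let $v\in C^1((0,\infty)\times S^1;\mathbb C)$. Then the integral $$I(\rho,\alpha)=\int_{S^1}\int_0^\infty e^{i\Psi(r,\theta)}\,v(r,\theta)\,m(\theta)\,dr\,d\theta,\qquad \Psi(r,\theta)=\rho r\sin(\theta+\alpha)+\frac{h(\theta)}{r},$$ obeys the bound $$|I(\rho,\alpha)|\le C\left(\left(\rho^{\beta-1}(1+\rho^{-1})\kappa^{(\infty)}+\kappa^{(1)}\right)\log(\rho+2)+\kappa^{(1)}\left(\log(\rho^{-1}+2)+\log(\kappa^{(\$)})\right)\right)\cdot\left(\|\langle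 r\rangle^{2\beta+1}v\|_{L^\infty}+\left\|\langle r\rangle^{2\beta+2}\left(v_r,\tfrac1r v_\theta\right)\right\|_{L^\infty}\right),$$ where the constant $C>0$ depends only on $\delta_0$ and $n$ (and on the fixed exponent $\beta$).
   Context: $S^1=\mathbb R/2\pi\mathbb Z$; $\rho>0$ and $\alpha\in\mathbb R$; primes denote derivatives in $\theta$; $v_r,v_\theta$ are the partial derivatives of $v(r,\theta)$; $\langle r\rangle=\sqrt{1+r^2}$. The $L^1$ and $L^\infty$ norms in the definitions of the $\kappa$'s are over $\theta\in S^1$, and the norms of $v$ and its derivatives are over $(r,\theta)\in(0,\infty)\times S^1$. $\mathrm{Arg}$ takes values in $\mathbb R/2\pi\mathbb Z$, and $W'=\mathrm{Im}[\overline{\gamma'}\gamma'']/|\gamma'|^2$.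
   Formalization: The factor log(1/ρ+2)+log κ^($) is replaced by its maximum with 0, since the bound is false when it is very negative; that W is n-to-1 is assumed, as it does not follow from the winding number; the winding number, always negative, is taken in absolute value. *)

(* Defs.v *)
From HB Require Import structures.
From mathcomp Require Import all_boot all_order all_algebra.
From mathcomp Require Import all_classical all_reals all_analysis.
From mathcomp Require Import complex.

Set Implicit Arguments.
Unset Strict Implicit.
Unset Printing Implicit Defensive.

Import Order.TTheory GRing.Theory Num.Theory.
Import numFieldNormedType.Exports.

Local Open Scope classical_set_scope.
Local Open Scope ring_scope.

(* Functions on S^1 = R / 2 pi Z are 2pi-periodic functions on R. *)
Definition periodic2pi (R : realType) (T : Type) (f : R -> T) : Prop :=
  forall t, f (t + 2 * pi) = f t.

Definition circle (R : realType) : set R := [set t | 0 <= t <= 2 * pi].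

Definition half_line (R : realType) : set R := [set r | 0 < r].

Definition smooth (R : realType) (f : R -> R) : Prop :=
  forall (k : nat) (t : R), derivable (derive1n k f) t 1.

Definition csmooth (R : realType) (f : R -> R[i]) : Prop :=
  smooth (fun t => complex.Re (f t)) /\ smooth (fun t => complex.Im (f t)).

Definition cderive (R : realType) (f : R -> R[i]) (t : R) : R[i] :=
  (derive1 (fun x => complex.Re (f x)) t
   +i* derive1 (fun x => complex.Im (f x)) t)%C.

(* The modulus as a real number; the MathComp norm of R[i] is R[i]-valued. *)
Definition cmod (R : realType) (z : R[i]) : R := ComplexField.Normc.normc z.

Definition expi (R : realType) (t : R) : R[i] := (cos t +i* sin t)%C.

Definition cintegral (R : realType) (D : set R) (f : R -> R[i]) : R[i] :=
  (Rintegral lebesgue_measure D (fun x => complex.Re (f x))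
   +i* Rintegral lebesgue_measure D (fun x => complex.Im (f x)))%C.

(* The L^p(D) norm: f is extended by 0 outside of D. *)
Definition Lnorm_on d (T : measurableType d) (R : realType)
    (mu : {measure set T -> \bar R}) (D : set T) (p : \bar R)
    (f : T -> \bar R) : \bar R :=
  'N[mu]_p[f \_ D]%E.

Definition cLnorm_circle (R : realType) (p : \bar R) (f : R -> R[i]) : \bar R :=
  Lnorm_on lebesgue_measure (@circle R) p (fun t => (cmod (f t))%:E).

(* The L^oo norm over (r, theta) in (0, oo) x S^1. *)
Definition Loo_polar (R : realType) (f : R -> R -> R) : \bar R :=
  Lnorm_on (lebesgue_measure \x lebesgue_measure)%E
    (@half_line R `*` @circle R) +oo%E (fun p => (f p.1 p.2)%:E).

(* a is a representative of Arg z in R / 2 pi Z *)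
Definition is_arg (R : realType) (z : R[i]) (a : R) : Prop :=
  z = (cmod z)%:C%C * expi a.

(* The winding number of g about 0 is w, for nowhere vanishing g on S^1.  The
   gamma defined below runs clockwise: gamma' = e^{-it} (i h - h'), and
   i h - h' crosses the real axis only clockwise, so w <= -1 for g = gamma'
   and a winding number n in N has to be read as |w| = n. *)
Definition is_winding_number (R : realType) (g : R -> R[i]) (w : int) : Prop :=
  exists phi : R -> R,
    [/\ continuous phi,
        forall t, is_arg (g t) (phi t) &
        phi (2 * pi) - phi 0 = 2 * pi * w%:~R].

(* For nowhere vanishing g on S^1: every value of Arg \o g is attained at
   exactly n points of S^1. *)
Definition arg_n_to_1 (R : realType) (g : R -> R[i]) (n : nat) : Prop :=
  forall a : R,
    ([set t : R | 0 <= t < 2 * pi /\ is_arg (g t) a] #= `I_n)%card.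

Definition gamma (R : realType) (h : R -> R) (t : R) : R[i] :=
  - expi (- t) * (h t)%:C%C.

Definition dgamma (R : realType) (h : R -> R) : R -> R[i] := cderive (gamma h).

Definition ddgamma (R : realType) (h : R -> R) : R -> R[i] :=
  cderive (dgamma h).

(* W' for W = Arg \o gamma' *)
Definition dW (R : realType) (h : R -> R) (t : R) : R :=
  complex.Im ((dgamma h t)^*%C * ddgamma h t) / cmod (dgamma h t) ^+ 2.

Definition gamma_ratio (R : realType) (h : R -> R) (t : R) : R :=
  1 + cmod (ddgamma h t) / cmod (dgamma h t).

(* The quotient |m / W'| is taken in the extended reals, so that it is +oo
   where W' = 0 and m <> 0 (and 0 where both vanish). *)
Definition kappa_oo (R : realType) (beta : R) (h : R -> R) (m : R -> R[i])
    : \bar R :=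
  Lnorm_on lebesgue_measure (@circle R) +oo%E (fun t =>
    ((cmod (dgamma h t) `^ beta)^-1 * gamma_ratio h t)%:E
      * ((cmod (m t))%:E / `|dW h t|%:E))%E.

Definition kappa_1 (R : realType) (h : R -> R) (m : R -> R[i]) : \bar R :=
  cLnorm_circle 1%E (fun t =>
    ((cmod (dgamma h t))^-1)%:C%C
      * ((gamma_ratio h t)%:C%C * m t + cderive m t)).

Definition kappa_S (R : realType) (h : R -> R) (m : R -> R[i]) : \bar R :=
  (cLnorm_circle 1 (cderive m) + cLnorm_circle +oo (dgamma h))%E.

Definition Psi (R : realType) (h : R -> R) (rho alpha r t : R) : R :=
  rho * r * sin (t + alpha) + h t / r.

Definition Iint (R : realType) (h : R -> R) (m : R -> R[i])
    (v : R -> R -> R[i]) (rho alpha : R) : R[i] :=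
  cintegral (@circle R) (fun t =>
    cintegral (@half_line R) (fun r =>
      expi (Psi h rho alpha r t) * v r t * m t)).

Definition v_r (R : realType) (v : R -> R -> R[i]) (r t : R) : R[i] :=
  cderive (fun x => v x t) r.

Definition v_t (R : realType) (v : R -> R -> R[i]) (r t : R) : R[i] :=
  cderive (fun x => v r x) t.

Definition cderivable (R : realType) (f : R -> R[i]) (t : R) : Prop :=
  derivable (fun x => complex.Re (f x)) t 1 /\
  derivable (fun x => complex.Im (f x)) t 1.

Definition ccontinuous2_at (R : realType) (f : R -> R -> R[i]) (r t : R)
    : Prop :=
  {for (r, t), continuous (fun p : R * R => complex.Re (f p.1 p.2))} /\
  {for (r, t), continuous (fun p : R * R => complex.Im (f p.1 p.2))}.

(* v is in C^1((0, oo) x S^1; C); its values at r <= 0 are irrelevant. *)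
Definition C1_polar (R : realType) (v : R -> R -> R[i]) : Prop :=
  forall r t : R, 0 < r ->
    [/\ v r (t + 2 * pi) = v r t,
        cderivable (fun x => v x t) r /\ cderivable (fun x => v r x) t,
        ccontinuous2_at (v_r v) r t &
        ccontinuous2_at (v_t v) r t].

Definition japanese (R : realType) (r : R) : R := Num.sqrt (1 + r ^+ 2).

Definition v_norm0 (R : realType) (beta : R) (v : R -> R -> R[i]) : \bar R :=
  Loo_polar (fun r t => japanese r `^ (2 * beta + 1) * cmod (v r t)).

Definition v_norm1 (R : realType) (beta : R) (v : R -> R -> R[i]) : \bar R :=
  Loo_polar (fun r t => japanese r `^ (2 * beta + 2) *
    Num.sqrt (cmod (v_r v r t) ^+ 2 + (r^-1 * cmod (v_t v r t)) ^+ 2)).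

(* Main.v *)
Require Import Defs.
From HB Require Import structures.
From mathcomp Require Import all_boot all_order all_algebra.
From mathcomp Require Import all_classical all_reals all_analysis.
From mathcomp Require Import complex.
From mathcomp Require Import measurable_realfun ess_sup_inf ring lra.

Set Implicit Arguments.
Unset Strict Implicit.
Unset Printing Implicit Defensive.

Import Order.TTheory GRing.Theory Num.Theory.
Import numFieldNormedType.Exports.

Local Open Scope classical_set_scope.
Local Open Scope ring_scope.

(** In polar coordinates the gradient of [Psi] has the components [Psi_r] and
    [Psi_theta / r]. With [p = |gamma'|], [s = p / r ^ 2] and [phi] the angle of
    [gamma'] relative to the direction [alpha], its squared length is
    [D = (s - rho cos phi) ^ 2 + rho ^ 2 sin ^ 2 phi]
    ([sqr_gradientE]), so the only stationary points are the resonances [s = rho],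
    [cos phi = 1]. The bound comes from one integration by parts along the
    gradient, with [1 / D] replaced by a [C^1] function that is cut off below
    [eps ^ 2], [eps = rho / (rho + 2)]. It writes the integrand as
    [X_r + Y_theta] plus a remainder of size [1 / (r d)], where [d] is the
    maximum of [eps] and the length of the gradient ([residual_bound]). The
    divergence integrates to zero, because [X] vanishes at [r = 0] and at
    infinity and [Y] is periodic. There is no need to integrate the remainder
    directly: in [region_bound] it is dominated by explicit derivatives in [r],
    whose primitives have bounded variation on the half line
    ([divergence_bound], [oscillatory_bound]).

    Far from the resonance [d] is of size [s] at least, so the remainder is at
    most [r <r>^(-2 beta - 1)] times [((1 + |gamma''| / |gamma'|) |m| + |m'|) / p].
    Near the resonance there are two contributions. Where the combination
    [(1 + |gamma''| / |gamma'|) m + m'] of [kappa_1] occurs, it is multiplied by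
    [1 / (r d)], whose integral in [r] is of size [log (rho + 2) / p]. The term
    with [m] alone may come with a factor [1 / d ^ 2]; there
    [kappa_oo] is used to bound [m] by a multiple of [|W'|], and the integral in
    [r] is an arctangent, of size
    [1 / lam] with [lam ^ 2 = eps ^ 2 + rho ^ 2 sin ^ 2 phi]. What is left is the
    integral over the circle of [|W'| (cos phi)_+ / lam], in which [phi] can be
    taken as the variable: a curve that turns [n] times and takes every direction
    exactly [n] times must turn monotonically ([n_to_1_monotone]), and each turn
    contributes at most [6 log (rho + 2) / rho] ([angle_bound]).

    The far region involves [(1 + |gamma''| / |gamma'|) |m| / |gamma'|] in [L^1],
    whereas [kappa_1] only controls a sum in which [m'] may cancel this term.
    The combination is a damped linear equation for [m] on the circle, and
    [weighted_L1] inverts it at the cost of a factor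
    [1 + ln (sup |gamma'| / delta0)]: this is the origin of the logarithm of
    [kappa_S]. All constants depend on [beta], [delta0] and [n] only
    ([finite_bound_le]). *)

(** * Differentiation and continuity of explicit expressions *)

Section Derivatives.
Variable R : realType.
Implicit Types (f g : R -> R) (x a b : R).

Lemma der_eq f x a b : is_derive x 1 f a -> a = b -> is_derive x 1 f b.
Proof. by move=> + <-. Qed.

Lemma der_cst (c x : R) : is_derive x 1 (fun=> c) 0.
Proof. exact: is_derive_cst. Qed.

Lemma der_id x : is_derive x 1 (fun y : R => y) 1.
Proof. exact: is_derive_id. Qed.

Lemma derD f g x a b : is_derive x 1 f a -> is_derive x 1 g b ->
  is_derive x 1 (fun y => f y + g y) (a + b).
Proof. by move=> fa gb; exact: is_deriveD. Qed.

Lemma derN f x a : is_derive x 1 f a -> is_derive x 1 (fun y => - f y) (- a).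
Proof. by move=> fa; exact: is_deriveN. Qed.

Lemma derM f g x a b : is_derive x 1 f a -> is_derive x 1 g b ->
  is_derive x 1 (fun y => f y * g y) (a * g x + f x * b).
Proof.
move=> fa gb; have := is_deriveM fa gb; move/der_eq; apply.
by rewrite /GRing.scale /= addrC mulrC.
Qed.

Lemma der_comp g f x a b : is_derive (f x) 1 g b -> is_derive x 1 f a ->
  is_derive x 1 (fun y => g (f y)) (b * a).
Proof. by move=> gb fa; have := is_derive1_comp gb fa. Qed.

Lemma derV f x a : f x != 0 -> is_derive x 1 f a ->
  is_derive x 1 (fun y => (f y)^-1) (- a / f x ^+ 2).
Proof.
move=> fx fa; have := is_deriveV fx fa; move/der_eq; apply.
by rewrite /GRing.scale /= !mulNr mulrC.
Qed.

Lemma derX f x a (n : nat) : is_derive x 1 f a ->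
  is_derive x 1 (fun y => f y ^+ n.+1) (n.+1%:R * f x ^+ n * a).
Proof.
move=> fa; elim: n => [|n IH]; first by rewrite expr0 mulr1 mul1r.
rewrite (_ : (fun _ => _) = (fun y => f y * f y ^+ n.+1)); last first.
  by apply/funext => y; rewrite exprS.
apply: der_eq (derM fa IH) _.
by rewrite -[n.+2%:R]natr1 exprS; ring.
Qed.

Lemma der_sin f x a : is_derive x 1 f a ->
  is_derive x 1 (fun y => sin (f y)) (cos (f x) * a).
Proof. by move=> fa; apply: der_comp fa; exact: is_derive_sin. Qed.

Lemma der_cos f x a : is_derive x 1 f a ->
  is_derive x 1 (fun y => cos (f y)) (- sin (f x) * a).
Proof. by move=> fa; apply: der_comp fa; exact: is_derive_cos. Qed.

Lemma der_atan f x a : is_derive x 1 f a ->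
  is_derive x 1 (fun y => atan (f y)) ((1 + f x ^+ 2)^-1 * a).
Proof. by move=> fa; apply: der_comp fa; exact: is_derive1_atan. Qed.

Lemma der_ln f x a : 0 < f x -> is_derive x 1 f a ->
  is_derive x 1 (fun y => ln (f y)) ((f x)^-1 * a).
Proof. by move=> f0 fa; apply: der_comp fa; exact: is_derive1_ln. Qed.

Lemma der_sqrt f x a : 0 < f x -> is_derive x 1 f a ->
  is_derive x 1 (fun y => Num.sqrt (f y)) ((2 * Num.sqrt (f x))^-1 * a).
Proof. by move=> f0 fa; apply: der_comp fa; exact: is_derive1_sqrt. Qed.

Lemma der_powR f x a b : 0 < f x -> is_derive x 1 f a ->
  is_derive x 1 (fun y => f y `^ b) (b * f x `^ (b - 1) * a).
Proof.
by move=> f0 fa; exact: (@der_comp (fun y => y `^ b) f x a _ (is_derive1_powR b f0) fa).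
Qed.

Lemma der_continuous f x a : is_derive x 1 f a -> {for x, continuous f}.
Proof. by move=> fa; apply/differentiable_continuous/derivable1_diffP. Qed.

Lemma der_within (A : set R) f : (forall x, A x -> exists a, is_derive x 1 f a) ->
  {within A, continuous f}.
Proof.
move=> df; apply: continuous_in_subspaceT => x /set_mem /df[a].
exact: der_continuous.
Qed.

End Derivatives.

(** The derivation rules above are stated for applied expressions rather than
    for combinations of functions, so that the shape of a body determines the
    rule and its derivative is computed by unification. *)
Ltac der_step := match goal with
  | |- is_derive _ _ (fun y => _) _ => eapply der_cst
  | |- is_derive _ _ (fun y => @?f y + @?g y) _ => eapply (@derD _ f g)
  | |- is_derive _ _ (fun y => - @?f y) _ => eapply (@derN _ f)
  | |- is_derive _ _ (fun y => @?f y * @?g y) _ => eapply (@derM _ f g)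
  | |- is_derive _ _ (fun y => (@?f y)^-1) _ => eapply (@derV _ f)
  | |- is_derive _ _ (fun y => @?f y ^+ _.+1) _ => eapply (@derX _ f)
  | |- is_derive _ _ (fun y => sin (@?f y)) _ => eapply (@der_sin _ f)
  | |- is_derive _ _ (fun y => cos (@?f y)) _ => eapply (@der_cos _ f)
  | |- is_derive _ _ (fun y => atan (@?f y)) _ => eapply (@der_atan _ f)
  | |- is_derive _ _ (fun y => ln (@?f y)) _ => eapply (@der_ln _ f)
  | |- is_derive _ _ (fun y => Num.sqrt (@?f y)) _ => eapply (@der_sqrt _ f)
  | |- is_derive _ _ (fun y => @?f y `^ _) _ => eapply (@der_powR _ f)
  | |- is_derive _ _ (fun y => y) _ => eapply der_id
  | |- _ => eassumption
  end.
Ltac der := eapply der_eq; [repeat der_step|].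

(** * Joint continuity on the open half plane *)

Section HalfPlane.
Variable R : realType.
Implicit Types (f g : R -> R -> R) (u : R -> R).

Definition cont2 f : Prop := forall r t : R, 0 < r ->
  {for (r, t), continuous (fun p : R * R => f p.1 p.2)}.

Lemma cont2_cst (c : R) : cont2 (fun _ _ => c).
Proof. by move=> r t _; exact: cst_continuous. Qed.

Lemma cont2_fst u : (forall r, 0 < r -> {for r, continuous u}) ->
  cont2 (fun r _ => u r).
Proof.
move=> cu r t r0; apply: (@continuous_comp _ _ _ fst u); last exact: cu.
exact: cvg_fst.
Qed.

Lemma cont2_snd u : continuous u -> cont2 (fun _ t => u t).
Proof.
move=> cu r t r0; apply: (@continuous_comp _ _ _ snd u); last exact: cu.
exact: cvg_snd.
Qed.

Lemma cont2D f g : cont2 f -> cont2 g -> cont2 (fun r t => f r t + g r t).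
Proof. by move=> cf cg r t r0; apply: continuousD; [exact: cf|exact: cg]. Qed.

Lemma cont2N f : cont2 f -> cont2 (fun r t => - f r t).
Proof. by move=> cf r t r0; apply: continuousN; exact: cf. Qed.

Lemma cont2M f g : cont2 f -> cont2 g -> cont2 (fun r t => f r t * g r t).
Proof. by move=> cf cg r t r0; apply: continuousM; [exact: cf|exact: cg]. Qed.

Lemma cont2X f n : cont2 f -> cont2 (fun r t => f r t ^+ n).
Proof.
move=> cf; elim: n => [|n IH]; first exact: cont2_cst.
rewrite (_ : (fun _ _ => _) = (fun r t => f r t * f r t ^+ n)).
  exact: cont2M.
by apply/funext => r; apply/funext => t; rewrite exprS.
Qed.

Lemma cont2V f : cont2 f -> (forall r t, 0 < r -> f r t != 0) ->
  cont2 (fun r t => (f r t)^-1).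
Proof. by move=> cf f0 r t r0; apply: continuousV; [exact: f0|exact: cf]. Qed.

Lemma cont2_comp u f : continuous u -> cont2 f -> cont2 (fun r t => u (f r t)).
Proof.
move=> cu cf r t r0.
by apply: (@continuous_comp _ _ _ (fun p => f p.1 p.2) u); [exact: cf|exact: cu].
Qed.

Lemma cont2_slice_fst f r t : cont2 f -> 0 < r -> {for r, continuous (f ^~ t)}.
Proof.
move=> cf r0.
apply: (@continuous_comp _ _ _ (fun r => (r, t)) (fun p => f p.1 p.2)).
  exact: cvg_pair cvg_id (cvg_cst _).
exact: cf.
Qed.

Lemma cont2_slice_snd f r : cont2 f -> 0 < r -> continuous (f r).
Proof.
move=> cf r0 t.
apply: (@continuous_comp _ _ _ (fun t => (r, t)) (fun p => f p.1 p.2)).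
  exact: cvg_pair (cvg_cst _) cvg_id.
exact: cf.
Qed.

Lemma cont2_bounded f (a b c d : R) : cont2 f -> 0 < a ->
  exists2 M, 0 <= M & forall r t, a <= r <= b -> c <= t <= d -> `|f r t| <= M.
Proof.
move=> cf a0.
have cK : compact (`[a, b]%classic `*` `[c, d]%classic : set (R * R)).
  by apply: compact_setX; exact: segment_compact.
have : bounded_set ((fun p : R * R => f p.1 p.2) @` (`[a, b] `*` `[c, d])).
  apply: compact_bounded; apply: continuous_compact => //.
  apply: continuous_in_subspaceT => -[r t]; rewrite inE/= => -[/= + _].
  by rewrite in_itv/= => /andP[ar _]; apply: cf; exact: lt_le_trans ar.
case=> M [_ HM].
have MM : M < `|M| + 1 by rewrite (le_lt_trans (ler_norm M))// ltrDl.
have H := HM _ MM.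
exists (`|M| + 1); first by rewrite addr_ge0.
move=> r t abr cdt; apply: H; exists (r, t) => //=.
Qed.

(** The mean value theorem in [r], together with the local boundedness of [fr],
    reduces joint continuity to continuity in [t]. *)
Lemma cont2_partials f (fr ft : R -> R -> R) :
  (forall r t : R, 0 < r -> is_derive r 1 (f ^~ t) (fr r t)) ->
  (forall r t : R, 0 < r -> is_derive t 1 (f r) (ft r t)) ->
  cont2 fr -> cont2 f.
Proof.
move=> dr dt cr r t r0.
have r20 : 0 < r / 2 by rewrite divr_gt0.
have [M M0 HM] := @cont2_bounded fr (r / 2) (2 * r) (t - 1) (t + 1) cr r20.
have ct : {for t, continuous (f r)} by exact: der_continuous (dt r t r0).
apply/cvgrPdist_le => /= e e0.
have e20 : 0 < e / 2 by rewrite divr_gt0.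
move/cvgrPdist_le: (ct) => /(_ _ e20)[d /= d0 Hd].
pose d1 := Num.min (r / 2) (e / 2 / (M + 1)).
have d10 : 0 < d1.
  by rewrite lt_min r20/= divr_gt0// ltr_pwDr.
exists (ball r d1, ball t (Num.min d 1)) => /=.
  by split; apply: nbhsx_ballx => //; rewrite lt_min d0 /=.
case=> r' t' [/= br bt].
have {}bt : `|t - t'| < d /\ `|t - t'| < 1.
  by move: bt; rewrite /ball/= lt_min => /andP[].
have {}br : `|r - r'| < r / 2 /\ `|r - r'| < e / 2 / (M + 1).
  by move: br; rewrite /ball/= lt_min => /andP[].
have h1 : `|f r t - f r t'| <= e / 2 by apply: Hd; case: bt.
have h2 : `|f r t' - f r' t'| <= e / 2.
  have key (u v : R) : r / 2 <= u -> v <= 2 * r -> u <= v ->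
      `|f v t' - f u t'| <= M * (v - u).
    move=> ru vr uv.
    have u0 : 0 < u by exact: lt_le_trans ru.
    have [||c /andP[uc cv] ->] := @MVT_segment _ (f ^~ t') (fr ^~ t') u v uv.
    - by move=> x; rewrite in_itv/= => /andP[ux _]; apply: dr; exact: lt_trans ux.
    - apply: der_within => x /=; rewrite in_itv/= => /andP[ux _].
      by exists (fr x t'); apply: dr; exact: lt_le_trans ux.
    rewrite normrM (ger0_norm (_ : 0 <= v - u)) ?subr_ge0// ler_wpM2r ?subr_ge0//.
    apply: HM.
      by move: uc cv; rewrite !bnd_simp => uc cv; apply/andP; split; lra.
    by case: bt => _; rewrite ltr_norml => /andP[? ?]; apply/andP; split; lra.
  have [[b1 b2] [_ _]] := (br, bt).
  have hb : M * `|r - r'| <= e / 2.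
    apply: le_trans (_ : (M + 1) * `|r - r'| <= _).
      by rewrite ler_wpM2r// lerDl.
    by rewrite mulrC -ler_pdivlMr ?ltW// ltr_pwDr.
  have [rr|rr] := leP r r'.
    rewrite distrC (le_trans (key _ _ _ _ rr))//; [lra| |].
      by move: b1; rewrite ltr_norml => /andP[? ?]; lra.
    by rewrite -(ger0_norm (_ : 0 <= r' - r)) ?subr_ge0// distrC.
  have rr' := ltW rr.
  rewrite (le_trans (key _ _ _ _ rr'))//; [| lra |].
    by move: b1; rewrite ltr_norml => /andP[? ?]; lra.
  by rewrite -(ger0_norm (_ : 0 <= r - r')) ?subr_ge0.
rewrite (_ : _ - _ = (f r t - f r t') + (f r t' - f r' t')); last by ring.
by rewrite (le_trans (ler_normD _ _))// [leRHS](splitr e) lerD.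
Qed.

End HalfPlane.

(** * Integrals over segments and an integration by parts on the half strip *)

Section Segments.
Variable R : realType.
Notation mu := (@lebesgue_measure R).
Implicit Types (f g F : R -> R) (a b : R).

Lemma segment_integrable a b f : {within `[a, b], continuous f} ->
  mu.-integrable `[a, b] (EFin \o f).
Proof. by move=> cf; apply: continuous_compact_integrable => //; exact: segment_compact. Qed.

Lemma continuous_segment_integrable a b f : continuous f ->
  mu.-integrable `[a, b] (EFin \o f).
Proof. by move=> cf; apply: segment_integrable; exact: continuous_subspaceT. Qed.

Lemma Rintegral_is_derive a b f F : a < b ->
  {within `[a, b], continuous f} ->
  (forall x, a <= x <= b -> is_derive x 1 F (f x)) ->
  \int[mu]_(x in `[a, b]) f x = F b - F a.
Proof.
move=> ab cf dF; rewrite /Rintegral.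
have cF x : a <= x <= b -> F y @[y --> x] --> F x.
  by move=> axb; have := der_continuous (dF x axb).
rewrite (@continuous_FTC2 _ _ F)//.
- split.
  + move=> x; rewrite in_itv/= => /andP[ax xb].
    by have [] : is_derive x 1 F (f x) by apply: dF; rewrite !ltW.
  + by apply: cvg_at_right_filter; apply: cF; rewrite lexx ltW.
  + by apply: cvg_at_left_filter; apply: cF; rewrite lexx ltW.
- move=> x; rewrite in_itv/= => /andP[ax xb].
  rewrite derive1E.
  by have [_ ->] : is_derive x 1 F (f x) by apply: dF; rewrite !ltW.
Qed.

Lemma Rintegral_segment_cst a b (c : R) : a < b ->
  \int[mu]_(x in `[a, b]) c = c * (b - a).
Proof.
move=> ab; rewrite mulrBr; apply: (Rintegral_is_derive (F := fun x => c * x)) => //.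
  by apply: continuous_subspaceT; exact: cst_continuous.
by move=> x _; der; ring.
Qed.

Lemma half_lineE : @half_line R = `]0, +oo[%classic.
Proof. by apply/seteqP; split=> r /=; rewrite in_itv/= andbT. Qed.

Lemma measurable_half_line :
  measurable (@half_line R : set (measurableTypeR R)).
Proof. by rewrite half_lineE. Qed.

Lemma circleE : @circle R = `[0, 2 * pi]%classic.
Proof. by apply/seteqP; split=> r /=; rewrite in_itv/=. Qed.

Lemma integrable_half_line_oneDsqrV (M : R) :
  mu.-integrable (@half_line R) (EFin \o (fun r => M * (oneDsqr r)^-1)).
Proof.
have i1 : mu.-integrable (@half_line R) (EFin \o (fun r => (oneDsqr r)^-1)).
  apply: (@integrableS _ _ _ mu `[0%R, +oo[) => //.
  - by rewrite half_lineE.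
  - by rewrite half_lineE; apply: subset_itvr; rewrite bnd_simp.
  apply/integrableP; split.
    apply/measurable_EFinP/measurable_funTS.
    by apply: continuous_measurable_fun; exact: continuous_oneDsqrV.
  under eq_integral do rewrite /= ger0_norm ?invr_ge0 ?(le_trans _ (oneDsqr_ge1 _))//.
  by rewrite integral0y_oneDsqr ltry.
rewrite (_ : EFin \o _ = (fun r : R => M%:E * ((oneDsqr r)^-1%R)%:E)%E).
  by apply: integrableZl => //; exact: measurable_half_line.
by apply/funext => r; rewrite /= EFinM.
Qed.

Lemma Rintegral_half_line_oneDsqrV :
  \int[mu]_(r in @half_line R) (oneDsqr r)^-1 = pi / 2.
Proof.
rewrite half_lineE /Rintegral integral_itv_obnd_cbnd ?integral0y_oneDsqr//.
apply/measurable_EFinP/measurable_funTS.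
by apply: continuous_measurable_fun; exact: continuous_oneDsqrV.
Qed.

Lemma Rintegral_segment_oneDsqrV a b : a < b ->
  \int[mu]_(r in `[a, b]) (oneDsqr r)^-1 = atan b - atan a.
Proof.
move=> ab; apply: Rintegral_is_derive => //.
by apply: continuous_subspaceT; exact: continuous_oneDsqrV.
Qed.

Lemma half_line_truncation (M a b : R) f : 0 < a -> a < b ->
  mu.-integrable (@half_line R) (EFin \o f) ->
  (forall r, 0 < r -> `|f r| <= M * (oneDsqr r)^-1) ->
  `|\int[mu]_(r in @half_line R) f r - \int[mu]_(r in `[a, b]) f r| <=
    M * (pi / 2 - (atan b - atan a)).
Proof.
move=> a0 ab fi fM.
pose D := @half_line R `\` `[a, b]%classic.
have mH := measurable_half_line.
have mD : measurable D by apply: measurableD.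
have HE : @half_line R = `[a, b]%classic `|` D.
  apply/seteqP; split => r /=.
    by move=> r0; have [?|?] := pselect (`[a, b]%classic r); [left|right].
  by case=> [|[]//]; rewrite in_itv/= => /andP[ar _]; exact: lt_le_trans ar.
have dis : [disjoint `[a, b]%classic & D].
  by apply/disj_setPS => r /= [? []].
have split_int g : mu.-integrable (@half_line R) (EFin \o g) ->
    \int[mu]_(r in @half_line R) g r =
    \int[mu]_(r in `[a, b]) g r + \int[mu]_(r in D) g r.
  move=> gi; rewrite [in LHS]HE Rintegral_setU//.
  by rewrite -HE.
have DH : D `<=` @half_line R by move=> r [].
rewrite (split_int _ fi) (addrC (Rintegral _ _ _)) addrK.
have Mi := integrable_half_line_oneDsqrV M.
have oi := integrable_half_line_oneDsqrV 1.
have fiD : mu.-integrable D (EFin \o f) by exact: integrableS fi.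
have MiD : mu.-integrable D (EFin \o (fun r => M * (oneDsqr r)^-1)) by exact: integrableS Mi.
apply: le_trans (le_normr_Rintegral _ fiD) _ => //.
apply: le_trans (_ : \int[mu]_(r in D) (M * (oneDsqr r)^-1) <= _).
  apply: le_Rintegral => //.
  - by have /= := integrable_norm fiD.
  - by move=> r [/= r0 _]; exact: fM.
have {}oi : mu.-integrable (@half_line R) (EFin \o (fun r => (oneDsqr r)^-1)).
  by apply: eq_integrable oi => //= r _; rewrite mul1r.
rewrite RintegralZl//; last exact: integrableS oi.
have /eqP := split_int _ oi.
rewrite Rintegral_half_line_oneDsqrV Rintegral_segment_oneDsqrV//.
by rewrite addrC -subr_eq => /eqP <-.
Qed.

End Segments.

Section Divergence.
Variable R : realType.
Notation mu := (@lebesgue_measure R).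
Variables (F X Y dX dY T dT : R -> R -> R) (k : R -> R) (M : R).
Hypothesis cF : cont2 F.
Hypothesis cdX : cont2 dX.
Hypothesis cdY : cont2 dY.
Hypothesis cdT : cont2 dT.
Hypothesis hX : forall r t : R, 0 < r -> is_derive r 1 (X ^~ t) (dX r t).
Hypothesis hY : forall r t : R, 0 < r -> is_derive t 1 (Y r) (dY r t).
Hypothesis hT : forall r t : R, 0 < r -> is_derive r 1 (T ^~ t) (dT r t).
Hypothesis res : forall r t : R, 0 < r -> `|F r t - dX r t - dY r t| <= dT r t.
Hypothesis Tk : forall a b t : R, 0 < a -> a < b -> T b t - T a t <= k t.
Hypothesis FM : forall r t : R, 0 < r -> `|F r t| <= M * (oneDsqr r)^-1.
Hypothesis perY : forall r t : R, 0 < r -> Y r (t + 2 * pi) = Y r t.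
Hypothesis X0 : forall e : R, 0 < e ->
  exists2 a0 : R, 0 < a0 & forall a t : R, 0 < a -> a < a0 -> `|X a t| <= e.
Hypothesis Xoo : forall e : R, 0 < e ->
  exists2 b0 : R, 0 < b0 & forall b t : R, b0 < b -> `|X b t| <= e.
Hypothesis ck : continuous k.

Let within_seg (f : R -> R -> R) a b t : cont2 f -> 0 < a ->
  {within `[a, b], continuous (f ^~ t)}.
Proof.
move=> cf a0; apply: continuous_in_subspaceT => r /set_mem/=.
rewrite in_itv/= => /andP[ar _].
by apply: cont2_slice_fst => //; exact: lt_le_trans ar.
Qed.

Let Phi t := \int[mu]_(r in @half_line R) F r t.

Lemma half_line_integrable t : mu.-integrable (@half_line R) (EFin \o F ^~ t).
Proof.
apply: (le_integrable (@measurable_half_line R) _ _ (integrable_half_line_oneDsqrV M)).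
- apply/measurable_EFinP; apply: open_continuous_measurable_fun.
    by rewrite half_lineE; exact: interval_open.
  by move=> r /set_mem/= r0; exact: cont2_slice_fst.
- move=> r /= r0; rewrite lee_fin (le_trans (FM t r0))//.
  exact: ler_norm.
Qed.

Let I : set R := `](-1), (2 * pi + 1)[%classic.

Let circleI t : 0 <= t <= 2 * pi -> I t.
Proof. by move=> /andP[t0 t1]; rewrite /I /= in_itv/=; apply/andP; split; lra. Qed.

Lemma half_line_integral_continuous :
  {in I, continuous Phi}.
Proof.
apply: (@continuity_under_integral _ _ _ mu (fun t r => F r t) _ _ (-1) (2 * pi + 1)
  _ _ (fun r => M * (oneDsqr r)^-1)).
- exact: (@measurable_half_line R).
- by move=> t _; exact: half_line_integrable.
- by apply/aeW => r r0 t _; exact: cont2_slice_snd.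
- exact: integrable_half_line_oneDsqrV.
- by move=> t _; apply/aeW => r r0; exact: FM.
Qed.

Section Truncated.
Variables a b : R.
Hypotheses (a0 : 0 < a) (ab : a < b).

Let Xi t := \int[mu]_(r in `[a, b]) Y r t.
Let dXi t := \int[mu]_(r in `[a, b]) dY r t.

Let dY_bound : exists2 K, 0 <= K & forall r t, `[a, b]%classic r -> I t -> `|dY r t| <= K.
Proof.
have [K K0 HK] := @cont2_bounded _ dY a b (-1) (2 * pi + 1) cdY a0.
exists K => // r t /=; rewrite /I/= !in_itv/= => abr /andP[t1 t2].
by apply: HK => //; rewrite !ltW.
Qed.

Hypothesis wY : forall t, {within `[a, b], continuous (Y ^~ t)}.

Lemma truncated_derive t : 0 <= t <= 2 * pi -> is_derive t 1 Xi (dXi t).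
Proof.
move=> tc; have [K K0 HK] := dY_bound.
have dE r s : 0 < r -> derive1 (Y r) s = dY r s.
  move=> r0; rewrite derive1E.
  by have [_ ->] : is_derive s 1 (Y r) (dY r s) by exact: hY.
have r0 (r : R) : `[a, b]%classic r -> 0 < r.
  by rewrite /= in_itv/= => /andP[ar _]; exact: lt_le_trans ar.
have mab : measurable (`[a, b]%classic : set (measurableTypeR R)) by [].
have Yi s : I s -> mu.-integrable `[a, b] (EFin \o (fun r => Y r s)).
  by move=> _; exact: segment_integrable.
have Yd s r : I s -> `[a, b]%classic r -> derivable (Y r) s 1.
  by move=> _ abr; have [] := hY s (r0 _ abr).
have Ki : mu.-integrable `[a, b] (EFin \o (fun=> K)).
  by apply: continuous_segment_integrable; exact: cst_continuous.
have KG s r : I s -> `[a, b]%classic r ->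
    `|partial1of2 (fun t r => Y r t) s r| <= K.
  by move=> Is abr; rewrite /partial1of2 dE ?HK//; exact: r0.
split.
  exact: (@derivable_under_integral _ _ _ mu (fun t r => Y r t) _ mab t
    (-1) (2 * pi + 1) (circleI tc) Yi Yd (fun=> K) (fun=> K0) Ki KG).
rewrite -derive1E.
rewrite (@differentiation_under_integral _ _ _ mu (fun t r => Y r t) _ mab t
    (-1) (2 * pi + 1) (circleI tc) Yi Yd (fun=> K) (fun=> K0) Ki KG).
apply: eq_Rintegral => r /set_mem abr.
by rewrite /partial1of2 dE//; exact: r0.
Qed.

Lemma truncated_continuous : {in I, continuous dXi}.
Proof.
have [K K0 HK] := dY_bound.
apply: (@continuity_under_integral _ _ _ mu (fun t r => dY r t) _ _ (-1) (2 * pi + 1)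
  _ _ (fun=> K)) => //.
- by move=> t _; apply: segment_integrable; exact: within_seg.
- apply/aeW => r; rewrite /= in_itv/= => /andP[ar _] t _.
  by apply: cont2_slice_snd => //; exact: lt_le_trans ar.
- by apply: continuous_segment_integrable; exact: cst_continuous.
- by move=> t It; apply/aeW => r abr; exact: HK.
Qed.

Lemma truncated_pointwise t :
  `|Phi t - dXi t| <=
    M * (pi / 2 - (atan b - atan a)) + (`|X b t| + `|X a t|) + k t.
Proof.
have r0 (r : R) : `[a, b]%classic r -> 0 < r.
  by rewrite /= in_itv/= => /andP[ar _]; exact: lt_le_trans ar.
have mab : measurable (`[a, b]%classic : set (measurableTypeR R)) by [].
have iF : mu.-integrable `[a, b] (EFin \o F ^~ t) by apply: segment_integrable; exact: within_seg.
have iX : mu.-integrable `[a, b] (EFin \o dX ^~ t) by apply: segment_integrable; exact: within_seg.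
have iY : mu.-integrable `[a, b] (EFin \o dY ^~ t) by apply: segment_integrable; exact: within_seg.
have iT : mu.-integrable `[a, b] (EFin \o dT ^~ t) by apply: segment_integrable; exact: within_seg.
have iFX : mu.-integrable `[a, b] (EFin \o (fun r => F r t - dX r t)).
  by have := integrableB mab iF iX.
have iFXY : mu.-integrable `[a, b] (EFin \o (fun r => F r t - dX r t - dY r t)).
  by have := integrableB mab iFX iY.
have trunc := half_line_truncation a0 ab (half_line_integrable t) (fun r => @FM r t).
have intX : \int[mu]_(r in `[a, b]) dX r t = X b t - X a t.
  apply: (Rintegral_is_derive (F := X ^~ t)) => //; first exact: within_seg.
  by move=> r /andP[ar _]; apply: hX; exact: lt_le_trans ar.
have intT : \int[mu]_(r in `[a, b]) dT r t = T b t - T a t.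
  apply: (Rintegral_is_derive (F := T ^~ t)) => //; first exact: within_seg.
  by move=> r /andP[ar _]; apply: hT; exact: lt_le_trans ar.
have intR : `|\int[mu]_(r in `[a, b]) (F r t - dX r t - dY r t)| <= k t.
  apply: le_trans (le_normr_Rintegral mab iFXY) _.
  apply: (le_trans _ (Tk t a0 ab)); rewrite -intT.
  apply: le_Rintegral => //; first exact: (integrable_norm iFXY).
  by move=> r abr; apply: res; exact: r0.
have {intR} : `|\int[mu]_(r in `[a, b]) F r t - (X b t - X a t) - dXi t| <= k t.
  by move: intR; rewrite RintegralB// RintegralB// intX.
move=> h3.
rewrite (_ : Phi t - dXi t = (Phi t - \int[mu]_(r in `[a, b]) F r t) +
  (X b t - X a t) + (\int[mu]_(r in `[a, b]) F r t - (X b t - X a t) - dXi t)); last by ring.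
apply: le_trans (ler_normD _ _) _; apply: lerD => //.
apply: le_trans (ler_normD _ _) _; apply: lerD => //.
exact: ler_normB.
Qed.

End Truncated.

(** The integral of [F = X_r + Y_t + rest] over the half strip: the divergence
    part contributes nothing because [X] vanishes at both ends and [Y] is
    periodic, while the rest is dominated by an exact [r]-derivative. Since no
    integrability of [X_r] or [Y_t] near [r = 0] and [r = +oo] is available, the
    argument is run on [a <= r <= b] first. *)
Lemma divergence_bound :
  (forall r t : R, 0 < r -> {for r, continuous (Y ^~ t)}) ->
  `|\int[mu]_(t in @circle R) \int[mu]_(r in @half_line R) F r t| <=
    \int[mu]_(t in `[0, 2 * pi]) k t.
Proof.
move=> cY; rewrite circleE.
have pi20 : (0 : R) < 2 * pi by rewrite mulr_gt0// pi_gt0.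
have mc : measurable (`[0, 2 * pi]%classic : set (measurableTypeR R)) by [].
have wI (f : R -> R) : {in I, continuous f} -> {within `[0, 2 * pi], continuous f}.
  move=> cf; apply: continuous_in_subspaceT => t /set_mem/=.
  by rewrite in_itv/= => tc; apply: cf; apply/mem_set; exact: circleI.
have M0 : 0 <= M.
  have := @FM 1 0 ltr01; rewrite /oneDsqr => /(le_trans (normr_ge0 _)).
  by rewrite pmulr_lge0// invr_gt0 expr1n addr_gt0.
apply/ler_addgt0Pl => e e0.
(* On a circle of length [2 * pi], the error [e] is shared by four terms: the
   boundary values of [X] and the truncated tails of [F], at either end. *)
pose e1 := e / (2 * pi) / 4.
have e10 : 0 < e1 by rewrite !divr_gt0.
have [a1 a10 Xa] := X0 e10.
have [b1 b10 Xb] := Xoo e10.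
have e20 : 0 < e1 / (M + 1) by rewrite divr_gt0// ltr_pwDr.
have [a2 a20 Ha2] : exists2 a2 : R, 0 < a2 & forall a : R, 0 < a -> a < a2 -> M * atan a <= e1.
  have /cvgrPdist_le /(_ _ e20)[d /= d0 Hd] := @continuous_atan R 0.
  exists d => // a ap ad; have := Hd a; rewrite /= atan0 !sub0r !normrN.
  rewrite gtr0_norm// => /(_ ad) h.
  apply: le_trans (_ : (M + 1) * `|atan a| <= _).
    apply: le_trans (_ : M * `|atan a| <= _); first by rewrite ler_wpM2l// ler_norm.
    by rewrite ler_wpM2r// lerDl.
  by rewrite mulrC -ler_pdivlMr// ltr_pwDr.
have [b2 Hb2] : exists b2 : R, forall b : R, b2 < b -> M * (pi / 2 - atan b) <= e1.
  have /cvgrPdist_le /(_ _ e20)[d [dr Hd]] := @cvgy_atan R.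
  exists d => b db; have h := Hd _ db.
  apply: le_trans (_ : (M + 1) * `|pi / 2 - atan b| <= _).
    apply: le_trans (_ : M * `|pi / 2 - atan b| <= _); first by rewrite ler_wpM2l// ler_norm.
    by rewrite ler_wpM2r// lerDl.
  by rewrite mulrC -ler_pdivlMr// ltr_pwDr.
pose a := Num.min a1 a2 / 2.
have m0 : 0 < Num.min a1 a2 by rewrite lt_min a10.
have a0 : 0 < a by rewrite divr_gt0.
have am : a < Num.min a1 a2 by rewrite ltr_pdivrMr// ltr_pMr// ltr1n.
have [aa1 aa2] : a < a1 /\ a < a2 by move: am; rewrite lt_min => /andP[].
pose b := Num.max (Num.max b1 b2) a + 1.
have bm : Num.max (Num.max b1 b2) a < b by rewrite ltrDl.
have [bb1 bb2 ab] : [/\ b1 < b, b2 < b & a < b].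
  by move: bm; rewrite !gt_max => /andP[/andP[? ?] ?].
have wY t : {within `[a, b], continuous (Y ^~ t)}.
  apply: continuous_in_subspaceT => r /set_mem/=; rewrite in_itv/= => /andP[ar _].
  by apply: cY; exact: lt_le_trans ar.
pose dXi t := \int[mu]_(r in `[a, b]) dY r t.
have iPhi : mu.-integrable `[0, 2 * pi] (EFin \o Phi).
  by apply: segment_integrable; apply: wI; exact: half_line_integral_continuous.
have iXi : mu.-integrable `[0, 2 * pi] (EFin \o dXi).
  by apply: segment_integrable; apply: wI; exact: truncated_continuous.
have Xi0 : \int[mu]_(t in `[0, 2 * pi]) dXi t = 0.
  pose Xi t := \int[mu]_(r in `[a, b]) Y r t.
  have -> : \int[mu]_(t in `[0, 2 * pi]) dXi t = Xi (2 * pi) - Xi 0.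
    apply: (Rintegral_is_derive (F := Xi)) => //.
      by apply: wI; exact: truncated_continuous.
    by move=> t tc; exact: truncated_derive.
  apply/eqP; rewrite subr_eq0; apply/eqP.
  apply: eq_Rintegral => r /set_mem/=; rewrite in_itv/= => /andP[ar _].
  by rewrite -[in LHS](add0r (2 * pi)) perY//; exact: lt_le_trans ar.
have -> : \int[mu]_(t in `[0, 2 * pi]) \int[mu]_(r in @half_line R) F r t =
    \int[mu]_(t in `[0, 2 * pi]) (Phi t - dXi t).
  by rewrite RintegralB// Xi0 subr0.
have iPX : mu.-integrable `[0, 2 * pi] (EFin \o (fun t => Phi t - dXi t)).
  by have := integrableB mc iPhi iXi.
have ik : mu.-integrable `[0, 2 * pi] (EFin \o k) by exact: continuous_segment_integrable.
have ie : mu.-integrable `[0, 2 * pi] (EFin \o (fun=> 4 * e1)).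
  by apply: continuous_segment_integrable; exact: cst_continuous.
apply: le_trans (le_normr_Rintegral mc iPX) _.
apply: le_trans (_ : \int[mu]_(t in `[0, 2 * pi]) (4 * e1 + k t) <= _).
  apply: le_Rintegral => //.
  - exact: (integrable_norm iPX).
  - by have := integrableD mc ie ik.
  - move=> t _; apply: le_trans (truncated_pointwise a0 ab t) _.
    apply: lerD => //.
    have h1 := Xa a t a0 aa1; have h2 := Xb b t bb1.
    have h3 := Ha2 _ a0 aa2; have h4 := Hb2 _ bb2.
    rewrite (_ : M * _ = M * (pi / 2 - atan b) + M * atan a); last by ring.
    lra.
rewrite RintegralD// lerD2r Rintegral_segment_cst// subr0.
rewrite (_ : 4 * _ * _ = e) // /e1.
by move: (lt0r_neq0 (pi_gt0 R)); move: (@pi R) => p p0; field.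
Qed.

End Divergence.

(** * The cut-off reciprocal *)

Section Cutoff.
Variable R : realType.
Implicit Types (x y D e : R).

(** Differentiability from a quadratic remainder, which both branches of a
    [C^1] function defined by cases satisfy at their junction. *)
Lemma der_quadratic (f : R -> R) x a K :
  (forall y, `|f y - f x - a * (y - x)| <= K * (y - x) ^+ 2) ->
  is_derive x 1 f a.
Proof.
move=> H.
have K0 : 0 <= K.
  have := H (x + 1); rewrite (_ : x + 1 - x = 1) ?expr1n ?mulr1; last by ring.
  exact: le_trans.
have cv : h^-1 *: ((f \o shift x) (h *: (1 : R)) - f x) @[h --> 0^'] --> a.
  apply/cvgrPdist_le => ep ep0.
  near=> h.
  have h0 : h != 0 by near: h; exact: nbhs_dnbhs_neq.
  rewrite /= /GRing.scale/= mulr1.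
  have -> : a - h^-1 * (f (h + x) - f x) = - (h^-1 * (f (h + x) - f x - a * h)).
    by field.
  rewrite normrN normrM normfV ler_pdivrMl ?normr_gt0//.
  have := H (h + x); rewrite addrK => /le_trans; apply.
  rewrite -real_normK ?num_real// expr2 mulrCA ler_wpM2l//.
  have hk : `|h| <= ep / (K + 1).
    near: h; apply: dnbhs0_le; rewrite divr_gt0// ltr_pwDr//.
  apply: le_trans (ler_wpM2l K0 hk) _.
  rewrite mulrCA ler_piMr ?(ltW ep0)// ler_pdivrMr ?mul1r ?lerDl//.
  by rewrite ltr_pwDr.
split; first exact: cvgP cv.
exact: cvg_lim cv.
Unshelve. all: by end_near. Qed.

(** A [C^1] substitute for [D^-1]: equal to it for [D >= e], affine below. *)
Definition cutV e D : R := (Num.max D e)^-1 + Num.max (e - D) 0 / e ^+ 2.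

Definition dcutV e D : R := - (Num.max D e ^+ 2)^-1.

(** What remains of [1] after multiplying [D] by its cut-off reciprocal. *)
Definition cutoff e D : R := (Num.max (e - D) 0 / e) ^+ 2.

Lemma cutV_ge e D : e <= D -> cutV e D = D^-1.
Proof.
by move=> eD; rewrite /cutV (max_idPl eD) (max_idPr _) ?subr_le0// mul0r addr0.
Qed.

Lemma cutV_le e D : 0 < e -> D <= e -> cutV e D = (2 * e - D) / e ^+ 2.
Proof.
move=> e0 De; rewrite /cutV (max_idPr De) (max_idPl _) ?subr_ge0//.
by field; rewrite gt_eqF.
Qed.

Lemma der_cutV e D : 0 < e -> is_derive D 1 (cutV e) (dcutV e D).
Proof.
move=> e0; apply: (@der_quadratic _ _ _ (2 / e ^+ 3)) => y; rewrite /dcutV.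
have e3 : 0 < e ^+ 3 by rewrite exprn_gt0.
have en : e != 0 by rewrite gt_eqF.
have [De|eD] := leP D e; have [ye|ey] := leP y e.
- rewrite ?(max_idPr De) !cutV_le//.
  rewrite (_ : _ - _ - _ = 0); last by field.
  by rewrite normr0 mulr_ge0// ?sqr_ge0// divr_ge0// ltW.
- have yn : y != 0 by rewrite gt_eqF// (lt_trans e0).
  have y0 : 0 < y by exact: lt_trans ey.
  rewrite ?(max_idPr De) (cutV_le e0 De) cutV_ge ?(ltW ey)//.
  rewrite (_ : _ - _ - _ = (y - e) ^+ 2 / (y * e ^+ 2)); last by field; rewrite en yn.
  have ye2 : 0 < y * e ^+ 2 by rewrite mulr_gt0 ?exprn_gt0.
  rewrite ger0_norm; last by rewrite divr_ge0 ?sqr_ge0 ?(ltW ye2).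
  apply: le_trans (_ : (y - D) ^+ 2 / e ^+ 3 <= _).
    apply: ler_pM; [exact: sqr_ge0|by rewrite invr_ge0 ltW| |].
      by rewrite lerXn2r ?nnegrE; lra.
    rewrite lef_pV2 ?posrE//.
    by rewrite exprS ler_wpM2r ?sqr_ge0// ltW.
  rewrite [leRHS]mulrAC ler_wpM2r ?invr_ge0 ?(ltW e3)//.
  by rewrite ler_peMl ?sqr_ge0// ler1n.
- have D0 : 0 < D by exact: lt_trans eD.
  have Dn : D != 0 by rewrite gt_eqF.
  rewrite ?(max_idPl (ltW eD)) (cutV_ge (ltW eD)) (cutV_le e0 ye).
  rewrite (_ : _ - _ - _ = (D - e) / (e * D) * ((e - y) / e + (D - y) / D)); last first.
    by field; rewrite en Dn.
  have h1 : 0 <= (D - e) / (e * D) by rewrite divr_ge0 ?mulr_ge0//; lra.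
  have h2 : 0 <= (e - y) / e + (D - y) / D by rewrite addr_ge0// divr_ge0//; lra.
  rewrite ger0_norm; last exact: mulr_ge0.
  apply: le_trans (_ : ((D - y) / e ^+ 2) * ((D - y) / e + (D - y) / e) <= _); last first.
    rewrite le_eqVlt; apply/orP; left; apply/eqP; field; exact: en.
  apply: ler_pM => //.
    apply: ler_pM; [lra|by rewrite invr_ge0 mulr_ge0 ?ltW|lra|].
    by rewrite lef_pV2 ?posrE ?mulr_gt0 ?exprn_gt0// expr2 ler_wpM2l// ltW.
  apply: lerD; first by rewrite ler_wpM2r ?invr_ge0 ?(ltW e0)//; lra.
  apply: ler_wpM2l; first lra.
  by rewrite lef_pV2 ?posrE// ltW.
- have D0 : 0 < D by exact: lt_trans eD.
  have y0 : 0 < y by exact: lt_trans ey.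
  rewrite ?(max_idPl (ltW eD)) (cutV_ge (ltW eD)) (cutV_ge (ltW ey)).
  rewrite (_ : _ - _ - _ = (y - D) ^+ 2 / (y * D ^+ 2)); last first.
    by field; rewrite !gt_eqF.
  have yD2 : 0 < y * D ^+ 2 by rewrite mulr_gt0 ?exprn_gt0.
  rewrite ger0_norm; last by rewrite divr_ge0 ?sqr_ge0 ?(ltW yD2).
  rewrite [leRHS]mulrC ler_wpM2l ?sqr_ge0//.
  apply: le_trans (_ : 1 / e ^+ 3 <= _); last first.
    by rewrite ler_wpM2r ?invr_ge0 ?(ltW e3)//; lra.
  rewrite mul1r lef_pV2 ?posrE//.
  rewrite exprS ler_pM ?sqr_ge0 ?(ltW e0) ?(ltW ey)//.
  by rewrite lerXn2r ?nnegrE ?(ltW D0) ?(ltW e0) ?(ltW eD).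
Qed.

Lemma dcutV_continuous e : 0 < e -> continuous (dcutV e).
Proof.
move=> e0 D; rewrite (_ : dcutV e = (fun D : R => - (Num.max D e ^+ 2)^-1)) //.
suff : {for D, continuous (fun D : R => - (Num.max D e ^+ 2)^-1)} by [].
apply: continuousN; apply: continuousV.
  by rewrite expf_neq0// gt_eqF// lt_max e0 orbT.
apply: (@continuous_comp _ _ _ (fun D => Num.max D e) (fun x => x ^+ 2)).
  by apply: continuous_max => //; exact: cst_continuous.
exact: exprn_continuous.
Qed.

Lemma mul_cutV e D : 0 < e -> D * cutV e D = 1 - cutoff e D.
Proof.
move=> e0; have en : e != 0 by rewrite gt_eqF.
have [De|eD] := leP D e.
  by rewrite cutV_le// /cutoff (max_idPl _) ?subr_ge0//; field.
rewrite cutV_ge ?(ltW eD)// mulfV ?gt_eqF ?(lt_trans e0)//.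
by rewrite /cutoff (max_idPr _) ?subr_le0 ?(ltW eD)// mul0r expr0n subr0.
Qed.

Lemma cutoff_bound e D : 0 < e -> 0 <= D ->
  0 <= cutoff e D <= ((D < e)%R : nat)%:R.
Proof.
move=> e0 D0; rewrite /cutoff sqr_ge0/=; have [De|eD] := ltP D e.
  rewrite ?(max_idPl _) ?subr_ge0 ?(ltW De)// expr_le1//; last first.
    by apply: divr_ge0; [rewrite subr_ge0; exact: ltW|exact: ltW].
  by rewrite ler_pdivrMr// mul1r; lra.
by rewrite ?(max_idPr _) ?subr_le0// mul0r expr0n.
Qed.

Lemma cutV_bound e D : 0 < e -> 0 <= D ->
  0 <= cutV e D <= 2 / Num.max D e.
Proof.
move=> e0 D0; have en : e != 0 by rewrite gt_eqF.
have [De|eD] := leP D e.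
  rewrite cutV_le//; apply/andP; split.
    by rewrite divr_ge0 ?sqr_ge0//; lra.
  rewrite ler_pdivrMr ?exprn_gt0// (_ : 2 / e * e ^+ 2 = 2 * e); last by field.
  lra.
have D1 : 0 < D by exact: lt_trans eD.
rewrite cutV_ge ?(ltW eD)// invr_ge0 D0/= ler_peMl ?invr_ge0//.
by rewrite ler1n.
Qed.

End Cutoff.

(** * Pointwise estimates for the remainder *)

Section Pointwise.
Variable R : realType.
Implicit Types (x y p q r : R).

Lemma normr_le_sqr x y : 0 <= y -> x ^+ 2 <= y ^+ 2 -> `|x| <= y.
Proof.
by move=> y0 xy; rewrite -(@ler_pXn2r _ 2) ?nnegrE// real_normK ?num_real.
Qed.

Lemma le_of_sqr x y : 0 <= y -> x ^+ 2 <= y ^+ 2 -> x <= y.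
Proof. by move=> y0 /(normr_le_sqr y0); exact: le_trans (ler_norm x). Qed.

Lemma sqr_le x y : 0 <= x -> x <= y -> x ^+ 2 <= y ^+ 2.
Proof. by move=> x0 xy; rewrite lerXn2r// nnegrE (le_trans x0). Qed.

Lemma cauchy_schwarz2 (a b c d P Q : R) : 0 <= P -> 0 <= Q ->
  a ^+ 2 + b ^+ 2 <= P ^+ 2 -> c ^+ 2 + d ^+ 2 <= Q ^+ 2 ->
  `|a * c + b * d| <= P * Q.
Proof.
move=> P0 Q0 hP hQ; apply: normr_le_sqr; first exact: mulr_ge0.
rewrite exprMn; apply: le_trans (_ : (a ^+ 2 + b ^+ 2) * (c ^+ 2 + d ^+ 2) <= _).
  rewrite -subr_ge0 (_ : _ - _ = (a * d - b * c) ^+ 2); first exact: sqr_ge0.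
  by ring.
by apply: ler_pM; rewrite ?addr_ge0 ?sqr_ge0.
Qed.

(** In this lemma [x] and [y] are the radial and angular components of the
    gradient of the phase, [U] and [F] are the two trigonometric combinations of
    the amplitude, [A], [A1], [A2] bound the amplitude and its derivatives, and
    [d] is the length of the gradient cut off at [sqrt e]. Integrating by parts
    along the gradient leaves its divergence [c1], the derivative [c2] of [D]
    along it, and the derivatives of the amplitude. By the Cauchy-Schwarz
    inequality in the plane [c2] is of order [d ^ 2 (p + q) / r ^ 3], so that
    after division by [d ^ 4] it is no worse than [c1] divided by [d ^ 2]. *)
Lemma residual_bound (r x y h h1 h2 e U F U1 U2 A A1 A2 p q
    D d xr yt Dr Dt : R) :
  0 < r -> 0 < e -> 0 <= p -> 0 <= q ->
  p ^+ 2 = h ^+ 2 + h1 ^+ 2 -> q ^+ 2 = (h - h2) ^+ 2 + (2 * h1) ^+ 2 ->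
  `|U| <= A -> `|F| <= A -> `|U1| <= A1 -> `|U2| <= A2 ->
  D = x ^+ 2 + y ^+ 2 ->
  d = Num.sqrt (Num.max D e) ->
  xr = 2 * h / r ^+ 3 ->
  yt = - x + (h2 - h) / r ^+ 2 ->
  Dr = 4 * (x * h - y * h1) / r ^+ 3 ->
  Dt = - (2 * (x * (2 * h1) + y * (h - h2)) / r ^+ 2) ->
  `|F - (xr * cutV e D * U + x * (dcutV e D * Dr) * U + x * cutV e D * (x * F + U1))
      - (yt / r * cutV e D * U + y / r * (dcutV e D * Dt) * U
         + y / r * cutV e D * (r * y * F + U2))| <=
  ((D < e)%R : nat)%:R * A + (2 / (r * d) + 8 * (p + q) / (r ^+ 3 * d ^+ 2)) * A
  + 2 / d * A1 + 2 / (r * d) * A2.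
Proof.
move=> r0 e0 p0 q0 pE qE UA FA U1A U2A DE dD xrE ytE DrE DtE.
have A0 : 0 <= A by exact: le_trans UA.
have A10 : 0 <= A1 by exact: le_trans U1A.
have A20 : 0 <= A2 by exact: le_trans U2A.
have D0 : 0 <= D by rewrite DE addr_ge0 ?sqr_ge0.
have M0 : 0 < Num.max D e by rewrite lt_max e0 orbT.
have d0 : 0 < d by rewrite dD sqrtr_gt0.
have dE : d ^+ 2 = Num.max D e by rewrite dD sqr_sqrtr// ltW.
have Dd : D <= d ^+ 2 by rewrite dE le_max lexx.
have xyd : x ^+ 2 + y ^+ 2 <= d ^+ 2 by rewrite -DE.
have d0' := ltW d0.
have rn : r != 0 by rewrite gt_eqF.
have dn : d != 0 by rewrite gt_eqF.
have xd : `|x| <= d.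
  apply: normr_le_sqr; first exact: ltW.
  by apply: le_trans Dd; rewrite DE lerDl sqr_ge0.
have yd : `|y| <= d.
  apply: normr_le_sqr; first exact: ltW.
  by apply: le_trans Dd; rewrite DE lerDr sqr_ge0.
have [ph0 phd] : 0 <= cutV e D /\ cutV e D <= 2 / d ^+ 2.
  by apply/andP; rewrite dE; exact: cutV_bound.
have dphE : dcutV e D = - (d ^+ 4)^-1.
  by rewrite /dcutV -dE -exprM.
have hp : `|h| <= p by apply: normr_le_sqr => //; rewrite pE lerDl sqr_ge0.
have hh : `|h + h2| <= 2 * p + q.
  have -> : h + h2 = 2 * h - (h - h2) by ring.
  apply: le_trans (ler_normB _ _) _; apply: lerD.
    by rewrite normrM ger0_norm// ler_wpM2l.
  by apply: normr_le_sqr => //; rewrite qE lerDl sqr_ge0.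
have xh : `|x * h - y * h1| <= d * p.
  rewrite (_ : _ - _ = x * h + y * (- h1)); last by ring.
  by apply: cauchy_schwarz2 => //; rewrite sqrrN pE.
have xh2 : `|x * (2 * h1) + y * (h - h2)| <= d * q.
  by apply: cauchy_schwarz2 => //; rewrite qE addrC.
have r3 : 0 < r ^+ 3 by rewrite exprn_gt0.
pose c1 := - (x / r) + (h + h2) / r ^+ 3.
pose c2 := x * Dr + y / r * Dt.
(* The terms in [F] add up to [D * cutV e D * F], since [x ^ 2 + y ^ 2 = D]. *)
have -> : F - (xr * cutV e D * U + x * (dcutV e D * Dr) * U + x * cutV e D * (x * F + U1))
      - (yt / r * cutV e D * U + y / r * (dcutV e D * Dt) * U
         + y / r * cutV e D * (r * y * F + U2)) =
    (1 - D * cutV e D) * F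
    - (cutV e D * c1 + dcutV e D * c2) * U - cutV e D * (x * U1 + y / r * U2).
  rewrite /c1 /c2 xrE ytE [D in 1 - D * _]DE.
  by move: (cutV e D) (dcutV e D) => P Q; field.
rewrite mul_cutV// (_ : 1 - (1 - cutoff e D) = cutoff e D); last by ring.
have [cu0 cu1] : 0 <= cutoff e D /\ cutoff e D <= ((D < e)%R : nat)%:R.
  by apply/andP; exact: cutoff_bound.
have t1 : `|cutoff e D * F| <= ((D < e)%R : nat)%:R * A.
  by rewrite normrM (ger0_norm cu0) ler_pM.
have c1b : `|c1| <= d / r + (2 * p + q) / r ^+ 3.
  apply: le_trans (ler_normD _ _) _; apply: lerD.
    by rewrite normrN normrM normfV (gtr0_norm r0) ler_wpM2r// invr_ge0 ltW.
  by rewrite normrM normfV (gtr0_norm r3) ler_wpM2r// invr_ge0 ltW.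
have c2b : `|c2| <= d ^+ 2 * (4 * p + 2 * q) / r ^+ 3.
  rewrite /c2 DrE DtE.
  have -> : d ^+ 2 * (4 * p + 2 * q) / r ^+ 3 =
      d * (4 * (d * p) / r ^+ 3) + d / r * (2 * (d * q) / r ^+ 2) by field.
  apply: le_trans (ler_normD _ _) _; rewrite !normrM; apply: lerD.
    apply: ler_pM => //; rewrite normfV (gtr0_norm r3) ler_wpM2r ?invr_ge0 ?(ltW r3)//.
    by rewrite ger0_norm// ler_wpM2l.
  apply: ler_pM => //.
    by rewrite normfV (gtr0_norm r0) ler_wpM2r// invr_ge0 ltW.
  rewrite normrN !normrM normfV (gtr0_norm (_ : 0 < r ^+ 2)) ?exprn_gt0//.
  rewrite ler_wpM2r ?invr_ge0 ?sqr_ge0//.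
  by rewrite ger0_norm// ler_wpM2l.
have t2 : `|(cutV e D * c1 + dcutV e D * c2) * U| <=
    (2 / (r * d) + 8 * (p + q) / (r ^+ 3 * d ^+ 2)) * A.
  rewrite normrM; apply: ler_pM => //.
  apply: le_trans (_ : 2 / d ^+ 2 * (d / r + (2 * p + q) / r ^+ 3) +
     (d ^+ 4)^-1 * (d ^+ 2 * (4 * p + 2 * q) / r ^+ 3) <= _).
    apply: le_trans (ler_normD _ _) _; rewrite !normrM; apply: lerD.
      by apply: ler_pM => //; rewrite ger0_norm.
    rewrite dphE normrN normfV (gtr0_norm (_ : 0 < d ^+ 4)) ?exprn_gt0//.
    by rewrite ler_wpM2l// invr_ge0 exprn_ge0 ?ltW.
  rewrite -subr_ge0 (_ : _ - _ = 4 * q / (r ^+ 3 * d ^+ 2)); last by field; rewrite rn dn.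
  by apply: divr_ge0; rewrite mulr_ge0 ?sqr_ge0// ltW.
have t3 : `|cutV e D * (x * U1 + y / r * U2)| <= 2 / d * A1 + 2 / (r * d) * A2.
  have -> : 2 / d * A1 + 2 / (r * d) * A2 = 2 / d ^+ 2 * (d * A1 + d / r * A2).
    by field; rewrite rn dn.
  rewrite normrM; apply: ler_pM => //; first by rewrite ger0_norm.
  apply: le_trans (ler_normD _ _) _; rewrite !normrM; apply: lerD; first exact: ler_pM.
  apply: ler_pM => //.
  by rewrite normfV (gtr0_norm r0) ler_wpM2r// invr_ge0 ltW.
apply: le_trans (ler_normB _ _) _; rewrite -[leRHS]addrA lerD//.
by apply: le_trans (ler_normB _ _) _; rewrite lerD.
Qed.

End Pointwise.

Section Kernels.
Variable R : realType.

(** With [s = p / r ^ 2], this is minus the derivative in [r] of the arctangent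
    of [(s - rho * c) / lam], divided by [lam], where
    [lam ^ 2 = eps ^ 2 + rho ^ 2 (1 - c ^ 2)]. *)
Definition angle_kernel (rho eps p c r : R) : R :=
  (2 * (p / r ^+ 2) / r) /
  (eps ^+ 2 + rho ^+ 2 * (1 - c ^+ 2) + (p / r ^+ 2 - rho * c) ^+ 2).

(** The quotient [(s - rho) / (s + rho)] at [s = p / r ^ 2]: it measures the
    relative distance to the resonance and, unlike [s], it is bounded. *)
Definition mobius (rho p r : R) : R := (p - rho * r ^+ 2) / (p + rho * r ^+ 2).

(** Minus the derivative in [r] of [asinh ((rho + 2) * mobius rho p r)]. *)
Definition radial_kernel (rho p r : R) : R :=
  (rho + 2) * (4 * p * rho * r / (p + rho * r ^+ 2) ^+ 2) /
  Num.sqrt (1 + ((rho + 2) * mobius rho p r) ^+ 2).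

(** For [s] comparable to [rho] the derivative of [mobius] is of size [1 / r],
    while [rho] times [mobius] is at most of size [|s - rho| <= d]. *)
Lemma near_radial_kernel (rho p r d : R) : 0 < rho -> 0 < p -> 0 < r ->
  rho / 2 <= p / r ^+ 2 <= 3 / 2 * rho ->
  0 < d -> (rho / (rho + 2)) ^+ 2 <= d ^+ 2 -> (p / r ^+ 2 - rho) ^+ 2 <= d ^+ 2 ->
  (r * d)^-1 <= 3 / rho * radial_kernel rho p r.
Proof.
move=> rho0 p0 r0 /andP[s1 s2] d0 ed sd.
have rn : r != 0 by rewrite gt_eqF.
have rhon : rho != 0 by rewrite gt_eqF.
have rho2 : 0 < rho + 2 by rewrite addr_gt0.
have rho2n : rho + 2 != 0 by rewrite gt_eqF.
set s := p / r ^+ 2 in s1 s2 sd.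
have pE : p = s * r ^+ 2 by rewrite /s mulfVK// expf_neq0.
have s0 : 0 < s by rewrite divr_gt0// exprn_gt0.
have srho : 0 < s + rho by rewrite addr_gt0.
have srhon : s + rho != 0 by rewrite gt_eqF.
have prn : s * r ^+ 2 + rho * r ^+ 2 != 0.
  by rewrite -mulrDl mulf_neq0// expf_neq0.
pose tau := mobius rho p r.
have tauE : tau = (s - rho) / (s + rho).
  by rewrite /tau /mobius pE; field; rewrite ?srhon ?rn ?prn.
pose S := Num.sqrt (1 + ((rho + 2) * tau) ^+ 2).
have S1 : 0 < 1 + ((rho + 2) * tau) ^+ 2 by rewrite ltr_pwDl// sqr_ge0.
have S0 : 0 < S by rewrite sqrtr_gt0.
have Sn : S != 0 by rewrite gt_eqF.
have SE : S ^+ 2 = 1 + ((rho + 2) * tau) ^+ 2 by rewrite sqr_sqrtr// ltW.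
have Sd : rho / (rho + 2) * S <= 3 / 2 * d.
  apply: le_of_sqr; first by rewrite !mulr_ge0// ltW.
  rewrite exprMn SE [leRHS]exprMn.
  have h1 : (rho * tau) ^+ 2 <= (s - rho) ^+ 2.
    rewrite tauE mulrCA exprMn ler_piMr ?sqr_ge0// expr_le1// ?divr_ge0 ?ltW//.
    by rewrite ltr_pdivrMr// mul1r ltrDr.
  have h2 : (rho / (rho + 2)) ^+ 2 * (1 + ((rho + 2) * tau) ^+ 2) =
     (rho / (rho + 2)) ^+ 2 + (rho * tau) ^+ 2 by field.
  rewrite h2; have d2 : 0 <= d ^+ 2 := sqr_ge0 d.
  rewrite (_ : (3 / 2) ^+ 2 = 9 / 4 :> R); last by field.
  lra.
have kE : radial_kernel rho p r =
    (rho + 2) * (4 * s * rho / (r * (s + rho) ^+ 2)) / S.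
  rewrite /radial_kernel -/tau -/S; move: (S) Sn => S' Sn'; rewrite pE.
  by field; rewrite ?srhon ?rn ?prn ?Sn'.
have h8 : (s + rho) ^+ 2 <= 8 * s * rho.
  have : 0 <= (s - rho / 2) * (3 / 2 * rho - s) by rewrite mulr_ge0 ?subr_ge0.
  have : 0 <= rho * (s - rho / 2) by rewrite mulr_ge0 ?subr_ge0// ltW.
  nra.
rewrite kE.
apply: le_trans (_ : 3 / rho * ((rho + 2) * (2^-1 / r) / S) <= _); last first.
  rewrite ler_wpM2l ?divr_ge0 ?(ltW rho0)// ler_wpM2r ?invr_ge0 ?(ltW S0)//.
  rewrite ler_wpM2l ?(ltW rho2)//.
  rewrite (_ : 2^-1 / r = 2^-1 * (r * (s + rho) ^+ 2) / (r ^+ 2 * (s + rho) ^+ 2)); last first.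
    by field; rewrite rn srhon.
  rewrite (_ : 4 * s * rho / (r * (s + rho) ^+ 2) =
    4 * s * rho * r / (r ^+ 2 * (s + rho) ^+ 2)); last by field; rewrite rn srhon.
  apply: ler_wpM2r; first by rewrite invr_ge0 mulr_ge0// sqr_ge0.
  rewrite (_ : 4 * s * rho * r = r * (4 * s * rho)); last by ring.
  by rewrite mulrCA; apply: ler_wpM2l; [exact: ltW|lra].
have -> : 3 / rho * ((rho + 2) * (2^-1 / r) / S) =
    3 / 2 * d / (rho / (rho + 2) * S) / (r * d).
  by move: (S) Sn => S' Sn'; field; rewrite ?rn ?rhon ?rho2n ?Sn' ?gt_eqF.
apply: ler_peMl; first by rewrite invr_ge0 ltW// mulr_gt0.
by rewrite ler_pdivlMr ?mul1r// mulr_gt0// divr_gt0.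
Qed.

End Kernels.

Section Regions.
Variable R : realType.

(** The remainder of the integration by parts against exact [r]-derivatives.
    The terms with [1 / d] carry [ff] and [g * mm], those with [1 / d ^ 2] only
    [g * mm]. Far from the resonance [3 d] exceeds [s], which costs nothing more
    than the weight [r / p]. Near it, [ff / d] has a logarithmic primitive, and
    for [g * mm / d ^ 2] the hypothesis on [kap] brings in the factor [om] that
    makes the arctangent bound integrable over the circle later on. *)
Lemma region_bound (rho beta p q g r c mm m1 ff J N kap om D d s : R) :
  0 < rho -> 0 < beta -> 0 < p -> 0 <= q -> 0 < r -> `|c| <= 1 ->
  0 <= mm -> 0 <= ff -> 0 <= J -> 0 <= N -> 0 <= kap -> 0 <= om ->
  m1 <= ff + g * mm -> g = 1 + q / p ->
  s = p / r ^+ 2 -> D = (s - rho * c) ^+ 2 + rho ^+ 2 * (1 - c ^+ 2) ->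
  d = Num.sqrt (Num.max D ((rho / (rho + 2)) ^+ 2)) ->
  J * r `^ (2 * beta) <= 1 -> J * (r * r `^ (2 * beta)) <= 1 -> J * r ^+ 2 <= 1 ->
  g * mm <= kap * (p `^ beta * om) ->
  ((D < (rho / (rho + 2)) ^+ 2)%R : nat)%:R * (N * J * mm)
  + (2 / (r * d) + 8 * (p + q) / (r ^+ 3 * d ^+ 2)) * (N * J * mm)
  + 2 / d * (N * J * mm / r) + 2 / (r * d) * (N * J * (mm + m1)) <=
  N * (96 * ((g * mm + ff) / p) * (r * J)
     + 9 * (ff / p) * radial_kernel rho p r
     + 96 * (3 / 2) `^ beta * (kap * (rho `^ beta * ((rho + 1) / rho)) *
         (om * Num.max c 0)) * angle_kernel rho (rho / (rho + 2)) p c r).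
Proof.
move=> rho0 beta0 p0 q0 r0 c1 mm0 ff0 J0 N0 kap0 om0 m1b gE sE DE dE J1 J2 J3 kb.
have rn : r != 0 by rewrite gt_eqF.
have pn : p != 0 by rewrite gt_eqF.
have rhon : rho != 0 by rewrite gt_eqF.
have rho2 : 0 < rho + 2 by rewrite addr_gt0.
have rho2n : rho + 2 != 0 by rewrite gt_eqF.
set eps := rho / (rho + 2) in dE *.
have eps0 : 0 < eps by rewrite divr_gt0.
have eps1 : eps <= 1 by rewrite ler_pdivrMr// mul1r lerDl.
have epsr : eps < rho / 2.
  by rewrite ltr_pM2l// ltf_pV2 ?posrE// ltrDr.
have e20 : 0 < eps ^+ 2 by rewrite exprn_gt0.
have g1 : 1 <= g by rewrite gE lerDl divr_ge0// ltW.
have g0 : 0 <= g by lra.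
have s0 : 0 < s by rewrite sE divr_gt0// exprn_gt0.
have pE : p = s * r ^+ 2 by rewrite sE mulfVK// expf_neq0.
have D0 : 0 <= D.
  rewrite DE addr_ge0 ?sqr_ge0// mulr_ge0 ?sqr_ge0// subr_ge0.
  by rewrite -real_normK ?num_real// expr_le1.
have M0 : 0 < Num.max D (eps ^+ 2) by rewrite lt_max e20 orbT.
have d0 : 0 < d by rewrite dE sqrtr_gt0.
have dn : d != 0 by rewrite gt_eqF.
have d2E : d ^+ 2 = Num.max D (eps ^+ 2) by rewrite dE sqr_sqrtr// ltW.
have Dd : D <= d ^+ 2 by rewrite d2E le_max lexx.
have ed2 : eps ^+ 2 <= d ^+ 2 by rewrite d2E le_max lexx orbT.
have Ds : (s - rho) ^+ 2 <= D.
  rewrite DE -subr_ge0 (_ : _ - _ = 2 * s * rho * (1 - c)); last by ring.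
  by rewrite !mulr_ge0 ?(ltW s0) ?(ltW rho0)// subr_ge0 (le_trans (ler_norm _)).
have rd0 : 0 < r * d by rewrite mulr_gt0.
have gm : mm <= g * mm by rewrite ler_peMl.
have gmm0 : 0 <= g * mm by rewrite mulr_ge0.
have [r0' p0' rho0' s0'] : [/\ 0 <= r, 0 <= p, 0 <= rho & 0 <= s] by split; exact: ltW.
have rI0 : 0 <= r^-1 by rewrite invr_ge0.
have pI0 : 0 <= p^-1 by rewrite invr_ge0.
have rhoI0 : 0 <= rho^-1 by rewrite invr_ge0.
have d0' := ltW d0.
pose I : R := ((D < eps ^+ 2)%R : nat)%:R.
(* [m1] is eliminated by its bound, and [p + q = g * p]. *)
apply: le_trans (_ : N * (J * (I * mm + 8 * (g * mm) / (r * d) +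
    8 * (g * mm) * s / (r * d ^+ 2) + 2 * ff / (r * d))) <= _).
  rewrite -/I (_ : p + q = g * (s * r ^+ 2)); last first.
    by rewrite -pE gE; field.
  rewrite -subr_ge0 (_ : _ - _ = N * J * (6 * (g * mm - mm) + 2 * (ff + g * mm - m1)) / (r * d)); last first.
    by field; rewrite rn dn.
  rewrite divr_ge0 ?(ltW rd0)// !mulr_ge0// addr_ge0// mulr_ge0//; move: gm m1b; clear; lra.
rewrite ler_wpM2l//.
have rk0 : 0 <= radial_kernel rho p r.
  rewrite /radial_kernel divr_ge0 ?sqrtr_ge0// mulr_ge0 ?(ltW rho2)//.
  rewrite divr_ge0 ?sqr_ge0// !mulr_ge0 ?(ltW p0) ?(ltW rho0) ?(ltW r0)//.
have den : eps ^+ 2 + rho ^+ 2 * (1 - c ^+ 2) + (s - rho * c) ^+ 2 = eps ^+ 2 + D.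
  by rewrite DE; ring.
have eD0 : 0 < eps ^+ 2 + D by rewrite ltr_pwDl.
have ak : angle_kernel rho eps p c r = (2 * s / r) / (eps ^+ 2 + D).
  by rewrite /angle_kernel -sE den.
have ak0 : 0 <= angle_kernel rho eps p c r.
  by rewrite ak divr_ge0 ?(ltW eD0)// divr_ge0 ?mulr_ge0 ?ltW.
pose b := 96 * (3 / 2) `^ beta * (kap * (rho `^ beta * ((rho + 1) / rho)) * (om * Num.max c 0)) *
    angle_kernel rho eps p c r.
have b0 : 0 <= b.
  rewrite /b mulr_ge0// !mulr_ge0 ?powR_ge0 ?invr_ge0 ?(ltW rho0)//; first by lra.
  by rewrite le_max lexx orbT.
rewrite -/b.
have [Dfar|Dnear] := leP (rho ^+ 2 / 4) D.
(* Far from the resonance: [s <= |s - rho| + rho <= 3 d]. *)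
- have rd : rho / 2 <= d.
    apply: le_of_sqr; first exact: ltW.
    by apply: le_trans Dd; rewrite (_ : (rho / 2) ^+ 2 = rho ^+ 2 / 4)//; field.
  have I0 : I = 0.
    rewrite /I ltNge (_ : eps ^+ 2 <= D)//.
    apply: le_trans Dfar; rewrite (_ : _ / 4 = (rho / 2) ^+ 2); last by field.
    by apply: sqr_le; exact: ltW.
  have sd : s <= 3 * d.
    have : `|s - rho| <= d by apply: normr_le_sqr (ltW d0) (le_trans Ds Dd).
    by rewrite ler_norml => /andP[_]; move: rd; clear; lra.
  have h1 : (r * d)^-1 <= 3 * r / p.
    rewrite pE (_ : 3 * r / (s * r ^+ 2) = 3 * d / s / (r * d)); last first.
      by field; rewrite rn dn gt_eqF.
    rewrite ler_peMl ?invr_ge0 ?(ltW rd0)//.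
    by rewrite ler_pdivlMr ?mul1r.
  have h2 : s / (r * d ^+ 2) <= 9 * r / p.
    rewrite pE (_ : 9 * r / (s * r ^+ 2) = (3 * d) ^+ 2 / (s * (r * d ^+ 2))); last first.
      by field; rewrite rn dn gt_eqF.
    rewrite (_ : s / (r * d ^+ 2) = s ^+ 2 / (s * (r * d ^+ 2))); last first.
      by field; rewrite rn dn gt_eqF.
    apply: ler_wpM2r; first by rewrite invr_ge0 !mulr_ge0 ?sqr_ge0 ?ltW.
    by apply: sqr_le => //; exact: ltW.
  have rJ0 : 0 <= r * J by rewrite mulr_ge0// ltW.
  apply: le_trans (_ : 96 * ((g * mm + ff) / p) * (r * J) <= _); last first.
    rewrite -addrA lerDl; apply: addr_ge0 => //.
    by apply: mulr_ge0 => //; rewrite mulr_ge0// divr_ge0// ltW.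
  rewrite I0 mul0r add0r.
  rewrite (_ : 96 * ((g * mm + ff) / p) * (r * J) = J * (96 * (g * mm + ff) * r / p)); last by ring.
  rewrite ler_wpM2l//.
  have k1 : 8 * (g * mm) * (r * d)^-1 <= 8 * (g * mm) * (3 * r / p) by rewrite ler_wpM2l ?mulr_ge0.
  have k2 : 8 * (g * mm) * s / (r * d ^+ 2) <= 8 * (g * mm) * (9 * r / p).
    by rewrite -(mulrA _ s) ler_wpM2l ?mulr_ge0.
  have k3 : 2 * ff * (r * d)^-1 <= 2 * ff * (3 * r / p) by rewrite ler_wpM2l ?mulr_ge0.
  have k4 : 0 <= 90 * ff * (r / p) by rewrite !mulr_ge0.
  apply: le_trans (lerD (lerD k1 k2) k3) _.
  rewrite -subr_ge0 (_ : _ - _ = 90 * ff * (r / p))//.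
  by field.
(* Near the resonance: [s] is comparable to [rho] and the cosine [c] is at
   least [1 / 2], whence [Num.max c 0] can be inserted at the cost of a factor [2]. *)
- have sr : `|s - rho| <= rho / 2.
    apply: normr_le_sqr; first by rewrite divr_ge0 ?ltW.
    rewrite (_ : (rho / 2) ^+ 2 = rho ^+ 2 / 4); last by field.
    exact: le_trans Ds (ltW Dnear).
  have [sr1 sr2] : rho / 2 <= s /\ s <= 3 / 2 * rho.
    by move: sr; clear; rewrite ler_norml => /andP[? ?]; split; lra.
  have ds : d <= s.
    apply: le_trans sr1; apply: le_of_sqr; first by rewrite divr_ge0// ltW.
    rewrite (_ : (rho / 2) ^+ 2 = rho ^+ 2 / 4); last by field.
    rewrite d2E ge_max (ltW Dnear)/= (_ : rho ^+ 2 / 4 = (rho / 2) ^+ 2); last by field.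
    by apply: sqr_le; exact: ltW.
  have c12 : 1 / 2 <= c.
    rewrite leNgt; apply/negP => c12.
    have : rho ^+ 2 / 4 <= D; last by rewrite leNgt Dnear.
    rewrite DE -subr_ge0.
    rewrite (_ : _ - _ = (s - rho / 2) ^+ 2 + 2 * s * rho * (1 / 2 - c) + rho ^+ 2 / 2); last by field.
    by rewrite !addr_ge0 ?sqr_ge0// ?divr_ge0 ?sqr_ge0// !mulr_ge0 ?(ltW s0) ?(ltW rho0)// subr_ge0 ltW.
  have cm : 1 <= 2 * Num.max c 0.
    apply: le_trans (_ : 2 * c <= _); first by move: c12; clear; lra.
    by rewrite ler_wpM2l// le_max lexx.
  pose E := (d ^+ 2)^-1.
  have E0 : 0 <= E by rewrite invr_ge0 sqr_ge0.
  have IE : I <= E.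
    rewrite /I; case: (ltP D (eps ^+ 2)) => // De /=.
    by rewrite /E d2E (max_idPr (ltW De)) invf_ge1// expr_le1// ltW.
  have rdE : (r * d)^-1 <= s / r * E.
    rewrite /E (_ : s / r / d ^+ 2 = s / d / (r * d)); last by field; rewrite rn dn.
    by rewrite ler_peMl ?invr_ge0 ?(ltW rd0)// ler_pdivlMr ?mul1r.
  have EA : E / r <= 4 / rho * Num.max c 0 * angle_kernel rho eps p c r.
    have h1 : E <= 2 / (eps ^+ 2 + D).
      rewrite /E ler_pdivlMr// mulrC ler_pdivrMr ?exprn_gt0//.
      by move: ed2 Dd; clear; lra.
    have h2 : r^-1 <= 2 / rho * (s / r).
      rewrite mulrA ler_peMl ?invr_ge0 ?(ltW r0)// mulrAC ler_pdivlMr//.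
      by move: sr1; clear; lra.
    have h3 : E / r <= 2 / (eps ^+ 2 + D) * (2 / rho * (s / r)).
      by apply: ler_pM => //; rewrite invr_ge0 ltW.
    apply: le_trans h3 _.
    rewrite ak (_ : 4 / rho * Num.max c 0 * (2 * s / r / (eps ^+ 2 + D)) =
      2 * Num.max c 0 * (2 / (eps ^+ 2 + D) * (2 / rho * (s / r)))); last first.
      by field; rewrite rn rhon gt_eqF.
    by rewrite ler_peMl// !mulr_ge0// ?invr_ge0 ?(ltW eD0).
  have pb : p `^ beta = s `^ beta * r `^ (2 * beta).
    rewrite pE powRM ?(ltW s0) ?sqr_ge0// powRrM.
    by rewrite powR_mulrn// ltW.
  have sb : s `^ beta <= (3 / 2) `^ beta * rho `^ beta.
    have h32 : 0 <= 3 / 2 :> R by rewrite divr_ge0.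
    rewrite -(powRM _ h32 rho0').
    by apply: (ge0_ler_powR (ltW beta0)); rewrite ?nnegrE// mulr_ge0.
  have sb0 : 0 <= s `^ beta := powR_ge0 _ _.
  have Jg1 : J * (g * mm) <= kap * om * s `^ beta.
    apply: le_trans (ler_wpM2l J0 kb) _.
    rewrite pb (_ : J * _ = kap * om * s `^ beta * (J * r `^ (2 * beta))); last by ring.
    by rewrite ler_piMr// !mulr_ge0.
  have Jg2 : J * (g * mm) <= kap * om * s `^ beta / r.
    apply: le_trans (ler_wpM2l J0 kb) _.
    rewrite pb (_ : J * _ = kap * om * s `^ beta / r * (J * (r * r `^ (2 * beta)))); last by field.
    by rewrite ler_piMr// !mulr_ge0.
  have part1 : J * (I * mm + 8 * (g * mm) / (r * d) + 8 * (g * mm) * s / (r * d ^+ 2)) <= b.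
    apply: le_trans (_ : kap * om * s `^ beta * (1 + 16 * s) * (E / r) <= _).
      apply: le_trans (_ : E * (J * (g * mm)) + 16 * (s / r * E) * (J * (g * mm)) <= _).
        have l1 : J * (I * mm) <= E * (J * (g * mm)).
          rewrite (mulrCA E) ler_wpM2l//; exact: ler_pM.
        have l2 : J * (8 * (g * mm)) * (r * d)^-1 <= J * (8 * (g * mm)) * (s / r * E).
          by rewrite ler_wpM2l// !mulr_ge0.
        have l3 : J * (8 * (g * mm) * s / (r * d ^+ 2)) = J * (8 * (g * mm)) * (s / r * E).
          by rewrite /E; field; rewrite rn dn.
        rewrite 2!mulrDr l3.
        rewrite (mulrA J (8 * _) (_^-1)).
        apply: le_trans (lerD (lerD l1 l2) (lexx _)) _.
        by rewrite le_eqVlt; apply/orP; left; apply/eqP; ring.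
      have l1 : E * (J * (g * mm)) <= E * (kap * om * s `^ beta / r) by rewrite ler_wpM2l.
      have l2 : 16 * (s / r * E) * (J * (g * mm)) <= 16 * (s / r * E) * (kap * om * s `^ beta).
        by rewrite ler_wpM2l// !mulr_ge0.
      apply: le_trans (lerD l1 l2) _.
      by rewrite le_eqVlt; apply/orP; left; apply/eqP; field.
    rewrite /b (_ : 96 * _ * _ * _ = kap * om * ((3 / 2) `^ beta * rho `^ beta) *
        (24 * (rho + 1)) * (4 / rho * Num.max c 0 * angle_kernel rho eps p c r)); last first.
      by field.
    apply: ler_pM => //.
    + by rewrite !mulr_ge0// addr_ge0// mulr_ge0.
    + by rewrite mulr_ge0.
    + apply: ler_pM => //.
      * by rewrite !mulr_ge0.
      * by rewrite addr_ge0// mulr_ge0.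
      * by rewrite ler_wpM2l// mulr_ge0.
      * by move: sr2 rho0; clear; lra.
  have part2 : J * (2 * ff / (r * d)) <= 9 * (ff / p) * radial_kernel rho p r.
    have Js : J <= 3 / 2 * rho / p.
      apply: le_trans (_ : s / p <= _); last by rewrite ler_wpM2r// invr_ge0 ltW.
      rewrite pE -[leLHS]mulr1 (_ : s / (s * r ^+ 2) = (r ^+ 2)^-1); last first.
        by field; rewrite rn gt_eqF.
      by rewrite mulr1 -div1r ler_pdivlMr// exprn_gt0.
    have near : rho / 2 <= p / r ^+ 2 <= 3 / 2 * rho by rewrite -sE sr1.
    have Ds' : (p / r ^+ 2 - rho) ^+ 2 <= d ^+ 2 by rewrite -sE (le_trans Ds).
    have k := near_radial_kernel rho0 p0 r0 near d0 ed2 Ds'.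
    apply: le_trans (_ : 3 / 2 * rho / p * (2 * ff * (3 / rho * radial_kernel rho p r)) <= _).
      apply: ler_pM => //; first by rewrite divr_ge0 ?mulr_ge0 ?(ltW rd0).
      by rewrite ler_wpM2l// mulr_ge0.
    by rewrite le_eqVlt; apply/orP; left; apply/eqP; field; rewrite pn rhon.
  have a0 : 0 <= 96 * ((g * mm + ff) / p) * (r * J).
    by rewrite !mulr_ge0// addr_ge0.
  rewrite mulrDr.
  apply: le_trans (lerD part1 part2) _.
  by rewrite addrC lerD2r lerDr.
Qed.

End Regions.

(** * Radial primitives of the majorants *)

Section Primitives.
Variable R : realType.
Implicit Types (r x rho p c : R).

Definition jweight (beta r : R) : R := (japanese r `^ (2 * beta + 1))^-1.

Lemma oneD_sqr_gt0 r : 0 < 1 + r ^+ 2.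
Proof. by rewrite ltr_pwDl// sqr_ge0. Qed.

Lemma japanese_ge1 r : 1 <= japanese r.
Proof.
rewrite /japanese -[leLHS]sqrtr1 ler_wsqrtr// lerDl; exact: sqr_ge0.
Qed.

Lemma japanese_gt0 r : 0 < japanese r.
Proof. exact: lt_le_trans (japanese_ge1 r). Qed.

Lemma le_japanese r : r <= japanese r.
Proof.
apply: (le_trans (ler_norm r)); rewrite -sqrtr_sqr /japanese ler_wsqrtr// lerDr.
exact: ler01.
Qed.

Lemma sqr_japanese r : japanese r ^+ 2 = 1 + r ^+ 2.
Proof. by rewrite sqr_sqrtr// ltW// oneD_sqr_gt0. Qed.

Lemma jweightE beta r : jweight beta r = (1 + r ^+ 2) `^ (- (beta + 2^-1)).
Proof.
rewrite /jweight /japanese powRN; congr (_^-1).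
rewrite -powR12_sqrt ?ltW ?oneD_sqr_gt0// -powRrM.
by congr (_ `^ _); field.
Qed.

Lemma jweight_gt0 beta r : 0 < jweight beta r.
Proof.
by rewrite invr_gt0 powR_gt0// (lt_le_trans ltr01)// japanese_ge1.
Qed.

Lemma jweight_powR beta r (x : R) : 0 < r -> 0 <= x -> x <= 2 * beta + 1 ->
  jweight beta r * r `^ x <= 1.
Proof.
move=> r0 x0 xb; have j0 : 0 < japanese r by rewrite (lt_le_trans ltr01)// japanese_ge1.
rewrite /jweight mulrC ler_pdivrMr ?powR_gt0// mul1r.
apply: (le_trans (y := japanese r `^ x)).
  apply: (ge0_ler_powR x0); rewrite ?nnegrE ?(ltW r0) ?(ltW j0)//.
  exact: le_japanese.
by apply: ler_powR => //; exact: japanese_ge1.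
Qed.

Lemma jweight_oneDsqr beta r : 1 / 2 < beta -> jweight beta r <= (oneDsqr r)^-1.
Proof.
move=> hb; rewrite /jweight lef_pV2 ?posrE ?powR_gt0 ?japanese_gt0 ?oneD_sqr_gt0//.
rewrite /oneDsqr -sqr_japanese -powR_mulrn ?(le_trans ler01) ?japanese_ge1//.
by apply: ler_powR; [exact: japanese_ge1|lra].
Qed.

(** The primitive of [r <r>^(-2 beta - 1)] that vanishes at infinity when
    [1 / 2 < beta]. *)
Definition jprim (beta r : R) : R :=
  - ((1 + r ^+ 2) `^ (2^-1 - beta) / (2 * beta - 1)).

Lemma der_jprim beta r : 1 / 2 < beta ->
  is_derive r 1 (jprim beta) (r * jweight beta r).
Proof.
move=> hb; have bn : 2 * beta - 1 != 0 by rewrite gt_eqF//; lra.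
rewrite /jprim; der; first exact: oneD_sqr_gt0.
rewrite jweightE (_ : 2^-1 - beta - 1 = - (beta + 2^-1)); last by field.
by rewrite expr1; move: (_ `^ _) => w; field.
Qed.

Lemma jprim_bound beta a b : 1 / 2 < beta ->
  jprim beta b - jprim beta a <= (2 * beta - 1)^-1.
Proof.
move=> hb; have b0 : 0 < 2 * beta - 1 by lra.
rewrite /jprim opprK addrC -mulrBl ler_piMl ?invr_ge0 ?(ltW b0)//.
have h1 : (1 + a ^+ 2) `^ (2^-1 - beta) <= 1.
  rewrite -[leRHS](powRr0 (1 + a ^+ 2)); apply: ler_powR; last lra.
  by rewrite lerDl sqr_ge0.
have h2 : 0 <= (1 + b ^+ 2) `^ (2^-1 - beta) := powR_ge0 _ _.
lra.
Qed.

Definition asinh x : R := ln (x + Num.sqrt (1 + x ^+ 2)).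

Lemma asinh_arg_gt0 x : 0 < x + Num.sqrt (1 + x ^+ 2).
Proof.
have : `|x| < Num.sqrt (1 + x ^+ 2).
  by rewrite -sqrtr_sqr ltr_sqrt ?oneD_sqr_gt0// ltrDr.
by rewrite ltr_norml => /andP[? _]; lra.
Qed.

Lemma der_asinh (f : R -> R) r a : is_derive r 1 f a ->
  is_derive r 1 (fun y => asinh (f y)) (a / Num.sqrt (1 + f r ^+ 2)).
Proof.
move=> fa; rewrite /asinh; der; first exact: asinh_arg_gt0.
  exact: oneD_sqr_gt0.
have := asinh_arg_gt0 (f r).
have : 0 < Num.sqrt (1 + f r ^+ 2) by rewrite sqrtr_gt0 oneD_sqr_gt0.
move: (Num.sqrt _) => S S0 fS; rewrite expr1 add0r; field.
by rewrite !gt_eqF.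
Qed.

Lemma asinh_bound x (M : R) : 0 <= M -> `|x| <= M -> `|asinh x| <= ln (2 * M + 1).
Proof.
move=> M0 xM; have S0 : 0 < Num.sqrt (1 + x ^+ 2) by rewrite sqrtr_gt0 oneD_sqr_gt0.
have S1 : Num.sqrt (1 + x ^+ 2) <= 1 + M.
  apply: le_of_sqr; first lra.
  rewrite sqr_sqrtr ?(ltW (oneD_sqr_gt0 _))//.
  have : x ^+ 2 <= M ^+ 2 by rewrite -(real_normK (num_real x)) sqr_le.
  by rewrite sqrrD; lra.
have [x1 x2] : - M <= x /\ x <= M by move: xM; rewrite ler_norml => /andP[].
have A0 := asinh_arg_gt0 x; have B0 := asinh_arg_gt0 (- x).
rewrite sqrrN in B0.
have AB : (x + Num.sqrt (1 + x ^+ 2)) * (- x + Num.sqrt (1 + x ^+ 2)) = 1.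
  have : Num.sqrt (1 + x ^+ 2) ^+ 2 = 1 + x ^+ 2.
    by rewrite sqr_sqrtr// (ltW (oneD_sqr_gt0 _)).
  by move: (Num.sqrt _) => S SE; rewrite mulrDl !mulrDr; nra.
have M1 : 0 < 2 * M + 1 by lra.
rewrite ler_norml /asinh; apply/andP; split; last first.
  by rewrite ler_ln ?posrE//; lra.
rewrite lerNl -lnV ?posrE//.
rewrite (_ : (x + _)^-1 = - x + Num.sqrt (1 + x ^+ 2)); last first.
  by apply: (mulfI (lt0r_neq0 A0)); rewrite AB mulfV// gt_eqF.
by rewrite ler_ln ?posrE//; lra.
Qed.

(** Since [2 (rho + 2) + 1 <= (rho + 2) ^ 3]. *)
Lemma asinh_log_bound (rho x : R) : 0 < rho -> `|x| <= rho + 2 ->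
  `|asinh x| <= 3 * ln (rho + 2).
Proof.
move=> rho0 xr; have r2 : 0 < rho + 2 by lra.
apply: le_trans (asinh_bound (ltW r2) xr) _.
rewrite [leRHS]mulrC mulr_natr -lnXn// ler_ln ?posrE ?exprn_gt0//; last lra.
by rewrite !exprS expr0 mulr1; nra.
Qed.

Lemma der_mobius rho p r : 0 < rho -> 0 < p ->
  is_derive r 1 (mobius rho p) (- (4 * p * rho * r / (p + rho * r ^+ 2) ^+ 2)).
Proof.
move=> rho0 p0; have n0 : p + rho * r ^+ 2 != 0.
  by rewrite gt_eqF// ltr_pwDl// mulr_ge0 ?sqr_ge0// ltW.
by rewrite /mobius; der => //; rewrite expr1; field.
Qed.

Lemma mobius_bound rho p r : 0 < rho -> 0 < p -> `|mobius rho p r| <= 1.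
Proof.
move=> rho0 p0; have rr : 0 <= rho * r ^+ 2 by rewrite mulr_ge0 ?sqr_ge0// ltW.
have n0 : 0 < p + rho * r ^+ 2 by rewrite ltr_pwDl.
rewrite /mobius normrM normfV (gtr0_norm n0) ler_pdivrMr// mul1r.
by rewrite ler_norml; apply/andP; split; lra.
Qed.

Definition radial_prim (rho p r : R) : R := - asinh ((rho + 2) * mobius rho p r).

Lemma der_radial_prim rho p r : 0 < rho -> 0 < p ->
  is_derive r 1 (radial_prim rho p) (radial_kernel rho p r).
Proof.
move=> rho0 p0; have dm := der_mobius r rho0 p0.
apply: der_eq (derN (der_asinh (derM (der_cst (rho + 2) r) dm))) _.
rewrite /radial_kernel mul0r add0r; ring.
Qed.

Lemma radial_prim_bound rho p a b : 0 < rho -> 0 < p ->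
  radial_prim rho p b - radial_prim rho p a <= 6 * ln (rho + 2).
Proof.
move=> rho0 p0; have r2 : 0 < rho + 2 by lra.
have B x : `|asinh ((rho + 2) * mobius rho p x)| <= 3 * ln (rho + 2).
  apply: asinh_log_bound => //; rewrite normrM (gtr0_norm r2) ler_piMr ?(ltW r2)//.
  exact: mobius_bound.
have := B a; have := B b; rewrite /radial_prim !ler_norml => /andP[? ?] /andP[? ?].
lra.
Qed.

Definition angle_width (rho eps c : R) : R :=
  Num.sqrt (eps ^+ 2 + rho ^+ 2 * (1 - c ^+ 2)).

Definition angle_prim (rho eps p c r : R) : R :=
  - (atan ((p / r ^+ 2 - rho * c) / angle_width rho eps c) / angle_width rho eps c).

Lemma angle_width_arg_gt0 rho eps c : 0 < eps -> `|c| <= 1 ->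
  0 < eps ^+ 2 + rho ^+ 2 * (1 - c ^+ 2).
Proof.
move=> e0 c1; rewrite ltr_pwDl ?exprn_gt0// mulr_ge0 ?sqr_ge0// subr_ge0.
by rewrite -real_normK ?num_real// expr_le1.
Qed.

Lemma der_angle_prim rho eps p c r : 0 < eps -> `|c| <= 1 -> 0 < r ->
  is_derive r 1 (angle_prim rho eps p c) (angle_kernel rho eps p c r).
Proof.
move=> e0 c1 r0; have A0 := angle_width_arg_gt0 rho e0 c1.
have rn : r != 0 by rewrite gt_eqF.
rewrite /angle_prim /angle_kernel.
have : 0 < angle_width rho eps c by rewrite sqrtr_gt0.
have <- : angle_width rho eps c ^+ 2 = eps ^+ 2 + rho ^+ 2 * (1 - c ^+ 2).
  by rewrite sqr_sqrtr// ltW.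
move: (angle_width _ _ _) => l l0.
have ln0 : l != 0 by rewrite gt_eqF.
der; first by rewrite expf_neq0.
have D0 : l ^+ 2 + (p / r ^+ 2 - rho * c) ^+ 2 != 0.
  by rewrite gt_eqF// ltr_pwDl ?exprn_gt0// sqr_ge0.
rewrite expr1 (_ : 1 + ((p / r ^+ 2 - rho * c) / l) ^+ 2 =
  (l ^+ 2 + (p / r ^+ 2 - rho * c) ^+ 2) / l ^+ 2); last by field; rewrite ?rn ?ln0.
move: D0; move: (l ^+ 2 + (p / r ^+ 2 - rho * c) ^+ 2) => D D0.
by field; rewrite ?rn ?ln0 ?D0.
Qed.

Lemma angle_prim_bound rho eps p c a b : 0 < eps -> `|c| <= 1 ->
  angle_prim rho eps p c b - angle_prim rho eps p c a <= pi / angle_width rho eps c.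
Proof.
move=> e0 c1; have A0 := angle_width_arg_gt0 rho e0 c1.
have l0 : 0 < angle_width rho eps c by rewrite sqrtr_gt0.
rewrite /angle_prim opprK addrC -mulrBl ler_wpM2r ?invr_ge0 ?(ltW l0)//.
set u := (_ / _); set v := (_ / _).
have := atan_ltpi2 u; have := atan_gtNpi2 v; lra.
Qed.

End Primitives.

(** * The oscillatory integral *)

(** Structural proof of joint continuity; atoms are looked up among the
    hypotheses by syntactic equality only, since unification up to conversion
    would unfold the atoms. *)
Ltac cont2_step := match goal with
  | H : cont2 (fun r t => @?f r t) |- cont2 (fun r t => @?g r t) =>
      constr_eq f g; exact H
  | |- cont2 (fun r t => @?f r t + @?g r t) => apply (@cont2D _ f g)
  | |- cont2 (fun r t => - @?f r t) => apply (@cont2N _ f)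
  | |- cont2 (fun r t => @?f r t * @?g r t) => apply (@cont2M _ f g)
  | |- cont2 (fun r t => @?f r t ^+ _) => apply (@cont2X _ f)
  | |- cont2 (fun r t => sin (@?f r t)) =>
      apply (@cont2_comp _ (@sin _) f); [exact: continuous_sin|]
  | |- cont2 (fun r t => cos (@?f r t)) =>
      apply (@cont2_comp _ (@cos _) f); [exact: continuous_cos|]
  | |- cont2 (fun _ _ => ?c) => exact: (@cont2_cst _ c)
  end.

Lemma half_lt_exponents (R : realType) (beta : R) : 1 / 2 < beta ->
  [/\ 0 < beta, 0 <= 2 * beta, 2 * beta <= 2 * beta + 1, 0 <= 2 * beta + 1
    & 2 <= 2 * beta + 1].
Proof. by move=> hb; split; lra. Qed.

Lemma le_oneDsqr (R : realType) (r : R) : r <= oneDsqr r.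
Proof. by rewrite /oneDsqr; have := sqr_ge0 (r - 1); rewrite sqrrB1; nra. Qed.

Section Oscillatory.
Variable R : realType.
Notation mu := (@lebesgue_measure R).
Variables (beta rho alpha delta N kap Mm : R).
Variables (h h1 h2 mm m1 ff om : R -> R).
Variables (a ar at_ b br bt : R -> R -> R).
Hypotheses (hbeta : 1 / 2 < beta) (rho0 : 0 < rho) (delta0 : 0 < delta).
Hypotheses (N0 : 0 <= N) (kap0 : 0 <= kap).
Hypothesis dh : forall t : R, is_derive t 1 h (h1 t).
Hypothesis dh1 : forall t : R, is_derive t 1 h1 (h2 t).
Hypothesis ch2 : continuous h2.
Hypothesis perh : forall t, h (t + 2 * pi) = h t.
Hypothesis perh1 : forall t, h1 (t + 2 * pi) = h1 t.

(** [speed] and [accel] are the moduli of [gamma'] and [gamma''], and [cosine]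
    is that of the angle between [gamma'] and the direction [alpha], all in
    terms of [h]. *)
Definition speed (t : R) : R := Num.sqrt (h t ^+ 2 + h1 t ^+ 2).
Definition accel (t : R) : R := Num.sqrt ((h t - h2 t) ^+ 2 + (2 * h1 t) ^+ 2).
Definition cosine (t : R) : R := (h t * sin (t + alpha) - h1 t * cos (t + alpha)) / speed t.

Hypothesis delta_speed : forall t, delta <= speed t.
Hypotheses (cmm : continuous mm) (cff : continuous ff) (com : continuous om).
Hypothesis mm0 : forall t, 0 <= mm t.
Hypothesis ff0 : forall t, 0 <= ff t.
Hypothesis om0 : forall t, 0 <= om t.
Hypothesis mmM : forall t, mm t <= Mm.
Hypothesis m1_ff : forall t, m1 t <= ff t + (1 + accel t / speed t) * mm t.
Hypothesis kap_mm : forall t,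
  (1 + accel t / speed t) * mm t <= kap * (speed t `^ beta * om t).

Hypothesis da_r : forall r t : R, 0 < r -> is_derive r 1 (a ^~ t) (ar r t).
Hypothesis da_t : forall r t : R, 0 < r -> is_derive t 1 (a r) (at_ r t).
Hypothesis db_r : forall r t : R, 0 < r -> is_derive r 1 (b ^~ t) (br r t).
Hypothesis db_t : forall r t : R, 0 < r -> is_derive t 1 (b r) (bt r t).
Hypotheses (car : cont2 (fun r t => ar r t)) (cat_ : cont2 (fun r t => at_ r t)).
Hypotheses (cbr : cont2 (fun r t => br r t)) (cbt : cont2 (fun r t => bt r t)).
Hypothesis pera : forall r t : R, 0 < r -> a r (t + 2 * pi) = a r t.
Hypothesis perb : forall r t : R, 0 < r -> b r (t + 2 * pi) = b r t.
Hypothesis ab_bound : forall r t : R, 0 < r ->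
  `|a r t| + `|b r t| <= N * jweight beta r * mm t.
Hypothesis abr_bound : forall r t : R, 0 < r ->
  `|ar r t| + `|br r t| <= N * jweight beta r * mm t / r.
Hypothesis abt_bound : forall r t : R, 0 < r ->
  `|at_ r t| + `|bt r t| <= N * jweight beta r * (mm t + m1 t).

(* The gradient is cut off below [eps], which is less than both [1] and
   [rho / 2]: the cut-off region then lies inside the resonant one. *)
Let eps : R := rho / (rho + 2).
Let e : R := eps ^+ 2.
Let xx r t := rho * sin (t + alpha) - h t / r ^+ 2.
Let yy r t := rho * cos (t + alpha) + h1 t / r ^+ 2.
Let DD r t := xx r t ^+ 2 + yy r t ^+ 2.
Let FF r t := cos (Psi h rho alpha r t) * a r t + sin (Psi h rho alpha r t) * b r t.
Let UU r t := sin (Psi h rho alpha r t) * a r t - cos (Psi h rho alpha r t) * b r t.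
Let U1 r t := sin (Psi h rho alpha r t) * ar r t - cos (Psi h rho alpha r t) * br r t.
Let U2 r t := sin (Psi h rho alpha r t) * at_ r t - cos (Psi h rho alpha r t) * bt r t.
Let xr r t := 2 * h t / r ^+ 3.
Let yt r t := - xx r t + (h2 t - h t) / r ^+ 2.
Let Dr r t := 4 * (xx r t * h t - yy r t * h1 t) / r ^+ 3.
Let Dt r t := - (2 * (xx r t * (2 * h1 t) + yy r t * (h t - h2 t)) / r ^+ 2).
Let X r t := xx r t * cutV e (DD r t) * UU r t.
Let Y r t := yy r t / r * cutV e (DD r t) * UU r t.
Let dX r t := xr r t * cutV e (DD r t) * UU r t
  + xx r t * (dcutV e (DD r t) * Dr r t) * UU r t
  + xx r t * cutV e (DD r t) * (xx r t * FF r t + U1 r t).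
Let dY r t := yt r t / r * cutV e (DD r t) * UU r t
  + yy r t / r * (dcutV e (DD r t) * Dt r t) * UU r t
  + yy r t / r * cutV e (DD r t) * (r * yy r t * FF r t + U2 r t).

Let w1 t := 96 * (((1 + accel t / speed t) * mm t + ff t) / speed t).
Let w2 t := 9 * (ff t / speed t).
Let w3 t := 96 * (3 / 2) `^ beta * (kap * (rho `^ beta * ((rho + 1) / rho)) *
         (om t * Num.max (cosine t) 0)).
Let T r t := N * (w1 t * jprim beta r + w2 t * radial_prim rho (speed t) r
  + w3 t * angle_prim rho eps (speed t) (cosine t) r).
Let dT r t := N * (w1 t * (r * jweight beta r) + w2 t * radial_kernel rho (speed t) r
  + w3 t * angle_kernel rho eps (speed t) (cosine t) r).

Definition osc_bound (t : R) : R :=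
  N * (w1 t * (2 * beta - 1)^-1 + w2 t * (6 * ln (rho + 2))
       + w3 t * (pi / angle_width rho eps (cosine t))).

Let eps0 : 0 < eps.
Proof. by rewrite divr_gt0// addr_gt0. Qed.

Let e0 : 0 < e.
Proof. by rewrite exprn_gt0. Qed.

Lemma speed_gt0 t : 0 < speed t.
Proof. exact: lt_le_trans (delta_speed t). Qed.

Lemma speedE t : speed t ^+ 2 = h t ^+ 2 + h1 t ^+ 2.
Proof. by rewrite sqr_sqrtr// addr_ge0 ?sqr_ge0. Qed.

Lemma accelE t : accel t ^+ 2 = (h t - h2 t) ^+ 2 + (2 * h1 t) ^+ 2.
Proof. by rewrite sqr_sqrtr// addr_ge0 ?sqr_ge0. Qed.

Lemma cosine_le1 t : `|cosine t| <= 1.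
Proof.
have p0 := speed_gt0 t.
rewrite /cosine normrM normfV (gtr0_norm p0) ler_pdivrMr// mul1r.
rewrite -[leRHS]mulr1 (_ : _ - _ = h t * sin (t + alpha) + h1 t * - cos (t + alpha)); last by ring.
apply: cauchy_schwarz2 => //; first exact: ltW.
  by rewrite speedE.
by rewrite sqrrN addrC cos2Dsin2 expr1n.
Qed.

(** The phase is stationary exactly where [speed t / r ^ 2 = rho] and [gamma']
    points in the direction [alpha]. *)
Lemma sqr_gradientE (r t : R) : 0 < r ->
  DD r t = (speed t / r ^+ 2 - rho * cosine t) ^+ 2 + rho ^+ 2 * (1 - cosine t ^+ 2).
Proof.
move=> r0; have pn : speed t != 0 by rewrite gt_eqF// speed_gt0.
have rn : r != 0 by rewrite gt_eqF.
have pc : speed t * cosine t = h t * sin (t + alpha) - h1 t * cos (t + alpha).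
  by rewrite /cosine mulrCA mulfV// mulr1.
rewrite [RHS](_ : _ = speed t ^+ 2 / r ^+ 4 - 2 * rho / r ^+ 2 * (speed t * cosine t) + rho ^+ 2); last first.
  by field.
rewrite pc speedE.
rewrite (_ : DD r t = h t ^+ 2 / r ^+ 4 + h1 t ^+ 2 / r ^+ 4
    - 2 * rho / r ^+ 2 * (h t * sin (t + alpha) - h1 t * cos (t + alpha))
    + rho ^+ 2 * (cos (t + alpha) ^+ 2 + sin (t + alpha) ^+ 2)); last first.
  by rewrite /DD /xx /yy; field.
by rewrite cos2Dsin2; field.
Qed.

Let ch : continuous h.
Proof. by move=> t; exact: der_continuous (dh t). Qed.

Let ch1 : continuous h1.
Proof. by move=> t; exact: der_continuous (dh1 t). Qed.

Let c2h : cont2 (fun _ t => h t). Proof. exact: cont2_snd. Qed.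
Let c2h1 : cont2 (fun _ t => h1 t). Proof. exact: cont2_snd. Qed.
Let c2h2 : cont2 (fun _ t => h2 t). Proof. exact: cont2_snd. Qed.
Let c2t : cont2 (fun _ t : R => t). Proof. by apply: cont2_snd => t; exact: cvg_id. Qed.
Let c2r : cont2 (fun r _ : R => r). Proof. by apply: cont2_fst => t _; exact: cvg_id. Qed.
Let ca : cont2 (fun r t => a r t). Proof. exact: cont2_partials da_r da_t car. Qed.
Let cb : cont2 (fun r t => b r t). Proof. exact: cont2_partials db_r db_t cbr. Qed.

Let rX0 n (r : R) : 0 < r -> r ^+ n != 0.
Proof. by move=> r0; rewrite expf_neq0// gt_eqF. Qed.

Let c2V n : cont2 (fun r _ : R => (r ^+ n)^-1).
Proof. by apply: cont2V => [|r t]; [exact: cont2X|exact: rX0]. Qed.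

Let c2V1 : cont2 (fun r _ : R => r^-1).
Proof. by apply: cont2V => // r t r0; rewrite gt_eqF. Qed.

Let cPsi : cont2 (fun r t => Psi h rho alpha r t).
Proof. by rewrite /Psi; repeat cont2_step. Qed.
Let cxx : cont2 (fun r t => xx r t). Proof. by rewrite /xx; repeat cont2_step. Qed.
Let cyy : cont2 (fun r t => yy r t). Proof. by rewrite /yy; repeat cont2_step. Qed.
Let cDD : cont2 (fun r t => DD r t). Proof. by rewrite /DD; repeat cont2_step. Qed.
Let cFF : cont2 (fun r t => FF r t). Proof. by rewrite /FF; repeat cont2_step. Qed.
Let cUU : cont2 (fun r t => UU r t). Proof. by rewrite /UU; repeat cont2_step. Qed.
Let cU1 : cont2 (fun r t => U1 r t). Proof. by rewrite /U1; repeat cont2_step. Qed.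
Let cU2 : cont2 (fun r t => U2 r t). Proof. by rewrite /U2; repeat cont2_step. Qed.
Let ccut : cont2 (fun r t => cutV e (DD r t)).
Proof. by apply: cont2_comp => // D; exact: der_continuous (der_cutV D e0). Qed.
Let cdcut : cont2 (fun r t => dcutV e (DD r t)).
Proof. by apply: cont2_comp => //; exact: dcutV_continuous. Qed.
Let cdX : cont2 (fun r t => dX r t).
Proof. by rewrite /dX /xr /Dr; repeat cont2_step. Qed.
Let cdY : cont2 (fun r t => dY r t).
Proof. by rewrite /dY /yt /Dt; repeat cont2_step. Qed.

Let c2s : cont2 (fun _ t => speed t).
Proof.
apply: (@cont2_comp _ (@Num.sqrt R)); first exact: sqrt_continuous.
by repeat cont2_step.
Qed.

Let c2acc : cont2 (fun _ t => accel t).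
Proof.
apply: (@cont2_comp _ (@Num.sqrt R)); first exact: sqrt_continuous.
by repeat cont2_step.
Qed.

Let c2sV : cont2 (fun _ t => (speed t)^-1).
Proof. by apply: cont2V => // r t _; rewrite gt_eqF// speed_gt0. Qed.

Let c2c : cont2 (fun _ t => cosine t).
Proof. by rewrite /cosine; repeat cont2_step. Qed.

Let c2mm : cont2 (fun _ t => mm t). Proof. exact: cont2_snd. Qed.
Let c2ff : cont2 (fun _ t => ff t). Proof. exact: cont2_snd. Qed.
Let c2om : cont2 (fun _ t => om t). Proof. exact: cont2_snd. Qed.
Let c2cmax : cont2 (fun _ t => Num.max (cosine t) 0).
Proof.
apply: cont2_snd => t; apply: continuous_max; first exact: (cont2_slice_snd c2c ltr01).
exact: cst_continuous.
Qed.

Let c2w1 : cont2 (fun _ t => w1 t). Proof. by rewrite /w1; repeat cont2_step. Qed.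
Let c2w2 : cont2 (fun _ t => w2 t). Proof. by rewrite /w2; repeat cont2_step. Qed.
Let c2w3 : cont2 (fun _ t => w3 t). Proof. by rewrite /w3; repeat cont2_step. Qed.

Let cjw : cont2 (fun r _ => jweight beta r).
Proof.
apply: cont2_fst => r _; rewrite (_ : jweight beta = fun r => (1 + r ^+ 2) `^ (- (beta + 2^-1))).
  eapply der_continuous; repeat der_step; exact: oneD_sqr_gt0.
by apply/funext => x; exact: jweightE.
Qed.

Let crk : cont2 (fun r t => radial_kernel rho (speed t) r).
Proof.
have den (r t : R) : 0 < r -> speed t + rho * r ^+ 2 != 0.
  by move=> r0; rewrite gt_eqF// ltr_pwDl ?speed_gt0// mulr_ge0 ?sqr_ge0// ltW.
have cden : cont2 (fun r t => (speed t + rho * r ^+ 2)^-1).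
  by apply: cont2V => //; repeat cont2_step.
have cden2 : cont2 (fun r t => ((speed t + rho * r ^+ 2) ^+ 2)^-1).
  by apply: cont2V => [|r t r0]; [repeat cont2_step|rewrite expf_neq0// den].
have cS : cont2 (fun r t => (Num.sqrt (1 + ((rho + 2) * mobius rho (speed t) r) ^+ 2))^-1).
  apply: cont2V; last by move=> r t _; rewrite gt_eqF// sqrtr_gt0 oneD_sqr_gt0.
  apply: (@cont2_comp _ (@Num.sqrt R)); first exact: sqrt_continuous.
  by rewrite /mobius; repeat cont2_step.
by rewrite /radial_kernel; repeat cont2_step.
Qed.

Let cak : cont2 (fun r t => angle_kernel rho eps (speed t) (cosine t) r).
Proof.
have den : cont2 (fun r t => (eps ^+ 2 + rho ^+ 2 * (1 - cosine t ^+ 2) +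
    (speed t / r ^+ 2 - rho * cosine t) ^+ 2)^-1).
  apply: cont2V; first by repeat cont2_step.
  move=> r t _; rewrite gt_eqF// ltr_wpDr ?sqr_ge0//.
  by apply: angle_width_arg_gt0 => //; exact: cosine_le1.
by rewrite /angle_kernel; repeat cont2_step.
Qed.

Let cdT : cont2 (fun r t => dT r t).
Proof. by rewrite /dT; repeat cont2_step. Qed.

Lemma osc_bound_continuous : continuous osc_bound.
Proof.
have cw : cont2 (fun _ t => (angle_width rho eps (cosine t))^-1).
  apply: cont2V.
    apply: (@cont2_comp _ (@Num.sqrt R)); first exact: sqrt_continuous.
    by repeat cont2_step.
  move=> r t _; rewrite gt_eqF// sqrtr_gt0.
  by apply: angle_width_arg_gt0 => //; exact: cosine_le1.
have c : cont2 (fun _ t => osc_bound t) by rewrite /osc_bound; repeat cont2_step.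
exact: (cont2_slice_snd c ltr01).
Qed.

Let dxx_r (r t : R) : 0 < r -> is_derive r 1 (xx ^~ t) (xr r t).
Proof.
move=> r0; have rn : r != 0 by rewrite gt_eqF.
by rewrite /xx /xr; der; [exact: rX0|field].
Qed.

Let dyy_r (r t : R) : 0 < r -> is_derive r 1 (yy ^~ t) (- (2 * h1 t / r ^+ 3)).
Proof.
move=> r0; have rn : r != 0 by rewrite gt_eqF.
by rewrite /yy; der; [exact: rX0|field].
Qed.

Let dxx_t (r t : R) : 0 < r -> is_derive t 1 (xx r) (yy r t - 2 * h1 t / r ^+ 2).
Proof.
move=> r0; have rn : r != 0 by rewrite gt_eqF.
have dht := dh t; rewrite /xx /yy; der; field.
exact: rn.
Qed.

Let dyy_t (r t : R) : 0 < r -> is_derive t 1 (yy r) (yt r t).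
Proof.
move=> r0; have rn : r != 0 by rewrite gt_eqF.
have dht := dh1 t; rewrite /yt /xx /yy; der; field.
exact: rn.
Qed.

Let dDD_r (r t : R) : 0 < r -> is_derive r 1 (DD ^~ t) (Dr r t).
Proof.
move=> r0; have rn : r != 0 by rewrite gt_eqF.
have d1 := dxx_r t r0; have d2 := dyy_r t r0.
rewrite /DD /Dr; apply: der_eq (derD (derX 1 d1) (derX 1 d2)) _.
by rewrite /xr; field.
Qed.

Let dDD_t (r t : R) : 0 < r -> is_derive t 1 (DD r) (Dt r t).
Proof.
move=> r0; have rn : r != 0 by rewrite gt_eqF.
have d1 := dxx_t t r0; have d2 := dyy_t t r0.
rewrite /DD /Dt; apply: der_eq (derD (derX 1 d1) (derX 1 d2)) _.
by rewrite /yt; field.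
Qed.

Let dPsi_r (r t : R) : 0 < r -> is_derive r 1 (fun r => Psi h rho alpha r t) (xx r t).
Proof.
move=> r0; have rn : r != 0 by rewrite gt_eqF.
by rewrite /Psi /xx; der => //; field.
Qed.

Let dPsi_t (r t : R) : 0 < r -> is_derive t 1 (Psi h rho alpha r) (r * yy r t).
Proof.
move=> r0; have rn : r != 0 by rewrite gt_eqF.
have dht := dh t; rewrite /Psi /yy; der; field.
exact: rn.
Qed.

Let dUU_r (r t : R) : 0 < r -> is_derive r 1 (UU ^~ t) (xx r t * FF r t + U1 r t).
Proof.
move=> r0; have d1 := dPsi_r t r0; have d2 := da_r t r0; have d3 := db_r t r0.
rewrite /UU; apply: der_eq (derD (derM (der_sin d1) d2) (derN (derM (der_cos d1) d3))) _.
by rewrite /FF /U1; ring.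
Qed.

Let dUU_t (r t : R) : 0 < r -> is_derive t 1 (UU r) (r * yy r t * FF r t + U2 r t).
Proof.
move=> r0; have d1 := dPsi_t t r0; have d2 := da_t t r0; have d3 := db_t t r0.
rewrite /UU; apply: der_eq (derD (derM (der_sin d1) d2) (derN (derM (der_cos d1) d3))) _.
by rewrite /FF /U2; ring.
Qed.

Let hX (r t : R) : 0 < r -> is_derive r 1 (X ^~ t) (dX r t).
Proof.
move=> r0; have dc := @der_comp R (cutV e) (DD ^~ t) r _ _ (der_cutV (DD r t) e0) (dDD_r t r0).
apply: der_eq (derM (derM (dxx_r t r0) dc) (dUU_r t r0)) _.
by rewrite /dX; ring.
Qed.

Let hY (r t : R) : 0 < r -> is_derive t 1 (Y r) (dY r t).
Proof.
move=> r0; have dc := @der_comp R (cutV e) (DD r) t _ _ (der_cutV (DD r t) e0) (dDD_t t r0).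
have d1 := derM (dyy_t t r0) (der_cst (r^-1) t).
apply: der_eq (derM (derM d1 dc) (dUU_t t r0)) _.
by rewrite /dY; ring.
Qed.

Let hT (r t : R) : 0 < r -> is_derive r 1 (T ^~ t) (dT r t).
Proof.
move=> r0.
have d1 := der_jprim r hbeta.
have d2 := der_radial_prim r rho0 (speed_gt0 t).
have d3 := der_angle_prim rho (speed t) eps0 (cosine_le1 t) r0.
have dw (c x a' : R) (f : R -> R) : is_derive x 1 f a' -> is_derive x 1 (fun y : R => c * f y) (c * a').
  by move=> d; apply: der_eq (derM (der_cst c x) d) _; rewrite mul0r add0r.
exact: dw (derD (derD (dw _ _ _ _ d1) (dw _ _ _ _ d2)) (dw _ _ _ _ d3)).
Qed.

Let trig_bound (x u v B : R) : `|u| + `|v| <= B ->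
  `|cos x * u + sin x * v| <= B /\ `|sin x * u - cos x * v| <= B.
Proof.
have c1 : `|cos x| <= 1 by rewrite ler_norml cos_geN1 cos_le1.
have s1 : `|sin x| <= 1 by rewrite ler_norml sin_geN1 sin_le1.
move=> uv; split; apply: (le_trans _ uv).
  by apply: le_trans (ler_normD _ _) _; rewrite !normrM lerD// ler_piMl.
by apply: le_trans (ler_normB _ _) _; rewrite !normrM lerD// ler_piMl.
Qed.

Let res (r t : R) : 0 < r -> `|FF r t - dX r t - dY r t| <= dT r t.
Proof.
move=> r0; have p0 := speed_gt0 t.
have j0 := ltW (jweight_gt0 beta r).
have q0 : 0 <= accel t by exact: sqrtr_ge0.
have [Fb Ub] := trig_bound (Psi h rho alpha r t) (ab_bound t r0).
have [_ U1b] := trig_bound (Psi h rho alpha r t) (abr_bound t r0).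
have [_ U2b] := trig_bound (Psi h rho alpha r t) (abt_bound t r0).
apply: le_trans (residual_bound r0 e0 (ltW p0) q0 (speedE t) (accelE t) Ub Fb U1b U2b
  erefl erefl erefl erefl erefl erefl) _.
have [b1 b2 b3 b4 b5] := half_lt_exponents hbeta.
apply: region_bound => //.
- exact: cosine_le1.
- exact: sqr_gradientE.
- exact: jweight_powR.
- rewrite (_ : r * r `^ (2 * beta) = r `^ (2 * beta + 1)); first exact: jweight_powR.
  by rewrite powRD ?(gt_eqF r0) ?implybT// powRr1 ?(ltW r0)// mulrC.
- by rewrite -powR_mulrn ?(ltW r0)//; exact: jweight_powR.
Qed.

Let Tk (r1 r2 t : R) : 0 < r1 -> r1 < r2 -> T r2 t - T r1 t <= osc_bound t.
Proof.
move=> _ _; have p0 := speed_gt0 t.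
have q0 : 0 <= accel t by exact: sqrtr_ge0.
have g0 : 0 <= 1 + accel t / speed t by rewrite addr_ge0// divr_ge0// ltW.
have W1 : 0 <= w1 t.
  by rewrite /w1 mulr_ge0// divr_ge0 ?(ltW p0)// addr_ge0// mulr_ge0.
have W2 : 0 <= w2 t by rewrite /w2 mulr_ge0// divr_ge0// ltW.
have W3 : 0 <= w3 t.
  rewrite /w3 !mulr_ge0 ?powR_ge0 ?invr_ge0 ?(ltW rho0)//.
    by rewrite addr_ge0// ltW.
  by rewrite le_max lexx orbT.
rewrite /T /osc_bound -mulrBr ler_wpM2l//.
have b1 := ler_wpM2l W1 (jprim_bound r1 r2 hbeta).
have b2 := ler_wpM2l W2 (radial_prim_bound r1 r2 rho0 p0).
have b3 := ler_wpM2l W3 (angle_prim_bound rho (speed t) r1 r2 eps0 (cosine_le1 t)).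
rewrite !mulrBr in b1 b2 b3.
by rewrite opprD opprD addrACA lerD// addrACA lerD.
Qed.

Let NMm0 : 0 <= N * Mm.
Proof. by rewrite mulr_ge0// (le_trans (mm0 0)). Qed.

Let ab_decay (r t : R) : 0 < r -> `|a r t| + `|b r t| <= N * Mm * (oneDsqr r)^-1.
Proof.
move=> r0; apply: le_trans (ab_bound t r0) _.
rewrite mulrAC; apply: ler_pM.
- by rewrite mulr_ge0.
- exact: ltW (jweight_gt0 _ _).
- by rewrite ler_wpM2l.
- exact: jweight_oneDsqr.
Qed.

Let X_bound (r t : R) : 0 < r ->
  `|X r t| <= 2 * (N * Mm * (oneDsqr r)^-1) / Num.sqrt (Num.max (DD r t) e).
Proof.
move=> r0; have [_ Ub] := trig_bound (Psi h rho alpha r t) (ab_decay t r0).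
have M0 : 0 < Num.max (DD r t) e by rewrite lt_max e0 orbT.
have D0 : 0 <= DD r t by rewrite addr_ge0 ?sqr_ge0.
have /andP[c0 c1] := cutV_bound e0 D0.
have d0 : 0 < Num.sqrt (Num.max (DD r t) e) by rewrite sqrtr_gt0.
have dE : Num.sqrt (Num.max (DD r t) e) ^+ 2 = Num.max (DD r t) e by rewrite sqr_sqrtr// ltW.
have xd : `|xx r t| <= Num.sqrt (Num.max (DD r t) e).
  apply: normr_le_sqr; first exact: ltW.
  by rewrite dE le_max lerDl sqr_ge0.
have {}c1 : cutV e (DD r t) <= 2 / Num.sqrt (Num.max (DD r t) e) ^+ 2 by rewrite dE.
rewrite /X !normrM (ger0_norm c0).
apply: le_trans (_ : Num.sqrt (Num.max (DD r t) e) * (2 / Num.sqrt (Num.max (DD r t) e) ^+ 2)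
   * (N * Mm / oneDsqr r) <= _).
  apply: ler_pM => //; first by rewrite mulr_ge0.
  exact: ler_pM.
move: d0; move: (Num.sqrt _) => d d0; move: (N * Mm / oneDsqr r) => z.
by rewrite le_eqVlt; apply/orP; left; apply/eqP; field; rewrite gt_eqF.
Qed.

(* At [r = 0] the gradient blows up like [speed t / r ^ 2]; at infinity it is
   the amplitude that decays. *)
Let X0 (ep : R) : 0 < ep ->
  exists2 r0 : R, 0 < r0 & forall r t : R, 0 < r -> r < r0 -> `|X r t| <= ep.
Proof.
move=> ep0; pose K := 2 * (N * Mm) / ep + 1.
have K0 : 0 < K.
  by apply: ltr_wpDl => //; apply: divr_ge0; [exact: mulr_ge0|exact: ltW].
have Kr : 0 < K + rho by rewrite addr_gt0.
exists (Num.min 1 (delta / (K + rho))); first by rewrite lt_min ltr01 divr_gt0.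
move=> r t r0; rewrite lt_min => /andP[r1 rd].
apply: le_trans (X_bound t r0) _.
have M0 : 0 < Num.max (DD r t) e by rewrite lt_max e0 orbT.
have d0 : 0 < Num.sqrt (Num.max (DD r t) e) by rewrite sqrtr_gt0.
have Kd : K <= Num.sqrt (Num.max (DD r t) e).
  apply: le_of_sqr; first exact: ltW.
  rewrite sqr_sqrtr ?(ltW M0)// le_max; apply/orP; left.
  have sK : K + rho <= speed t / r ^+ 2.
    rewrite ler_pdivlMr ?exprn_gt0//; apply: le_trans (delta_speed t).
    apply: le_trans (_ : (K + rho) * r <= _).
      apply: ler_wpM2l; first exact: ltW.
      by rewrite expr2; apply: ler_piMl; exact: ltW.
    by rewrite mulrC -ler_pdivlMr// ltW.
  apply: le_trans (_ : (speed t / r ^+ 2 - rho) ^+ 2 <= _).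
    by apply: sqr_le; [exact: ltW|rewrite lerBrDr].
  rewrite sqr_gradientE// -subr_ge0.
  rewrite (_ : _ - _ = 2 * (speed t / r ^+ 2) * rho * (1 - cosine t)); last by ring.
  apply: mulr_ge0; last by rewrite subr_ge0 (le_trans (ler_norm _) (cosine_le1 t)).
  apply: mulr_ge0; last exact: ltW.
  by apply: mulr_ge0 => //; apply: divr_ge0; [exact: ltW (speed_gt0 t)|exact: sqr_ge0].
rewrite ler_pdivrMr//.
apply: le_trans (_ : ep * K <= _); last by rewrite ler_wpM2l// ltW.
have epn : ep != 0 by rewrite gt_eqF.
have -> : ep * K = 2 * (N * Mm) + ep by rewrite /K; move: (N * Mm) => z; field.
apply: le_trans (_ : 2 * (N * Mm) <= _); last by rewrite lerDl ltW.
apply: ler_wpM2l => //; apply: ler_piMr => //.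
by rewrite invf_le1 ?oneD_sqr_gt0// oneDsqr_ge1.
Qed.

Let Xoo (ep : R) : 0 < ep ->
  exists2 r0 : R, 0 < r0 & forall r t : R, r0 < r -> `|X r t| <= ep.
Proof.
move=> ep0; pose K := 2 * (N * Mm) / eps / ep + 1.
have K0 : 0 < K.
  apply: ltr_wpDl => //; apply: divr_ge0; last exact: ltW.
  by apply: divr_ge0; [exact: mulr_ge0|exact: ltW].
exists K => // r t rK; have r0 : 0 < r by exact: lt_trans rK.
apply: le_trans (X_bound t r0) _.
have M0 : 0 < Num.max (DD r t) e by rewrite lt_max e0 orbT.
have d0 : 0 < Num.sqrt (Num.max (DD r t) e) by rewrite sqrtr_gt0.
have ed : eps <= Num.sqrt (Num.max (DD r t) e).
  apply: le_of_sqr; first exact: ltW.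
  by rewrite sqr_sqrtr ?(ltW M0)// le_max lexx orbT.
have o0 : 0 < oneDsqr r := oneD_sqr_gt0 r.
apply: le_trans (_ : 2 * (N * Mm / oneDsqr r) / eps <= _).
  apply: ler_wpM2l; last by rewrite lef_pV2 ?posrE.
  by apply: mulr_ge0 => //; apply: divr_ge0 => //; exact: ltW.
rewrite (_ : 2 * (N * Mm / oneDsqr r) / eps = 2 * (N * Mm) / eps / oneDsqr r); last first.
  by move: (oneDsqr r) o0 => z z0; field; rewrite !gt_eqF.
rewrite ler_pdivrMr// -ler_pdivrMl// [leLHS]mulrC.
apply: le_trans (_ : K <= _); first by rewrite /K lerDl.
apply: le_trans (ltW rK) _; exact: le_oneDsqr.
Qed.

(** Integration by parts along the gradient of the phase, with the field
    [(X, Y)] equal to [gradient / |gradient| ^ 2] times the primitive [UU] away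
    from the resonance. *)
Lemma oscillatory_bound :
  `|\int[mu]_(t in @circle R) \int[mu]_(r in @half_line R) FF r t| <=
    \int[mu]_(t in `[0, 2 * pi]) osc_bound t.
Proof.
apply: (divergence_bound cFF cdX cdY cdT hX hY hT res Tk (M := N * Mm)) => //.
- by move=> r t r0; have [] := trig_bound (Psi h rho alpha r t) (ab_decay t r0).
- move=> r t r0.
  have sp u : sin (u + 2 * pi) = sin u :> R.
    by rewrite mulr_natl -[u + _]/(u + pi *+ 2) sinD2pi.
  have cp u : cos (u + 2 * pi) = cos u :> R.
    by rewrite mulr_natl -[u + _]/(u + pi *+ 2) cosD2pi.
  have sh : t + 2 * pi + alpha = t + alpha + 2 * pi by ring.
  by rewrite /Y /UU /DD /xx /yy /Psi sh sp cp perh perh1 pera// perb.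
- exact: osc_bound_continuous.
- have cY : cont2 (fun r t => Y r t) by rewrite /Y; repeat cont2_step.
  by move=> r t r0; exact: cont2_slice_fst cY r0.
Qed.

End Oscillatory.

(** * The argument of [gamma'] as a change of variable *)

Section Lift.
Variable R : realType.

(** A continuous determination of the argument of a differentiable plane curve
    is differentiable, because it is locally [atan (S / C)]. *)
Lemma lift_is_derive (g1 g2 p phi : R -> R) (t d1 d2 : R) :
  (forall s, 0 < p s) -> (forall s, g1 s = p s * cos (phi s)) ->
  (forall s, g2 s = p s * sin (phi s)) -> {for t, continuous phi} ->
  is_derive t 1 g1 d1 -> is_derive t 1 g2 d2 ->
  is_derive t 1 phi ((g1 t * d2 - g2 t * d1) / p t ^+ 2).
Proof.
move=> p0 g1E g2E cphi dg1 dg2.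
pose S s := g1 t * g2 s - g2 t * g1 s.
pose C s := g1 t * g1 s + g2 t * g2 s.
have SE s : S s = p t * p s * sin (phi s - phi t).
  by rewrite /S !g1E !g2E sinB; ring.
have CE s : C s = p t * p s * cos (phi s - phi t).
  by rewrite /C !g1E !g2E cosB; ring.
have Ct : C t = p t ^+ 2 by rewrite CE subrr cos0 mulr1 expr2.
have St : S t = 0 by rewrite SE subrr sin0 mulr0.
have pn : p t != 0 by rewrite gt_eqF.
pose f s := phi t + atan (S s / C s).
have df : is_derive t 1 f ((g1 t * d2 - g2 t * d1) / p t ^+ 2).
  have dS : is_derive t 1 S (g1 t * d2 - g2 t * d1) by rewrite /S; der; ring.
  have dC : is_derive t 1 C (g1 t * d1 + g2 t * d2) by rewrite /C; der; ring.
  rewrite /f; der; first by rewrite Ct expf_neq0.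
  by rewrite St Ct !mul0r expr0n addr0 invr1 mul1r add0r addr0.
have near_f : \forall s \near t, f s = phi s.
  have pi20 : (0 : R) < pi / 2 by rewrite divr_gt0// pi_gt0.
  move/cvgrPdist_lt: cphi => /(_ _ pi20); apply: filterS => s.
  rewrite distrC ltr_norml => /andP[l1 l2].
  rewrite /f SE CE -mulf_div divff ?mul1r; last by rewrite mulf_neq0// gt_eqF.
  have := @tanK R (phi s - phi t); rewrite /tan => ->; first by rewrite addrC subrK.
  by rewrite in_itv/= l1.
case: df => df1 df2; split; first exact: near_eq_derivable near_f df1.
by rewrite -df2; apply: near_eq_derive; apply: filterS near_f => s ->.
Qed.

(** At the end points of the segment only one-sided differences are known to
    have a sign. *)
Lemma derive_ge0_segment (psi : R -> R) (a b t d : R) : a < b -> a <= t <= b ->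
  (forall x y, a <= x -> x <= y -> y <= b -> psi x <= psi y) ->
  is_derive t 1 psi d -> 0 <= d.
Proof.
move=> ab /andP[at_ tb] mono [dpsi dE]; rewrite leNgt; apply/negP => d0.
move: dpsi; rewrite /derivable -/(derive psi t 1) => /cvg_ex[l /= cl].
have ld : l = d by rewrite -dE; apply/esym/cvg_lim.
have d20 : 0 < - d by rewrite oppr_gt0.
move/cvgrPdist_lt: cl => /(_ _ d20)[e /= e0 He].
have neg u : u != 0 -> `|u| < e -> u^-1 * (psi (u + t) - psi t) < 0.
  move=> u0 ue; have := He u; rewrite /= sub0r normrN => /(_ ue u0).
  by rewrite /GRing.scale/= mulr1 ld ltr_norml => /andP[? _]; lra.
have [tb'|bt] := ltP t b.
  pose u := Num.min (b - t) (e / 2).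
  have u0 : 0 < u by rewrite lt_min subr_gt0 tb' divr_gt0.
  have ue : u < e.
    apply: le_lt_trans (_ : e / 2 < _); first by rewrite ge_min lexx orbT.
    by rewrite ltr_pdivrMr// ltr_pMr// ltr1n.
  have ub : u <= b - t by rewrite ge_min lexx.
  have := neg u; rewrite gt_eqF// gtr0_norm// => /(_ isT ue).
  rewrite pmulr_rlt0 ?invr_gt0// subr_lt0 ltNge mono//; lra.
have {bt tb}tE : t = b by apply/eqP; rewrite eq_le tb.
pose u := Num.min (t - a) (e / 2).
have u0 : 0 < u by rewrite lt_min subr_gt0 tE ab divr_gt0.
have ue : u < e.
  apply: le_lt_trans (_ : e / 2 < _); first by rewrite ge_min lexx orbT.
  by rewrite ltr_pdivrMr// ltr_pMr// ltr1n.
have ub : u <= t - a by rewrite ge_min lexx.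
have := neg (- u); rewrite oppr_eq0 gt_eqF// normrN gtr0_norm// => /(_ isT ue).
rewrite invrN mulNr oppr_lt0 pmulr_rgt0 ?invr_gt0// subr_gt0 ltNge mono//; lra.
Qed.

(** If [psi] winds [n] times and takes each value modulo [2 pi] only [n] times
    then it cannot go back: a level crossed on the way down is crossed again, or
    lies outside [psi 0, psi (2 pi)], in addition to the [n] crossings forced by
    the intermediate value theorem. *)
Lemma n_to_1_monotone (psi : R -> R) (n : nat) (A : R -> set R) :
  continuous psi -> psi (2 * pi) = psi 0 + 2 * pi * n%:R ->
  (forall y, (A y #= `I_n)%card) ->
  (forall y t (k : int), 0 <= t -> t < 2 * pi -> psi t = y + 2 * pi * k%:~R -> A y t) ->
  forall t1 t2, 0 <= t1 -> t1 <= t2 -> t2 <= 2 * pi -> psi t1 <= psi t2.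
Proof.
move=> cpsi psin cardA subA t1 t2 t10 t12 t2p; rewrite leNgt; apply/negP => desc.
have pi20 : (0 : R) < 2 * pi by rewrite mulr_gt0// pi_gt0.
have t12' : t1 < t2.
  rewrite lt_neqAle t12 andbT; apply/negP => /eqP tt.
  by move: desc; rewrite tt ltxx.
have ivt (a b v : R) : a <= b -> psi a <= v <= psi b \/ psi b <= v <= psi a ->
    exists2 c, a <= c <= b & psi c = v.
  move=> ab H; have [||c] := @IVT _ psi a b v ab.
  - exact: continuous_subspaceT.
  - by case: H => /andP[H1 H2]; rewrite ge_min le_max H1 H2 ?orbT.
  - by rewrite in_itv/=; exists c.
(* [y] is a level crossed downwards between [t1] and [t2], and [y0] is its
   representative modulo [2 * pi] in the turn starting at [psi 0]. *)
pose y := (psi t1 + psi t2) / 2.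
have [y1 y2] : psi t2 < y /\ y < psi t1 by rewrite /y; split; lra.
pose k0 : int := - Num.floor ((y - psi 0) / (2 * pi)).
pose y0 := y + 2 * pi * k0%:~R.
have y0E : y0 = psi 0 + 2 * pi * ((y - psi 0) / (2 * pi) - (Num.floor ((y - psi 0) / (2 * pi)))%:~R).
  rewrite /y0 /k0 mulrNz mulrBr mulrCA mulfV ?gt_eqF// mulr1; ring.
have fl := real_floor_itv (num_real ((y - psi 0) / (2 * pi))).
have [y01 y02] : psi 0 <= y0 /\ y0 < psi 0 + 2 * pi.
  move: fl; rewrite y0E intrD => /andP[f1 f2]; split.
    by rewrite lerDl mulr_ge0 ?(ltW pi20)// subr_ge0.
  by rewrite ltrD2l -[ltRHS]mulr1 ltr_pM2l// ltrBlDl.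
have level (j : nat) : (j < n)%N -> exists t, [/\ 0 <= t, t < 2 * pi &
    psi t = y0 + 2 * pi * j%:R].
  move=> jn.
  have lt_end : y0 + 2 * pi * j%:R < psi (2 * pi).
    rewrite psin; apply: lt_le_trans (_ : psi 0 + 2 * pi + 2 * pi * j%:R <= _).
      by rewrite ltrD2r.
    rewrite -addrA lerD2l -{1}[2 * pi]mulr1 -mulrDr ler_wpM2l ?(ltW pi20)//.
    by rewrite addrC natr1 ler_nat.
  have [|c /andP[c0 c1] cE] := @ivt 0 (2 * pi) (y0 + 2 * pi * j%:R) (ltW pi20).
    left; rewrite (ltW lt_end) andbT (le_trans y01)// lerDl mulr_ge0 ?(ltW pi20)//.
  exists c; split => //; rewrite lt_neqAle c1 andbT.
  by apply/negP => /eqP cc; move: lt_end; rewrite -[X in psi X]cc cE ltxx.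
have /choice[f Hf] : forall j : nat, exists t, (j < n)%N -> [/\ 0 <= t, t < 2 * pi &
    psi t = y0 + 2 * pi * j%:R].
  move=> j; have [jn|nj] := boolP (j < n)%N; last by exists 0.
  by have [t Ht] := level j jn; exists t.
have fpsi i j : (i < n)%N -> (j < n)%N -> psi (f i) = psi (f j) -> i = j.
  move=> /Hf[_ _ ->] /Hf[_ _ ->] /addrI /(mulfI (lt0r_neq0 pi20)) /eqP.
  by rewrite eqr_nat => /eqP.
(* A further solution: if [y] is a value between those at the end points it is
   also crossed upwards on both sides of the descent, and one of these two
   crossings is not among the [f j]; otherwise no [f j] is at level [y]. *)
have [v [v0 vp vE vf]] : exists v, [/\ 0 <= v, v < 2 * pi, psi v = y &
    forall j, (j < n)%N -> f j != v].
  have [inside|outside] := pselect (psi 0 <= y /\ y < psi (2 * pi)).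
    case: inside => i1 i2.
    have [|u /andP[u0 ut] uE] := @ivt 0 t1 y t10; first by left; rewrite i1 ltW.
    have [|w /andP[tw wp] wE] := @ivt t2 (2 * pi) y t2p.
      by left; rewrite (ltW y1) ltW.
    have wp' : w < 2 * pi.
      rewrite lt_neqAle wp andbT; apply/negP => /eqP ww.
      by move: i2; rewrite -ww wE ltxx.
    have uw : u < w by exact: le_lt_trans ut (lt_le_trans t12' tw).
    have [hu|hu] := pselect (forall j, (j < n)%N -> f j != u).
      by exists u; split => //; exact: lt_trans uw wp'.
    exists w; split => //; first exact: le_trans u0 (ltW uw).
    move=> j jn; apply/eqP => jw; apply: hu => i iN; apply/eqP => iu.
    have ij : i = j by apply: fpsi => //; rewrite iu jw uE wE.
    by move: uw; rewrite -iu -jw ij ltxx.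
  have [|v /andP[v1 v2] vE] := @ivt t1 t2 y t12.
    by right; rewrite (ltW y1) (ltW y2).
  exists v; split => //; first exact: le_trans t10 v1.
    apply: lt_le_trans t2p; rewrite lt_neqAle v2 andbT.
    by apply/negP => /eqP vv; move: y1; rewrite -vv vE ltxx.
  move=> j jn; apply/eqP => jv; apply: outside; rewrite -vE -jv.
  have [_ _ ->] := Hf _ jn; split.
    by rewrite (le_trans y01)// lerDl mulr_ge0 ?(ltW pi20).
  rewrite psin; apply: lt_le_trans (_ : psi 0 + 2 * pi + 2 * pi * j%:R <= _).
    by rewrite ltrD2r.
  rewrite -addrA lerD2l -{1}[2 * pi]mulr1 -mulrDr ler_wpM2l ?(ltW pi20)//.
  by rewrite addrC natr1 ler_nat.
pose F j := if (j < n)%N then f j else v.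
have Finj : {in `I_n.+1 &, injective F}.
  move=> i j /set_mem/= iN /set_mem/= jN; rewrite /F.
  have [il|il] := ltnP i n; have [jl|jl] := ltnP j n.
  - by move=> fij; apply: fpsi => //; rewrite fij.
  - by move=> fiv; have := vf i il; rewrite fiv eqxx.
  - by move=> fiv; have := vf j jl; rewrite -fiv eqxx.
  - have -> : i = n by apply/eqP; rewrite eqn_leq il andbT -ltnS.
    by have -> : j = n by apply/eqP; rewrite eqn_leq jl andbT -ltnS.
have FA : F @` `I_n.+1 `<=` A y.
  move=> _ [j /= jN <-]; rewrite /F; case: ltnP => jl.
    have [a1 a2 a3] := Hf _ jl.
    apply: (@subA _ _ (k0 + j%:Z)) => //; rewrite a3 /y0.
    have -> : (k0 + j%:Z)%:~R = k0%:~R + j%:R :> R by rewrite intrD.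
    by rewrite (mulrDr (2 * pi)) addrA.
  by apply: (@subA _ _ 0) => //; rewrite vE mulr0z mulr0 addr0.
have := subset_card_le FA.
rewrite (card_le_eql (inj_card_eq Finj)) (card_le_eqr (cardA y)) card_le_II.
by rewrite ltnn.
Qed.

End Lift.

Section AngleIntegral.
Variable R : realType.
Notation mu := (@lebesgue_measure R).

Lemma cos_2pin (x : R) (k : nat) : cos (x + 2 * pi * k%:R) = cos x.
Proof.
elim: k => [|k IH]; first by rewrite mulr0 addr0.
rewrite -[k.+1%:R]natr1 (mulrDr (2 * pi)) mulr1 addrA (mulr_natl (pi : R) 2) cosD2pi.
by rewrite -(mulr_natl (pi : R) 2).
Qed.

Lemma sin_2pin (x : R) (k : nat) : sin (x + 2 * pi * k%:R) = sin x.
Proof.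
elim: k => [|k IH]; first by rewrite mulr0 addr0.
rewrite -[k.+1%:R]natr1 (mulrDr (2 * pi)) mulr1 addrA (mulr_natl (pi : R) 2) sinD2pi.
by rewrite -(mulr_natl (pi : R) 2).
Qed.

Lemma cos_2piz (x : R) (k : int) : cos (x + 2 * pi * k%:~R) = cos x.
Proof.
case: k => k; first exact: cos_2pin.
by rewrite NegzE mulrNz mulrN -(cos_2pin _ k.+1) subrK.
Qed.

Lemma sin_2piz (x : R) (k : int) : sin (x + 2 * pi * k%:~R) = sin x.
Proof.
case: k => k; first exact: sin_2pin.
by rewrite NegzE mulrNz mulrN -(sin_2pin _ k.+1) subrK.
Qed.

Variables (rho a0 : R).
Hypothesis rho0 : 0 < rho.

Let eps : R := rho / (rho + 2).
Let eps0 : 0 < eps. Proof. by rewrite divr_gt0// addr_gt0. Qed.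
Let cos1 (x : R) : `|cos x| <= 1.
Proof. by rewrite ler_norml cos_geN1 cos_le1. Qed.

Let K (x : R) : R := Num.max (cos (x - a0)) 0 / angle_width rho eps (cos (x - a0)).
Let E (x : R) : R := asinh ((rho + 2) * sin (x - a0)) / rho.
Let B : R := 6 * ln (rho + 2) / rho.

Let width_gt0 x : 0 < angle_width rho eps (cos x).
Proof. by rewrite sqrtr_gt0; exact: angle_width_arg_gt0. Qed.

Let K_ge0 x : 0 <= K x.
Proof. by rewrite divr_ge0 ?(ltW (width_gt0 _))// le_max lexx orbT. Qed.

Let c2cos : cont2 (fun _ x => cos (x - a0)).
Proof. by apply: cont2_snd => x; apply: der_continuous; der. Qed.

Let c2width : cont2 (fun _ x => (angle_width rho eps (cos (x - a0)))^-1).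
Proof.
apply: cont2V; last by move=> _ x _; rewrite gt_eqF.
apply: (@cont2_comp _ (@Num.sqrt R)); first exact: sqrt_continuous.
by repeat cont2_step.
Qed.

Let cK : continuous K.
Proof.
have c : cont2 (fun _ x => K x).
  rewrite /K; apply: cont2M => //; apply: cont2_snd => x.
  apply: continuous_max; last exact: cst_continuous.
  exact: (cont2_slice_snd c2cos ltr01).
exact: (cont2_slice_snd c ltr01).
Qed.

Let dE (x : R) : is_derive x 1 E (cos (x - a0) / angle_width rho eps (cos (x - a0))).
Proof.
have ds : is_derive x 1 (fun x : R => (rho + 2) * sin (x - a0)) ((rho + 2) * cos (x - a0)).
  by der; ring.
apply: der_eq (derM (der_asinh ds) (der_cst rho^-1 x)) _.
rewrite mulr0 addr0.
have -> : angle_width rho eps (cos (x - a0)) =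
    eps * Num.sqrt (1 + ((rho + 2) * sin (x - a0)) ^+ 2).
  rewrite -[in RHS](gtr0_norm eps0) -sqrtr_sqr -sqrtrM ?sqr_ge0//.
  congr (Num.sqrt _).
  have -> : 1 - cos (x - a0) ^+ 2 = sin (x - a0) ^+ 2.
    by rewrite -(cos2Dsin2 (x - a0)) addrC addKr.
  rewrite /eps; field.
  by rewrite gt_eqF// addr_gt0.
have : 0 < Num.sqrt (1 + ((rho + 2) * sin (x - a0)) ^+ 2) by rewrite sqrtr_gt0 oneD_sqr_gt0.
rewrite /eps; move: (Num.sqrt _) => S S0; field.
by rewrite !gt_eqF// addr_gt0.
Qed.

(** The angles at which the cosine turns positive. *)
Definition is_start (z : R) := cos (z - a0) = 0 /\ sin (z - a0) = -1.

Let G (z x : R) : R := \int[mu]_(u in `[z - 1, x]) K u.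

Let dG (z x : R) : z <= x -> is_derive x 1 (G z) (K x).
Proof.
move=> zx; have [] := @continuous_FTC1_closed R K (z - 1) x (x + 1) _ _ _ (@cK x).
- by rewrite ltrDl.
- exact: continuous_segment_integrable.
- by apply: lt_le_trans zx; rewrite gtrBl.
by move=> h1 h2; split; [exact: h1|rewrite -derive1E; exact: h2].
Qed.

Let G_incr z x y : z <= x -> x < y -> G z y - G z x = \int[mu]_(u in `[x, y]) K u.
Proof.
move=> zx xy; apply/esym; apply: (Rintegral_is_derive (F := G z) xy).
  exact: continuous_subspaceT.
by move=> u /andP[xu _]; apply: dG; exact: le_trans xu.
Qed.

Let G_mono z x y : z <= x -> x <= y -> G z x <= G z y.
Proof.
move=> zx; rewrite le_eqVlt => /predU1P[->//|xy].
rewrite -subr_ge0 G_incr//; apply: Rintegral_ge0 => u _; exact: K_ge0.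
Qed.

Let start_angle z u : is_start z -> cos (u - a0) = sin (u - z).
Proof.
case=> c s; rewrite (_ : u - a0 = (z - a0) + (u - z)); last by ring.
by rewrite cosD c s mul0r sub0r mulN1r opprK.
Qed.

Let G_period z z' : is_start z' -> z <= z' -> G z (z' + 2 * pi) - G z z' <= B.
Proof.
move=> sz zz; have p0 : (0 : R) < pi := pi_gt0 R.
have l1 : z' < z' + pi by rewrite ltrDl.
have l2 : z' + pi < z' + 2 * pi by rewrite ltrD2l ltr_pMl// ltr1n.
have zz' : z <= z' + pi by rewrite (le_trans zz)// ltW.
rewrite (_ : _ - _ = (G z (z' + 2 * pi) - G z (z' + pi)) + (G z (z' + pi) - G z z')); last by ring.
rewrite (G_incr zz' l2) (G_incr zz l1).
have -> : \int[mu]_(u in `[(z' + pi), (z' + 2 * pi)]) K u = 0.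
  rewrite (@eq_Rintegral _ _ _ mu _ (fun=> 0)); last first.
    move=> u /set_mem/=; rewrite in_itv/= => /andP[u1 u2].
    rewrite /K (start_angle u sz) (max_idPr _) ?mul0r//.
    rewrite (_ : u - z' = (u - z' - pi) + pi); last by ring.
    rewrite sinDpi oppr_le0 sin_ge0_pi//; apply/andP; split; lra.
  by rewrite Rintegral_segment_cst// mul0r.
have -> : \int[mu]_(u in `[z', (z' + pi)]) K u =
    \int[mu]_(u in `[z', (z' + pi)]) (cos (u - a0) / angle_width rho eps (cos (u - a0))).
  apply: eq_Rintegral => u /set_mem/=; rewrite in_itv/= => /andP[u1 u2].
  rewrite /K (max_idPl _)// (start_angle u sz) sin_ge0_pi//; apply/andP; split; lra.
have -> : \int[mu]_(u in `[z', (z' + pi)]) (cos (u - a0) / angle_width rho eps (cos (u - a0)))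
    = E (z' + pi) - E z'.
  apply: (Rintegral_is_derive (F := E)) => //.
  apply: continuous_subspaceT; exact: (cont2_slice_snd (cont2M c2cos c2width) ltr01).
rewrite add0r /E /B -mulrBl ler_wpM2r ?invr_ge0 ?(ltW rho0)//.
have b x : `|asinh ((rho + 2) * sin x)| <= 3 * ln (rho + 2).
  apply: asinh_log_bound => //; have r2 : 0 < rho + 2 by rewrite addr_gt0.
  rewrite normrM (gtr0_norm r2) ler_piMr ?(ltW r2)//.
  by rewrite ler_norml sin_geN1 sin_le1.
have := b (z' + pi - a0); have := b (z' - a0).
rewrite !ler_norml => /andP[? ?] /andP[? ?]; lra.
Qed.

Let G_periods z (j : nat) : is_start z -> G z (z + 2 * pi * j%:R) - G z z <= j%:R * B.
Proof.
move=> sz; have p0 : (0 : R) < pi := pi_gt0 R.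
elim: j => [|j IH]; first by rewrite mulr0 addr0 subrr mul0r.
have sj : is_start (z + 2 * pi * j%:R).
  by case: sz => c s; split; rewrite addrAC ?cos_2pin ?sin_2pin.
have zj : z <= z + 2 * pi * j%:R by rewrite lerDl !mulr_ge0// ltW.
have step := G_period sj zj.
have -> : z + 2 * pi * j.+1%:R = z + 2 * pi * j%:R + 2 * pi.
  by rewrite -[j.+1%:R]natr1 (mulrDr (2 * pi)) mulr1 addrA.
rewrite -[j.+1%:R]natr1 (mulrDl _ _ B) mul1r.
by rewrite -[X in X - _](subrK (G z (z + 2 * pi * j%:R))) -addrA addrC lerD.
Qed.

(** The substitution [x = psi t]; each turn of the angle contributes the total
    variation of [asinh ((rho + 2) sin x) / rho] over the half turn on which
    the cosine is positive. *)
Lemma angle_integral (psi dpsi : R -> R) (n : nat) :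
  (forall t : R, is_derive t 1 psi (dpsi t)) -> continuous dpsi ->
  (forall t, 0 <= t <= 2 * pi -> psi 0 <= psi t) ->
  psi (2 * pi) = psi 0 + 2 * pi * n%:R ->
  \int[mu]_(t in `[0, 2 * pi]) (dpsi t * (Num.max (cos (psi t - a0)) 0 /
     angle_width rho (rho / (rho + 2)) (cos (psi t - a0)))) <=
  n.+1%:R * (6 * ln (rho + 2) / rho).
Proof.
move=> dp cdp mono psin; have p0 : (0 : R) < pi := pi_gt0 R.
have pi20 : (0 : R) < 2 * pi by rewrite mulr_gt0.
(* The turn containing [psi 0] is started at [z], so that [n.+1] turns cover the
   range of [psi]. *)
pose k : int := Num.floor ((psi 0 - a0 + pi / 2) / (2 * pi)).
pose z := a0 - pi / 2 + 2 * pi * k%:~R.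
have sz : is_start z.
  rewrite /is_start (_ : z - a0 = - (pi / 2) + 2 * pi * k%:~R); last by rewrite /z; ring.
  by rewrite cos_2piz sin_2piz cosN sinN cos_pihalf sin_pihalf.
have /andP[f1 f2] := real_floor_itv (num_real ((psi 0 - a0 + pi / 2) / (2 * pi))).
rewrite -/k in f1 f2.
have zp : z <= psi 0.
  by move: f1; rewrite ler_pdivlMr// /z; lra.
have pz : psi 0 < z + 2 * pi.
  have e : (k + 1)%:~R * (2 * pi) = 2 * pi * k%:~R + 2 * pi :> R.
    by rewrite intrD (mulrDl _ _ (2 * pi)) mul1r mulrC.
  by move: f2; rewrite ltr_pdivrMr// e /z => f2; lra.
have cpsi : continuous psi by move=> t; exact: der_continuous (dp t).
have -> : \int[mu]_(t in `[0, 2 * pi]) (dpsi t * K (psi t)) = G z (psi (2 * pi)) - G z (psi 0).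
  apply: (Rintegral_is_derive (F := fun t => G z (psi t)) pi20).
    have c : cont2 (fun _ t => dpsi t * K (psi t)).
      by apply: cont2M; [exact: cont2_snd|apply: cont2_comp => //; exact: cont2_snd].
    by apply: continuous_subspaceT; exact: (cont2_slice_snd c ltr01).
  move=> t tc; apply: der_eq (@der_comp _ (G z) psi t _ _ (dG _) (dp t)) (mulrC _ _).
  exact: le_trans zp (mono t tc).
have end_le : psi (2 * pi) <= z + 2 * pi * n.+1%:R.
  by rewrite psin -[n.+1%:R]natr1 (mulrDr (2 * pi)) mulr1; lra.
have zpsi : z <= psi (2 * pi) by rewrite psin (le_trans zp)// lerDl !mulr_ge0// ltW.
have g1 := G_mono zpsi end_le.
have g2 := G_mono (lexx z) zp.
have g3 := G_periods n.+1 sz.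
apply: le_trans g3; exact: lerB.
Qed.

End AngleIntegral.

(** * The weighted [L^1] estimate for [m] *)

Section ContinuousIntegrals.
Variable R : realType.
Notation mu := (@lebesgue_measure R).
Implicit Types (f g : R -> R) (a b c : R).

Lemma le_Rintegral_continuous f g a b : continuous f -> continuous g ->
  (forall x, a <= x <= b -> f x <= g x) ->
  \int[mu]_(x in `[a, b]) f x <= \int[mu]_(x in `[a, b]) g x.
Proof.
move=> cf cg fg; apply: le_Rintegral => //; exact: continuous_segment_integrable.
Qed.

Lemma RintegralD_continuous f g a b : continuous f -> continuous g ->
  \int[mu]_(x in `[a, b]) (f x + g x) =
  \int[mu]_(x in `[a, b]) f x + \int[mu]_(x in `[a, b]) g x.
Proof. by move=> cf cg; apply: RintegralD => //; exact: continuous_segment_integrable. Qed.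

Lemma RintegralZl_continuous f c a b : continuous f ->
  \int[mu]_(x in `[a, b]) (c * f x) = c * \int[mu]_(x in `[a, b]) f x.
Proof. by move=> cf; apply: RintegralZl => //; exact: continuous_segment_integrable. Qed.

End ContinuousIntegrals.

Section WeightedL1.
Variable R : realType.
Notation mu := (@lebesgue_measure R).

(** With [m = (u, v)] and [f = g m + m'], the modulus satisfies the damped
    inequality [|m|' <= |f| - g |m|]; the weight [a] has derivative [p' / p]. *)
Lemma weighted_pointwise (u v u' v' p p' g a eta m2 mu_ : R) :
  0 < p -> 1 <= a -> `|p' / p| <= g - 1 -> 0 < eta ->
  m2 = u ^+ 2 + v ^+ 2 ->
  mu_ = Num.sqrt (m2 + eta ^+ 2) ->
  g * Num.sqrt m2 / p + (p' / p * mu_ / p + a * (u * u' + v * v') / (mu_ * p)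
     - a * mu_ * p' / p ^+ 2) <=
  a * (Num.sqrt ((g * u + u') ^+ 2 + (g * v + v') ^+ 2) / p) + eta * (a * (g / p)).
Proof.
move=> p0 a1 Lg eta0 m2E muD.
have m20 : 0 <= m2 by rewrite m2E addr_ge0 ?sqr_ge0.
have s0 : 0 < m2 + eta ^+ 2 by rewrite ltr_wpDl// exprn_gt0.
have mu0 : 0 < mu_ by rewrite muD sqrtr_gt0.
have muE : mu_ ^+ 2 = m2 + eta ^+ 2 by rewrite muD sqr_sqrtr// ltW.
set mm := Num.sqrt m2.
have mm0 : 0 <= mm by exact: sqrtr_ge0.
have mmE : mm ^+ 2 = m2 by rewrite sqr_sqrtr.
have mmu : mm <= mu_ by rewrite muD ler_wsqrtr// lerDl sqr_ge0.
have emu : eta <= mu_.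
  by apply: le_of_sqr; [exact: ltW|rewrite muE lerDr].
set f1 := g * u + u'; set f2 := g * v + v'.
set ff := Num.sqrt (f1 ^+ 2 + f2 ^+ 2).
have ff0 : 0 <= ff by exact: sqrtr_ge0.
have ffE : ff ^+ 2 = f1 ^+ 2 + f2 ^+ 2 by rewrite sqr_sqrtr// addr_ge0 ?sqr_ge0.
have cs : u * f1 + v * f2 <= mm * ff.
  apply: le_trans (ler_norm _) _; apply: cauchy_schwarz2 => //.
    by rewrite mmE m2E.
  by rewrite ffE.
have g1 : 1 <= g by move: (normr_ge0 (p' / p)) Lg; lra.
have mun : mu_ != 0 by rewrite gt_eqF.
have pn : p != 0 by rewrite gt_eqF.
set L := p' / p in Lg.
have uv : (u * u' + v * v') / mu_ <= ff - g * (mu_ - eta).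
  rewrite ler_pdivrMr//.
  have -> : u * u' + v * v' = (u * f1 + v * f2) - g * m2.
    by rewrite /f1 /f2 m2E; ring.
  have h1 : mm * ff <= ff * mu_ by rewrite mulrC ler_wpM2l.
  have h2 : g * ((mu_ - eta) * mu_) <= g * m2.
    rewrite ler_wpM2l//; first lra.
    have -> : m2 = mu_ ^+ 2 - eta ^+ 2 by rewrite muE addrK.
    rewrite -subr_ge0 (_ : _ - _ = eta * (mu_ - eta)); last by ring.
    by rewrite mulr_ge0 ?subr_ge0// ltW.
  rewrite mulrBl -mulrA; lra.
rewrite (_ : _ + _ = (g * mm + L * mu_ * (1 - a) + a * ((u * u' + v * v') / mu_)) / p); last first.
  by rewrite /L; field; rewrite mun pn.
rewrite (_ : a * (ff / p) + eta * (a * (g / p)) = (a * ff + eta * a * g) / p); last by field.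
rewrite ler_wpM2r ?invr_ge0 ?(ltW p0)//.
have k1 : a * ((u * u' + v * v') / mu_) <= a * (ff - g * (mu_ - eta)).
  by rewrite ler_wpM2l//; lra.
have k2 : L * mu_ * (1 - a) <= (g - 1) * mu_ * (a - 1).
  rewrite (_ : L * mu_ * (1 - a) = - L * (mu_ * (a - 1))); last by ring.
  rewrite -mulrA ler_wpM2r ?mulr_ge0 ?subr_ge0 ?(ltW mu0)//.
  by move: Lg; rewrite ler_norml => /andP[? _]; lra.
have k3 : g * mm <= g * mu_ by rewrite ler_wpM2l//; lra.
have k4 : 0 <= (a - 1) * mu_ by rewrite mulr_ge0 ?subr_ge0// ltW.
have k5 : (g - 1) * mu_ * (a - 1) + g * mu_ + a * (ff - g * (mu_ - eta)) =
  a * ff + eta * a * g - (a - 1) * mu_ by ring.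
apply: le_trans (lerD (lerD k3 k2) k1) _.
rewrite (addrC (g * mu_)) k5; lra.
Qed.

Variables (u v u' v' p p' q : R -> R) (delta P : R).
Hypotheses (delta0 : 0 < delta) (dp : forall t, delta <= p t) (pP : forall t, p t <= P).
Hypotheses (du : forall t : R, is_derive t 1 u (u' t)) (dv : forall t : R, is_derive t 1 v (v' t)).
Hypothesis dpp : forall t : R, is_derive t 1 p (p' t).
Hypotheses (cu' : continuous u') (cv' : continuous v') (cp' : continuous p') (cq : continuous q).
Hypothesis p'q : forall t, `|p' t| <= q t.
Hypotheses (pu : u (2 * pi) = u 0) (pv : v (2 * pi) = v 0) (ppp : p (2 * pi) = p 0).

Let g t := 1 + q t / p t.

Let p0 t : 0 < p t. Proof. exact: lt_le_trans (dp t). Qed.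

(** A damped equation [m' + g m = f] on the circle controls [g m] by [f] in
    [L^1]; the weight [1 / p] spoils this because it may grow as fast as the
    damping. Multiplying [|m| / p] by the slowly varying weight
    [1 + ln (p / delta)] before integrating the derivative over the circle
    repairs this: where [p] decreases, the derivative of the weight makes up for
    the growth of [1 / p]. The square root is smoothed by [eta] to allow zeros
    of [m]. *)
Lemma weighted_L1 :
  \int[mu]_(t in `[0, 2 * pi]) (g t * Num.sqrt (u t ^+ 2 + v t ^+ 2) / p t) <=
  (1 + ln (P / delta)) * \int[mu]_(t in `[0, 2 * pi])
     (Num.sqrt ((g t * u t + u' t) ^+ 2 + (g t * v t + v' t) ^+ 2) / p t).
Proof.
have pi20 : (0 : R) < 2 * pi by rewrite mulr_gt0// pi_gt0.
have pn t : p t != 0 by rewrite gt_eqF.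
pose a t := 1 + ln (p t / delta).
have pd t : 0 < p t / delta by rewrite divr_gt0.
have a1 t : 1 <= a t.
  by rewrite lerDl ln_ge0// ler_pdivlMr// mul1r.
have aP t : a t <= 1 + ln (P / delta).
  rewrite lerD2l ler_ln ?posrE//; last by rewrite divr_gt0// (lt_le_trans (p0 0)).
  by rewrite ler_wpM2r// invr_ge0 ltW.
have cu : cont2 (fun _ t => u t) by apply: cont2_snd => t; exact: der_continuous (du t).
have cv : cont2 (fun _ t => v t) by apply: cont2_snd => t; exact: der_continuous (dv t).
have cp : cont2 (fun _ t => p t) by apply: cont2_snd => t; exact: der_continuous (dpp t).
have c2u' : cont2 (fun _ t => u' t) by exact: cont2_snd.
have c2v' : cont2 (fun _ t => v' t) by exact: cont2_snd.
have c2p' : cont2 (fun _ t => p' t) by exact: cont2_snd.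
have c2q : cont2 (fun _ t => q t) by exact: cont2_snd.
have cpV : cont2 (fun _ t => (p t)^-1) by apply: cont2V.
have c2g : cont2 (fun _ t => g t) by rewrite /g; repeat cont2_step.
have c2a : cont2 (fun _ t => a t).
  by apply: cont2_snd => t; have := dpp t => dt; apply: der_continuous; rewrite /a; der.
have c2mm : cont2 (fun _ t => Num.sqrt (u t ^+ 2 + v t ^+ 2)).
  by apply: (@cont2_comp _ (@Num.sqrt R)); [exact: sqrt_continuous|repeat cont2_step].
have c2ff : cont2 (fun _ t => Num.sqrt ((g t * u t + u' t) ^+ 2 + (g t * v t + v' t) ^+ 2)).
  by apply: (@cont2_comp _ (@Num.sqrt R)); [exact: sqrt_continuous|repeat cont2_step].
pose lhs t := g t * Num.sqrt (u t ^+ 2 + v t ^+ 2) / p t.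
pose rhs t := Num.sqrt ((g t * u t + u' t) ^+ 2 + (g t * v t + v' t) ^+ 2) / p t.
pose err t := a t * (g t / p t).
have slice f : cont2 (fun _ t => f t) -> continuous f.
  by move=> c; exact: (cont2_slice_snd c ltr01).
have clhs : continuous lhs by apply: slice; rewrite /lhs; repeat cont2_step.
have crhs : continuous rhs by apply: slice; rewrite /rhs; repeat cont2_step.
have carhs : continuous (fun t => a t * rhs t) by apply: slice; rewrite /rhs; repeat cont2_step.
have cerr : continuous err by apply: slice; rewrite /err; repeat cont2_step.
have rhs0 t : 0 <= rhs t by rewrite divr_ge0 ?sqrtr_ge0// ltW.
have err0 t : 0 <= err t.
  rewrite mulr_ge0 ?(le_trans ler01 (a1 t))// divr_ge0 ?(ltW (p0 t))//.
  by rewrite addr_ge0// divr_ge0 ?(ltW (p0 t))// (le_trans _ (p'q t)).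
have main eta : 0 < eta -> \int[mu]_(t in `[0, 2 * pi]) lhs t <=
    \int[mu]_(t in `[0, 2 * pi]) (a t * rhs t) + eta * \int[mu]_(t in `[0, 2 * pi]) err t.
  move=> eta0.
  pose m2 t := u t ^+ 2 + v t ^+ 2.
  pose mu_ t := Num.sqrt (m2 t + eta ^+ 2).
  have s0 t : 0 < m2 t + eta ^+ 2.
    by rewrite ltr_wpDl ?exprn_gt0// addr_ge0 ?sqr_ge0.
  have mu0 t : 0 < mu_ t by rewrite sqrtr_gt0.
  pose H t := a t * mu_ t / p t.
  pose dH t := p' t / p t * mu_ t / p t + a t * (u t * u' t + v t * v' t) / (mu_ t * p t)
     - a t * mu_ t * p' t / p t ^+ 2.
  have dHE (t : R) : is_derive t 1 H (dH t).
    have d1 := du t; have d2 := dv t; have d3 := dpp t.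
    have da : is_derive t 1 a (p' t / p t).
      by rewrite /a; der; [exact: pd|field; rewrite pn gt_eqF].
    have dm : is_derive t 1 mu_ ((u t * u' t + v t * v' t) / mu_ t).
      rewrite /mu_ /m2; der; first exact: s0.
      have := mu0 t; rewrite /mu_ /m2; move: (Num.sqrt _) => S S0.
      by rewrite !expr1; field; rewrite gt_eqF.
    apply: der_eq (derM (derM da dm) (derV (pn t) d3)) _.
    by rewrite /dH; field; rewrite pn gt_eqF.
  have c2mu : cont2 (fun _ t => mu_ t).
    by rewrite /mu_ /m2; apply: (@cont2_comp _ (@Num.sqrt R));
      [exact: sqrt_continuous|repeat cont2_step].
  have c2muV : cont2 (fun _ t => (mu_ t)^-1).
    by apply: cont2V => // _ t _; rewrite gt_eqF.
  have cdH : continuous dH.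
    apply: slice.
    have -> : (fun _ t : R => dH t) = (fun _ t => p' t * (p t)^-1 * mu_ t * (p t)^-1
        + a t * (u t * u' t + v t * v' t) * ((mu_ t)^-1 * (p t)^-1)
        - a t * mu_ t * p' t * ((p t)^-1 * (p t)^-1)).
      by apply/funext => _; apply/funext => t; rewrite /dH !invfM.
    by repeat cont2_step.
  have H0 : \int[mu]_(t in `[0, 2 * pi]) dH t = 0.
    have -> : \int[mu]_(t in `[0, 2 * pi]) dH t = H (2 * pi) - H 0.
      by apply: (Rintegral_is_derive (F := H)) => //; exact: continuous_subspaceT.
    by rewrite /H /a /mu_ /m2 pu pv ppp subrr.
  rewrite -RintegralZl_continuous// -RintegralD_continuous//; last first.
    by apply: slice; apply: cont2M; [exact: cont2_cst|exact: cont2_snd].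
  have -> : \int[mu]_(t in `[0, 2 * pi]) lhs t = \int[mu]_(t in `[0, 2 * pi]) (lhs t + dH t).
    by rewrite RintegralD_continuous// H0 addr0.
  apply: le_Rintegral_continuous.
  - by apply: slice; apply: cont2D; exact: cont2_snd.
  - apply: slice; apply: cont2D; first exact: cont2_snd.
    by apply: cont2M; [exact: cont2_cst|exact: cont2_snd].
  - move=> t _; apply: (@weighted_pointwise (u t) (v t) (u' t) (v' t) (p t) (p' t) (g t) (a t) eta (m2 t) (mu_ t)) => //.
    rewrite /g addrAC subrr add0r normrM normfV (gtr0_norm (p0 t)).
    by rewrite ler_wpM2r// invr_ge0 ltW.
have main2 : \int[mu]_(t in `[0, 2 * pi]) lhs t <= \int[mu]_(t in `[0, 2 * pi]) (a t * rhs t).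
  apply/ler_addgt0Pl => e e0.
  have I0 : 0 <= \int[mu]_(t in `[0, 2 * pi]) err t by exact: Rintegral_ge0.
  have I1 : 0 < \int[mu]_(t in `[0, 2 * pi]) err t + 1 by rewrite ltr_wpDl.
  have eta0 : 0 < e / (\int[mu]_(t in `[0, 2 * pi]) err t + 1) by rewrite divr_gt0.
  apply: le_trans (main _ eta0) _; rewrite addrC lerD2r.
  by rewrite mulrAC ler_pdivrMr// ler_wpM2l ?(ltW e0)// lerDl.
apply: le_trans main2 _; rewrite -RintegralZl_continuous//.
apply: le_Rintegral_continuous => //.
  by apply: slice; apply: cont2M; [exact: cont2_cst|exact: cont2_snd].
by move=> t _; rewrite ler_wpM2r.
Qed.

End WeightedL1.

(** * From essential suprema to pointwise bounds *)

Section EssSup.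
Variable R : realType.
Notation mu := (@lebesgue_measure R).

Lemma Lnorm_oo_ae d (T : measurableType d) (nu : {measure set T -> \bar R})
    (f : T -> \bar R) (N : \bar R) :
  ('N[nu]_+oo%E[f] <= N)%E -> {ae nu, forall x, (`|f x| <= N)%E}.
Proof.
rewrite unlock; case: ifPn => [_|]; first by move/ess_supP.
rewrite -leNgt => nu0 _; exists setT; split => //.
by apply/eqP; rewrite eq_le nu0 measure_ge0.
Qed.

Lemma ae_interval (P : R -> Prop) (a b : R) : a < b ->
  {ae mu, forall x, P x} -> exists2 x, a < x < b & P x.
Proof.
move=> ab [N [mN N0 PN]]; apply: contrapT => H.
have sub : `]a, b[%classic `<=` N.
  move=> x /=; rewrite in_itv/= => xab; apply: PN => /= Px.
  by apply: H; exists x.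
have : (mu `]a, b[ <= mu N)%E by apply: le_measure; rewrite ?inE.
by rewrite [X in (_ <= X)%E]N0 lebesgue_measure_itv/= lte_fin ab lee_fin leNgt subr_gt0 ab.
Qed.

(** A strict inequality at one point persists on a neighbourhood, which meets
    every set of full measure. *)
Lemma ae_le_segment (f g : R -> R) (a b : R) : a < b ->
  continuous f -> continuous g ->
  {ae mu, forall t, a <= t <= b -> f t <= g t} ->
  forall t, a <= t <= b -> f t <= g t.
Proof.
move=> ab cf cg fg t tab; have /andP[at_ tb] := tab; rewrite leNgt; apply/negP => gf.
have c : {for t, continuous (fun s => f s - g s)} by apply: continuousB; [exact: cf|exact: cg].
have e0 : 0 < f t - g t by rewrite subr_gt0.
move/cvgrPdist_lt: c => /(_ _ e0)[e /= ep He].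
have bad s : `|t - s| < e -> g s < f s.
  by move=> /He; rewrite ltr_norml => /andP[_]; lra.
have [tb'|bt] := ltP t b.
  have lt : t < Num.min b (t + e) by rewrite lt_min tb' ltrDl.
  have [s /andP[ts]] := ae_interval lt fg.
  rewrite lt_min => /andP[sb se] Ps.
  have /bad : `|t - s| < e by rewrite distrC gtr0_norm ?subr_gt0// ltrBlDl.
  by rewrite ltNge Ps// (le_trans at_ (ltW ts)) ltW.
have {bt tb}tE : t = b by apply/eqP; rewrite eq_le tb.
have lt : Num.max a (t - e) < t by rewrite gt_max tE ab gtrBl.
have [s /andP[]] := ae_interval lt fg.
rewrite gt_max => /andP[as_ se] st Ps.
have /bad : `|t - s| < e by rewrite gtr0_norm ?subr_gt0// ltrBlDl -ltrBlDr.
by rewrite ltNge Ps// (ltW as_) -tE ltW.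
Qed.

Lemma ae_box (P : R * R -> Prop) (a b c d : R) : a < b -> c < d ->
  {ae (mu \x mu)%E, forall p, P p} ->
  exists r t, [/\ a < r < b, c < t < d & P (r, t)].
Proof.
move=> ab cd [N [mN N0 PN]]; apply: contrapT => H.
pose box : set (measurableTypeR R * measurableTypeR R) := `]a, b[%classic `*` `]c, d[%classic.
have mbox : measurable box by apply: measurableX.
have sub : box `<=` N.
  move=> [r t] /= [/=]; rewrite !in_itv/= => rab tcd; apply: PN => /= Px.
  by apply: H; exists r, t.
have : ((mu \x mu) box <= (mu \x mu) N)%E by apply: le_measure; rewrite ?inE.
rewrite [X in (_ <= X)%E]N0 /box product_measure1E//= !lebesgue_measure_itv/= !lte_fin ab cd.
by rewrite -!EFinD -EFinM lee_fin leNgt mulr_gt0 ?subr_gt0.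
Qed.

Lemma ae_le_strip (f : R -> R -> R) (N : R) : cont2 f ->
  {ae (mu \x mu)%E, forall p : R * R, 0 < p.1 -> 0 <= p.2 <= 2 * pi -> f p.1 p.2 <= N} ->
  forall r t, 0 < r -> 0 <= t <= 2 * pi -> f r t <= N.
Proof.
move=> cf H r t r0 tc; have pi20 : (0 : R) < 2 * pi by rewrite mulr_gt0// pi_gt0.
have /andP[t0 t1] := tc.
rewrite leNgt; apply/negP => fN.
have e0 : 0 < f r t - N by rewrite subr_gt0.
move/cvgrPdist_lt: (cf r t r0) => /(_ _ e0)[[A B] /= [A0 B0] HAB].
have [e1 /= e10 He1] := A0; have [e2 /= e20 He2] := B0.
have bad s u : `|r - s| < e1 -> `|t - u| < e2 -> N < f s u.
  move=> /He1 As /He2 Bu; have := HAB (s, u); rewrite /= => /(_ (conj As Bu)).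
  by rewrite ltr_norml => /andP[_]; lra.
have ltr_ : r < r + e1 by rewrite ltrDl.
have [c [d [cd cdP]]] : exists c d, c < d /\ forall u, c < u < d ->
    0 <= u <= 2 * pi /\ `|t - u| < e2.
  have [tb|bt] := ltP t (2 * pi).
    exists t, (Num.min (2 * pi) (t + e2)); split; first by rewrite lt_min tb ltrDl.
    move=> u /andP[tu]; rewrite lt_min => /andP[u1 u2]; split.
      by rewrite (le_trans t0 (ltW tu)) ltW.
    by rewrite distrC gtr0_norm ?subr_gt0// ltrBlDl.
  have tE : t = 2 * pi by apply/eqP; rewrite eq_le t1.
  exists (Num.max 0 (t - e2)), t; split; first by rewrite gt_max tE pi20 gtrBl.
  move=> u /andP[]; rewrite gt_max => /andP[u1 u2] ut; split.
    by rewrite (ltW u1) -tE ltW.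
  by rewrite gtr0_norm ?subr_gt0// ltrBlDl -ltrBlDr.
have [s [u [/andP[s1 s2] ucd Ps]]] := ae_box ltr_ cd H.
have [u1 u2] := cdP u ucd.
have /bad := u2 => /(_ s); rewrite distrC gtr0_norm ?subr_gt0// ltrBlDl s2 => /(_ isT).
by rewrite ltNge Ps//; exact: lt_trans s1.
Qed.

End EssSup.

(** * The curve [gamma] in coordinates *)

Section Gamma.
Variable R : realType.
Notation mu := (@lebesgue_measure R).
Implicit Types (h f : R -> R) (t : R).

Lemma is_derive_derive1 f t : derivable f t 1 -> is_derive t 1 f (derive1 f t).
Proof. by move=> df; split => //; rewrite derive1E. Qed.

Lemma derive1_is_derive f t d : is_derive t 1 f d -> derive1 f t = d.
Proof. by move=> [_ <-]; rewrite derive1E. Qed.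

Lemma smooth_derive f : smooth f ->
  [/\ forall t, is_derive t 1 f (derive1 f t),
      forall t, is_derive t 1 (derive1 f) (derive1 (derive1 f) t) &
      continuous (derive1 (derive1 f))].
Proof.
move=> sf; split=> t.
- by apply: is_derive_derive1; exact: (sf 0 t).
- by apply: is_derive_derive1; exact: (sf 1 t).
- by apply: der_continuous; apply: is_derive_derive1; exact: (sf 2 t).
Qed.

Lemma periodic_derive1 f : (forall t, derivable f t 1) -> periodic2pi f ->
  periodic2pi (derive1 f).
Proof.
move=> df pf t; apply/esym/derive1_is_derive.
rewrite (_ : f = (fun s => f (s + 2 * pi))); last by apply/funext => s; rewrite pf.
have d1 : is_derive t 1 (fun s : R => s + 2 * pi) 1 by der; rewrite addr0.
have d2 := @der_comp _ f (fun s => s + 2 * pi) t _ _ (is_derive_derive1 (df (t + 2 * pi))) d1.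
by apply: der_eq d2 _; rewrite mulr1 (_ : (fun s => f (s + 2 * pi)) = f)//; apply/funext => s; rewrite pf.
Qed.

Lemma periodic_2piz (T : Type) (f : R -> T) t (k : int) : periodic2pi f ->
  f (t + 2 * pi * k%:~R) = f t.
Proof.
move=> pf; have pn (n : nat) s : f (s + 2 * pi * n%:R) = f s.
  elim: n => [|n IH]; first by rewrite mulr0 addr0.
  by rewrite -[n.+1%:R]natr1 (mulrDr (2 * pi)) mulr1 addrA pf.
case: k => k; first exact: pn.
by rewrite NegzE mulrNz mulrN -(pn k.+1) subrK.
Qed.

Lemma circle_representative t : exists s (k : int),
  0 <= s < 2 * pi /\ t = s + 2 * pi * k%:~R.
Proof.
have pi20 : (0 : R) < 2 * pi by rewrite mulr_gt0// pi_gt0.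
have /andP[f1 f2] := real_floor_itv (num_real (t / (2 * pi))).
set k := Num.floor _ in f1 f2.
exists (t - 2 * pi * k%:~R), k; split; last by rewrite subrK.
have e : (k + 1)%:~R * (2 * pi) = 2 * pi * k%:~R + 2 * pi :> R.
  by rewrite intrD (mulrDl _ _ (2 * pi)) mul1r mulrC.
rewrite subr_ge0 ltrBlDl -e mulrC -ler_pdivlMr// f1/=.
by rewrite -ltr_pdivrMr.
Qed.

Lemma periodic_forall (P : R -> Prop) : (forall t, P (t + 2 * pi) = P t) ->
  (forall t, 0 <= t <= 2 * pi -> P t) -> forall t, P t.
Proof.
move=> pP HP t; have [s [k [/andP[s0 s1] ->]]] := circle_representative t.
by rewrite (periodic_2piz s k pP); apply: HP; rewrite s0 ltW.
Qed.

Variable h : R -> R.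
Hypothesis sh : smooth h.
Hypothesis ph : periodic2pi h.

Let h1 := derive1 h.
Let h2 := derive1 h1.

Lemma Re_gamma t : complex.Re (gamma h t) = - (cos t * h t).
Proof. by rewrite /gamma /expi cosN sinN /=; ring. Qed.

Lemma Im_gamma t : complex.Im (gamma h t) = sin t * h t.
Proof. by rewrite /gamma /expi cosN sinN /=; ring. Qed.

Lemma Re_dgamma t : complex.Re (dgamma h t) = sin t * h t - cos t * h1 t.
Proof.
have [dh _ _] := smooth_derive sh; have d := dh t.
rewrite /dgamma /cderive /=; apply: derive1_is_derive.
rewrite (_ : (fun x => complex.Re (gamma h x)) = (fun x => - (cos x * h x))); last first.
  by apply/funext => x; exact: Re_gamma.
by der; rewrite /h1; ring.
Qed.

Lemma Im_dgamma t : complex.Im (dgamma h t) = cos t * h t + sin t * h1 t.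
Proof.
have [dh _ _] := smooth_derive sh; have d := dh t.
rewrite /dgamma /cderive /=; apply: derive1_is_derive.
rewrite (_ : (fun x => complex.Im (gamma h x)) = (fun x => sin x * h x)); last first.
  by apply/funext => x; exact: Im_gamma.
by der; rewrite /h1; ring.
Qed.

Lemma der_Re_dgamma t : is_derive t 1 (fun x => complex.Re (dgamma h x))
  (cos t * (h t - h2 t) + 2 * sin t * h1 t).
Proof.
have [dh dh1 _] := smooth_derive sh; have d := dh t; have d' := dh1 t.
rewrite (_ : (fun x => complex.Re (dgamma h x)) = (fun x => sin x * h x - cos x * h1 x)).
  by der; rewrite /h2 /h1; ring.
by apply/funext => x; exact: Re_dgamma.
Qed.

Lemma der_Im_dgamma t : is_derive t 1 (fun x => complex.Im (dgamma h x))
  (- (sin t * (h t - h2 t)) + 2 * cos t * h1 t).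
Proof.
have [dh dh1 _] := smooth_derive sh; have d := dh t; have d' := dh1 t.
rewrite (_ : (fun x => complex.Im (dgamma h x)) = (fun x => cos x * h x + sin x * h1 x)).
  by der; rewrite /h2 /h1; ring.
by apply/funext => x; exact: Im_dgamma.
Qed.

Lemma ddgammaE t : ddgamma h t = ((cos t * (h t - h2 t) + 2 * sin t * h1 t)
  +i* (- (sin t * (h t - h2 t)) + 2 * cos t * h1 t))%C.
Proof.
rewrite /ddgamma /cderive (derive1_is_derive (der_Re_dgamma t)).
by rewrite (derive1_is_derive (der_Im_dgamma t)).
Qed.

Lemma cmodE (z : R[i]) : cmod z = Num.sqrt (complex.Re z ^+ 2 + complex.Im z ^+ 2).
Proof. by case: z. Qed.

Lemma cmod_dgamma t : cmod (dgamma h t) = speed h h1 t.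
Proof.
rewrite cmodE Re_dgamma Im_dgamma /speed; congr Num.sqrt.
rewrite (_ : h t ^+ 2 + h1 t ^+ 2 = (cos t ^+ 2 + sin t ^+ 2) * (h t ^+ 2 + h1 t ^+ 2)).
  by ring.
by rewrite cos2Dsin2 mul1r.
Qed.

Lemma cmod_ddgamma t : cmod (ddgamma h t) = accel h h1 h2 t.
Proof.
rewrite cmodE ddgammaE /= /accel; congr Num.sqrt.
rewrite (_ : (h t - h2 t) ^+ 2 + (2 * h1 t) ^+ 2 =
  (cos t ^+ 2 + sin t ^+ 2) * ((h t - h2 t) ^+ 2 + (2 * h1 t) ^+ 2)).
  by ring.
by rewrite cos2Dsin2 mul1r.
Qed.

Lemma dWE t : dW h t = (complex.Re (dgamma h t) * (- (sin t * (h t - h2 t)) + 2 * cos t * h1 t)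
  - complex.Im (dgamma h t) * (cos t * (h t - h2 t) + 2 * sin t * h1 t)) / speed h h1 t ^+ 2.
Proof.
rewrite /dW cmod_dgamma ddgammaE; case: (dgamma h t) => a b /=.
by rewrite mulNr.
Qed.

Lemma cosineE alpha t : 0 < speed h h1 t ->
  speed h h1 t * cosine alpha h h1 t =
  cos alpha * complex.Re (dgamma h t) + sin alpha * complex.Im (dgamma h t).
Proof.
move=> p0; rewrite /cosine mulrCA mulfV ?gt_eqF// mulr1 Re_dgamma Im_dgamma.
by rewrite sinD cosD; ring.
Qed.

End Gamma.

(** * The norms of the data *)

Section Norms.
Variable R : realType.
Notation mu := (@lebesgue_measure R).

Lemma cmod_ge0 (z : R[i]) : 0 <= cmod z.
Proof. by rewrite cmodE sqrtr_ge0. Qed.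

Lemma cLnorm1E (f : R -> R[i]) (c : R -> R) : continuous c ->
  (forall t, cmod (f t) = c t) ->
  cLnorm_circle 1%E f = (\int[mu]_(t in `[0, 2 * pi]) c t)%:E.
Proof.
move=> cc fc; rewrite /cLnorm_circle /Lnorm_on Lnorm1.
have ci := continuous_segment_integrable 0 (2 * pi) cc.
rewrite /Rintegral fineK; last exact: integrable_fin_num.
rewrite [RHS]integral_mkcond -circleE; apply: eq_integral => t _.
rewrite /patch; case: ifPn => _; last by rewrite abse0.
by rewrite fc gee0_abs// lee_fin -fc cmod_ge0.
Qed.

Lemma cLnorm_oo_le (f : R -> R[i]) (c : R -> R) (N : R) : continuous c ->
  (forall t, cmod (f t) = c t) -> (cLnorm_circle +oo%E f <= N%:E)%E ->
  forall t, 0 <= t <= 2 * pi -> c t <= N.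
Proof.
move=> cc fc /Lnorm_oo_ae H; have pi20 : (0 : R) < 2 * pi by rewrite mulr_gt0// pi_gt0.
apply: (ae_le_segment pi20 cc (@cst_continuous _ _ N)).
apply: filterS H => t + tc; rewrite /patch (_ : t \in @circle R = true); last exact/mem_set.
by rewrite fc /= lee_fin; apply: le_trans; exact: ler_norm.
Qed.

Lemma Loo_polar_le (f : R -> R -> R) (N : R) : cont2 f ->
  (Loo_polar f <= N%:E)%E ->
  forall r t, 0 < r -> 0 <= t <= 2 * pi -> f r t <= N.
Proof.
move=> cf /Lnorm_oo_ae H; apply: ae_le_strip => //.
apply: filterS H => -[r t] + /= r0 tc.
rewrite /patch (_ : (r, t) \in @half_line R `*` @circle R = true); last exact/mem_set.
by rewrite /= lee_fin; apply: le_trans; exact: ler_norm.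
Qed.

(** Multiplying out avoids the quotient by [dW]: where it vanishes, a finite
    [kappa_oo] forces [m] to vanish. *)
Lemma kappa_oo_le (beta K : R) (h : R -> R) (m : R -> R[i]) (p g mm om : R -> R) :
  continuous g -> continuous mm -> continuous (fun t => p t `^ beta) -> continuous om ->
  (forall t, cmod (dgamma h t) = p t) -> (forall t, gamma_ratio h t = g t) ->
  (forall t, cmod (m t) = mm t) -> (forall t, `|dW h t| = om t) ->
  (forall t, 0 < p t) -> (forall t, 0 < g t) ->
  (kappa_oo beta h m <= K%:E)%E ->
  forall t, 0 <= t <= 2 * pi -> g t * mm t <= K * (p t `^ beta * om t).
Proof.
move=> cg cmm cp com pE gE mE oE p0 g0 /Lnorm_oo_ae H.
have pi20 : (0 : R) < 2 * pi by rewrite mulr_gt0// pi_gt0.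
have c1 : continuous (fun t => g t * mm t).
  by move=> t; apply: (cont2_slice_snd (cont2M (cont2_snd cg) (cont2_snd cmm)) ltr01).
have c2 : continuous (fun t => K * (p t `^ beta * om t)).
  by move=> t; apply: (cont2_slice_snd (cont2M (@cont2_cst _ K)
    (cont2M (cont2_snd cp) (cont2_snd com))) ltr01).
apply: (ae_le_segment pi20 c1 c2).
apply: filterS H => t + tc; rewrite /patch (_ : t \in @circle R = true); last exact/mem_set.
rewrite pE gE mE.
have pb : 0 < p t `^ beta by exact: powR_gt0.
have mm0 : 0 <= mm t by rewrite -mE cmod_ge0.
have om0 : 0 <= om t by rewrite -oE.
have q0 : 0 < (p t `^ beta)^-1 * g t by rewrite mulr_gt0// invr_gt0.
rewrite oE inver; have [om_0|omN] := eqVneq (om t) 0.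
  have [->|mN] := eqVneq (mm t) 0; first by rewrite om_0 !mulr0.
  have mm_gt0 : 0 < mm t by rewrite lt_def mN.
  by rewrite gt0_muley ?lte_fin// gt0_muley ?lte_fin.
rewrite -!EFinM lee_fin => /(le_trans (ler_norm _)).
have om_gt0 : 0 < om t by rewrite lt_def omN.
rewrite mulrA ler_pdivrMr// -mulrA ler_pdivrMl//.
by rewrite mulrCA.
Qed.

End Norms.

(** * The total rotation of the curve *)

Section Winding.
Variable R : realType.
Notation mu := (@lebesgue_measure R).
Variables (rho alpha : R) (h : R -> R) (n : nat).
Hypothesis rho0 : 0 < rho.
Hypothesis sh : smooth h.
Hypothesis ph : periodic2pi h.
Let h1 := derive1 h.
Let h2 := derive1 h1.
Hypothesis p0 : forall t, 0 < speed h h1 t.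
Hypothesis winding : exists2 w : int, is_winding_number (dgamma h) w & absz w = n.
Hypothesis n_to_1 : arg_n_to_1 (dgamma h) n.

Lemma dW_continuous : continuous (dW h).
Proof.
have [dh dh1 ch2] := smooth_derive sh.
have c2h : cont2 (fun _ t => h t) by apply: cont2_snd => t; exact: der_continuous (dh t).
have c2h1 : cont2 (fun _ t => h1 t) by apply: cont2_snd => t; exact: der_continuous (dh1 t).
have c2h2 : cont2 (fun _ t => h2 t) by exact: cont2_snd.
have c2t : cont2 (fun _ t : R => t) by apply: cont2_snd => t; exact: cvg_id.
have c2p : cont2 (fun _ t => (speed h h1 t ^+ 2)^-1).
  apply: cont2V; last by move=> r t _; rewrite expf_neq0// gt_eqF.
  apply: cont2X; apply: (@cont2_comp _ (@Num.sqrt R)); first exact: sqrt_continuous.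
  by repeat cont2_step.
have c : cont2 (fun _ t => dW h t).
  rewrite (_ : (fun _ t => dW h t) = (fun _ t : R => ((sin t * h t - cos t * h1 t) * (- (sin t * (h t - h2 t)) + 2 * cos t * h1 t)
  - (cos t * h t + sin t * h1 t) * (cos t * (h t - h2 t) + 2 * sin t * h1 t)) * (speed h h1 t ^+ 2)^-1)).
    by repeat cont2_step.
  by apply/funext => _; apply/funext => t; rewrite (dWE sh) Re_dgamma// Im_dgamma.
exact: (cont2_slice_snd c ltr01).
Qed.

Lemma expi_shift (y : R) (k : int) : expi (y + 2 * pi * k%:~R) = expi y.
Proof. by rewrite /expi cos_2piz sin_2piz. Qed.

(** The argument [phi] is monotone, so [|dW|] is its derivative up to the sign
    [sg] of the winding number. *)
Lemma angle_bound :
  \int[mu]_(t in `[0, 2 * pi]) (`|dW h t| * (Num.max (cosine alpha h h1 t) 0 /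
     angle_width rho (rho / (rho + 2)) (cosine alpha h h1 t))) <=
  n.+1%:R * (6 * ln (rho + 2) / rho).
Proof.
have pi20 : (0 : R) < 2 * pi by rewrite mulr_gt0// pi_gt0.
have [w [phi [cphi argphi phiw]] wn] := winding.
pose sg : R := if 0 <= w then 1 else -1.
have sg2 : sg * sg = 1 by rewrite /sg; case: ifP => _; rewrite ?mulrNN mulr1.
have sgw : sg * w%:~R = n%:R.
  rewrite /sg -wn natr_absz; case: ifP => w0; first by rewrite mul1r ger0_norm.
  by rewrite ltr0_norm ?ltNge ?w0// mulN1r mulrNz.
have parts t : complex.Re (dgamma h t) = speed h h1 t * cos (phi t) /\
    complex.Im (dgamma h t) = speed h h1 t * sin (phi t).
  have := argphi t; rewrite /is_arg cmod_dgamma// /expi => -> /=.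
  by rewrite !mul0r subr0 addr0.
have dphi (t : R) : is_derive t 1 phi (dW h t).
  have g1E s := (parts s).1; have g2E s := (parts s).2.
  have := lift_is_derive p0 g1E g2E (@cphi t) (der_Re_dgamma sh t) (der_Im_dgamma sh t).
  by rewrite -(dWE sh).
pose psi t := sg * phi t.
have phiE t : phi t = sg * psi t by rewrite /psi mulrA sg2 mul1r.
have dpsi (t : R) : is_derive t 1 psi (sg * dW h t).
  by apply: der_eq (derM (der_cst sg t) (dphi t)) _; rewrite mul0r add0r.
have psin : psi (2 * pi) = psi 0 + 2 * pi * n%:R.
  by rewrite -sgw mulrCA -phiw /psi -mulrDr addrC subrK.
have cpsi : continuous psi by move=> t; exact: der_continuous (dpsi t).
pose A y : set R := [set t : R | 0 <= t < 2 * pi /\ is_arg (dgamma h t) (sg * y)].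
have mono : forall t1 t2, 0 <= t1 -> t1 <= t2 -> t2 <= 2 * pi -> psi t1 <= psi t2.
  apply: (n_to_1_monotone cpsi psin (A := A)) => [y|y t k t0 tp psit]; first exact: n_to_1.
  split; first by rewrite t0.
  rewrite /is_arg (argphi t); congr (_ * _).
    by rewrite -(argphi t).
  rewrite phiE psit (mulrDr sg) mulrCA.
  have -> : sg * k%:~R = (if 0 <= w then k else - k)%:~R.
    by rewrite /sg; case: ifP => _; rewrite ?mul1r// mulN1r mulrNz.
  exact: expi_shift.
have dpsi_ge0 t : 0 <= t <= 2 * pi -> 0 <= sg * dW h t.
  by move=> tc; apply: (derive_ge0_segment pi20 tc mono (dpsi t)).
have omE t : 0 <= t <= 2 * pi -> `|dW h t| = sg * dW h t.
  move=> tc; have sg1 : `|sg| = 1 by rewrite /sg; case: ifP => _; rewrite ?normrN normr1.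
  by rewrite -(ger0_norm (dpsi_ge0 t tc)) (normrM sg) sg1 mul1r.
have cosE t : cosine alpha h h1 t = cos (psi t - sg * alpha).
  rewrite /psi -mulrBr; have -> : cos (sg * (phi t - alpha)) = cos (phi t - alpha).
    by rewrite /sg; case: ifP => _; rewrite ?mul1r// mulN1r cosN.
  apply: (mulfI (lt0r_neq0 (p0 t))); rewrite cosineE//.
  by have [-> ->] := parts t; rewrite cosB; ring.
have cdpsi : continuous (fun t => sg * dW h t).
  have c : cont2 (fun _ t => sg * dW h t).
    by apply: cont2M; [exact: cont2_cst|apply: cont2_snd; exact: dW_continuous].
  exact: (cont2_slice_snd c ltr01).
have mono0 t : 0 <= t <= 2 * pi -> psi 0 <= psi t.
  by move=> /andP[t0 tp]; exact: mono.
have := angle_integral (sg * alpha) rho0 dpsi cdpsi mono0 psin.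
rewrite (_ : \int[mu]_(t in `[0, 2 * pi]) (sg * dW h t * _) =
  \int[mu]_(t in `[0, 2 * pi]) (`|dW h t| * (Num.max (cosine alpha h h1 t) 0 /
     angle_width rho (rho / (rho + 2)) (cosine alpha h h1 t))))//.
by apply: eq_Rintegral => t /set_mem/=; rewrite in_itv/= => tc; rewrite omE// cosE.
Qed.

End Winding.

(** * The bound with finite constants *)

Lemma half_lt_double (R : realType) (beta : R) : 1 / 2 < beta -> 1 < 2 * beta.
Proof. by move=> hb; lra. Qed.

Lemma Rintegral_le0_continuous (R : realType) (f : R -> R) :
  continuous f -> (forall t, 0 <= f t) ->
  \int[@lebesgue_measure R]_(t in `[0, 2 * pi]) f t <= 0 ->
  forall t, 0 <= t <= 2 * pi -> f t <= 0.
Proof.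
move=> cf f0 If; have pi20 : (0 : R) < 2 * pi by rewrite mulr_gt0// pi_gt0.
have fi := continuous_segment_integrable 0 (2 * pi) cf.
have E : (\int[@lebesgue_measure R]_(t in `[0%R, (2 * pi)%R]) `|(EFin \o f) t| = 0)%E.
  under eq_integral do rewrite /= ger0_norm//.
  rewrite -[LHS]fineK; last exact: integrable_fin_num.
  by congr EFin; apply/eqP; rewrite eq_le If; exact: Rintegral_ge0.
apply: (ae_le_segment pi20 cf (@cst_continuous _ _ 0)).
have mf : measurable_fun `[0, 2 * pi] (EFin \o f) by exact: measurable_int fi.
have mI : measurable (`[0, 2 * pi]%classic : set (measurableTypeR R)) by exact: measurable_itv.
have H := (ae_eq_integral_abs (@lebesgue_measure R) mI mf).1 E.
apply: (filterS _ H) => t.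
move=> Ht tc; suff : (f t)%:E = 0%E by move=> [->].
by apply: Ht; rewrite /= in_itv.
Qed.

Section Finite.
Variable R : realType.
Notation mu := (@lebesgue_measure R).
Variables (beta delta0 rho alpha : R) (n : nat) (h : R -> R) (m : R -> R[i])
  (v : R -> R -> R[i]).
Hypotheses (hbeta : 1 / 2 < beta) (hdelta0 : 0 < delta0) (rho0 : 0 < rho).
Hypotheses (sh : smooth h) (ph : periodic2pi h).
Hypotheses (sm : csmooth m) (pm : periodic2pi m).
Hypothesis delta_dgamma : forall t, delta0 <= cmod (dgamma h t).
Hypothesis winding : exists2 w : int, is_winding_number (dgamma h) w & absz w = n.
Hypothesis n_to_1 : arg_n_to_1 (dgamma h) n.
Hypothesis c1v : C1_polar v.

Let h1 := derive1 h.
Let h2 := derive1 h1.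
Let p := speed h h1.
Let q := accel h h1 h2.
Let g t := 1 + q t / p t.
Let mr t := complex.Re (m t).
Let mi t := complex.Im (m t).
Let mr' := derive1 mr.
Let mi' := derive1 mi.
Let mm t := cmod (m t).
Let m1 t := cmod (cderive m t).

Definition kappa_1_num (t : R) : R := cmod ((gamma_ratio h t)%:C%C * m t + cderive m t).

Let ff := kappa_1_num.
Let om t := `|dW h t|.

Lemma delta_speed t : delta0 <= speed h (derive1 h) t.
Proof. by rewrite -cmod_dgamma. Qed.

Let p0 t : 0 < p t. Proof. exact: lt_le_trans (delta_speed t). Qed.

Let gE t : gamma_ratio h t = g t.
Proof. by rewrite /gamma_ratio cmod_dgamma// cmod_ddgamma. Qed.

Let q0 t : 0 <= q t. Proof. exact: sqrtr_ge0. Qed.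

Let g1 t : 1 <= g t.
Proof. by rewrite lerDl divr_ge0// ltW. Qed.

Let mmE t : mm t = Num.sqrt (mr t ^+ 2 + mi t ^+ 2).
Proof. exact: cmodE. Qed.

Let ffE t : ff t = Num.sqrt ((g t * mr t + mr' t) ^+ 2 + (g t * mi t + mi' t) ^+ 2).
Proof.
rewrite /ff /kappa_1_num cmodE gE /cderive /mr /mi; case: (m t) => a b /=.
by rewrite !mul0r subr0 addr0.
Qed.

Let dmr (t : R) : is_derive t 1 mr (mr' t).
Proof. by have [d _ _] := smooth_derive sm.1; exact: d. Qed.
Let dmi (t : R) : is_derive t 1 mi (mi' t).
Proof. by have [d _ _] := smooth_derive sm.2; exact: d. Qed.
Let cmr' : continuous mr'.
Proof. by have [_ d _] := smooth_derive sm.1; move=> t; exact: der_continuous (d t). Qed.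
Let cmi' : continuous mi'.
Proof. by have [_ d _] := smooth_derive sm.2; move=> t; exact: der_continuous (d t). Qed.

Let dh (t : R) : is_derive t 1 h (h1 t).
Proof. by have [d _ _] := smooth_derive sh; exact: d. Qed.
Let dh1 (t : R) : is_derive t 1 h1 (h2 t).
Proof. by have [_ d _] := smooth_derive sh; exact: d. Qed.
Let ch2 : continuous h2.
Proof. by have [_ _ d] := smooth_derive sh. Qed.
Let perh1 : periodic2pi h1.
Proof. by apply: (periodic_derive1 _ ph) => t; have [] := dh t. Qed.
Let perh2 : periodic2pi h2.
Proof. by apply: (periodic_derive1 _ perh1) => t; have [] := dh1 t. Qed.
Let perp : periodic2pi p.
Proof. by move=> t; rewrite /p /speed ph perh1. Qed.
Let perq : periodic2pi q.
Proof. by move=> t; rewrite /q /accel ph perh1 perh2. Qed.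
Let permm : periodic2pi mm.
Proof. by move=> t; rewrite /mm pm. Qed.

Let c2h : cont2 (fun _ t => h t).
Proof. by apply: cont2_snd => t; exact: der_continuous (dh t). Qed.
Let c2h1 : cont2 (fun _ t => h1 t).
Proof. by apply: cont2_snd => t; exact: der_continuous (dh1 t). Qed.
Let c2h2 : cont2 (fun _ t => h2 t). Proof. exact: cont2_snd. Qed.
Let c2mr : cont2 (fun _ t => mr t).
Proof. by apply: cont2_snd => t; exact: der_continuous (dmr t). Qed.
Let c2mi : cont2 (fun _ t => mi t).
Proof. by apply: cont2_snd => t; exact: der_continuous (dmi t). Qed.
Let c2mr' : cont2 (fun _ t => mr' t). Proof. exact: cont2_snd. Qed.
Let c2mi' : cont2 (fun _ t => mi' t). Proof. exact: cont2_snd. Qed.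

Let csqrt (f : R -> R -> R) : cont2 f -> cont2 (fun r t => Num.sqrt (f r t)).
Proof. by move=> cf; apply: (@cont2_comp _ (@Num.sqrt R)) => //; exact: sqrt_continuous. Qed.

Let c2p : cont2 (fun _ t => p t).
Proof. by apply: csqrt; repeat cont2_step. Qed.
Let c2q : cont2 (fun _ t => q t).
Proof. by apply: csqrt; repeat cont2_step. Qed.
Let c2pV : cont2 (fun _ t => (p t)^-1).
Proof. by apply: cont2V => // _ t _; rewrite gt_eqF. Qed.
Let c2g : cont2 (fun _ t => g t).
Proof. by rewrite /g; repeat cont2_step. Qed.
Let c2mm : cont2 (fun _ t => mm t).
Proof.
rewrite (_ : (fun _ t => mm t) = (fun _ t : R => Num.sqrt (mr t ^+ 2 + mi t ^+ 2))).
  by apply: csqrt; repeat cont2_step.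
by apply/funext => _; apply/funext => t; exact: mmE.
Qed.
Let c2ff : cont2 (fun _ t => ff t).
Proof.
rewrite (_ : (fun _ t => ff t) = (fun _ t : R =>
   Num.sqrt ((g t * mr t + mr' t) ^+ 2 + (g t * mi t + mi' t) ^+ 2))).
  by apply: csqrt; repeat cont2_step.
by apply/funext => _; apply/funext => t; exact: ffE.
Qed.
Let c2om : cont2 (fun _ t => om t).
Proof.
have cW := cont2_snd (dW_continuous sh p0).
by apply: (@cont2_comp _ (fun x : R => `|x|)) => // x; exact: norm_continuous.
Qed.

Let slice (f : R -> R) : cont2 (fun _ t => f t) -> continuous f.
Proof. by move=> c; exact: (cont2_slice_snd c ltr01). Qed.

Let I1 : R := \int[mu]_(t in `[0, 2 * pi]) (ff t / p t).

Lemma kappa_1E : kappa_1 h m =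
  (\int[mu]_(t in `[0, 2 * pi]) (kappa_1_num t / speed h (derive1 h) t))%:E.
Proof.
apply: cLnorm1E.
  by apply: slice; exact: (cont2M c2ff c2pV).
move=> t; rewrite /cmod ComplexField.Normc.normcM -/(cmod _) -/(cmod _) cmod_dgamma//.
rewrite -/(kappa_1_num t) mulrC; congr (_ * _).
by rewrite cmodE /= expr0n addr0 sqrtr_sqr ger0_norm// invr_ge0 ltW// p0.
Qed.

Let m1_ff t : m1 t <= ff t + g t * mm t.
Proof.
rewrite /m1 /ff /kappa_1_num.
set c := cderive m t; set u := (gamma_ratio h t)%:C%C * m t.
have -> : g t * mm t = cmod (- u).
  rewrite /cmod (@normcN R u) ComplexField.Normc.normcM gE -/(cmod _) cmodE /=.
  by rewrite expr0n addr0 sqrtr_sqr (ger0_norm (le_trans ler01 (g1 t))).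
rewrite (_ : cmod c = cmod (u + c + - u)); last by congr cmod; rewrite addrAC subrr add0r.
exact: (@le_normcD R (u + c) (- u)).
Qed.

(** [weighted_L1] applies because the derivative of [|gamma'|] is at most
    [|gamma''|]. *)
Lemma weighted_circle (P : R) : (forall t, speed h (derive1 h) t <= P) ->
  \int[mu]_(t in `[0, 2 * pi]) (g t * mm t / p t) <= (1 + ln (P / delta0)) * I1.
Proof.
move=> pP.
pose p' t := (h t * h1 t + h1 t * h2 t) / p t.
have dp (t : R) : is_derive t 1 p (p' t).
  have d1 := dh t; have d2 := dh1 t; have pt := p0 t.
  have pp : 0 < h t ^+ 2 + h1 t ^+ 2 by rewrite -speedE exprn_gt0.
  rewrite /p /speed; der.
  by rewrite /p' -/(p t) !expr1; move: pt; rewrite /p /speed; move: (Num.sqrt _) => z z0;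
    field; rewrite gt_eqF.
have cp' : continuous p' by apply: slice; rewrite /p'; repeat cont2_step.
have p'q t : `|p' t| <= q t.
  rewrite /p' normrM normfV (gtr0_norm (p0 t)) ler_pdivrMr//.
  rewrite (_ : _ + _ = (h t - h2 t) * - h1 t + 2 * h1 t * h t); last by ring.
  apply: cauchy_schwarz2; [exact: q0|exact: ltW| |].
    by rewrite -[leRHS]/(accel h h1 h2 t ^+ 2) accelE.
  by rewrite sqrrN addrC -[leRHS]/(speed h h1 t ^+ 2) speedE.
have per0 (f : R -> R) : periodic2pi f -> f (2 * pi) = f 0.
  by move=> pf; have := pf 0; rewrite add0r.
have pmr : mr (2 * pi) = mr 0 by apply: per0 => t; rewrite /mr pm.
have pmi : mi (2 * pi) = mi 0 by apply: per0 => t; rewrite /mi pm.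
have := weighted_L1 hdelta0 delta_speed pP dmr dmi dp cmr' cmi' cp' (slice c2q) p'q
  pmr pmi (per0 _ perp).
rewrite /I1 (_ : \int[mu]_(t in `[0, 2 * pi]) (ff t / p t) =
  \int[mu]_(t in `[0, 2 * pi]) (Num.sqrt ((g t * mr t + mr' t) ^+ 2 +
     (g t * mi t + mi' t) ^+ 2) / p t)); last by apply: eq_Rintegral => t _; rewrite ffE.
by rewrite [leLHS](_ : _ = \int[mu]_(t in `[0, 2 * pi]) (g t * mm t / p t))//;
  apply: eq_Rintegral => t _; rewrite mmE.
Qed.

Lemma speed_bounded : exists P, forall t, speed h (derive1 h) t <= P.
Proof.
have [M _ HM] := cont2_bounded 1 0 (2 * pi) c2p ltr01.
exists M; apply: periodic_forall => [t|t tc]; first by rewrite -/h1 -/p (perp t).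
by apply: le_trans (ler_norm _) (HM 1 t _ tc); rewrite lexx.
Qed.

(** If [gamma_ratio h * m + m'] vanishes then [m] solves a damped linear equation
    on the circle, whose only periodic solution is zero. *)
Lemma kappa_1_eq0 : kappa_1 h m = 0%E -> forall t, m t = 0.
Proof.
rewrite kappa_1E -/h1 -/p -/ff -/I1 => -[I10].
have [P pP] := speed_bounded.
have := weighted_circle pP; rewrite I10 mulr0 => H.
have cf : continuous (fun t => g t * mm t / p t).
  by apply: slice; exact: (cont2M (cont2M c2g c2mm) c2pV).
have f0 t : 0 <= g t * mm t / p t.
  by rewrite divr_ge0 ?(ltW (p0 t))// mulr_ge0 ?cmod_ge0// (le_trans ler01).
apply: periodic_forall => [t|t tc]; first by rewrite (pm t).
have := Rintegral_le0_continuous cf f0 H tc.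
rewrite ler_pdivrMr ?p0// mul0r pmulr_rle0; last exact: lt_le_trans ltr01 (g1 t).
move=> mt; apply: ComplexField.Normc.eq0_normc; apply/eqP.
by rewrite eq_le mt; exact: cmod_ge0.
Qed.

Let perv (r : R) : 0 < r -> periodic2pi (v r).
Proof. by move=> r0 t; have [] := c1v t r0. Qed.

Let vr r t := complex.Re (v r t).
Let vi r t := complex.Im (v r t).
Let vr_r r t := complex.Re (v_r v r t).
Let vi_r r t := complex.Im (v_r v r t).
Let vr_t r t := complex.Re (v_t v r t).
Let vi_t r t := complex.Im (v_t v r t).

Let dvr_r (r t : R) : 0 < r -> is_derive r 1 (vr ^~ t) (vr_r r t).
Proof. by move=> r0; have [_ [[d _] _] _ _] := c1v t r0; exact: is_derive_derive1. Qed.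
Let dvi_r (r t : R) : 0 < r -> is_derive r 1 (vi ^~ t) (vi_r r t).
Proof. by move=> r0; have [_ [[_ d] _] _ _] := c1v t r0; exact: is_derive_derive1. Qed.
Let dvr_t (r t : R) : 0 < r -> is_derive t 1 (vr r) (vr_t r t).
Proof. by move=> r0; have [_ [_ [d _]] _ _] := c1v t r0; exact: is_derive_derive1. Qed.
Let dvi_t (r t : R) : 0 < r -> is_derive t 1 (vi r) (vi_t r t).
Proof. by move=> r0; have [_ [_ [_ d]] _ _] := c1v t r0; exact: is_derive_derive1. Qed.
Let cvr_r : cont2 (fun r t => vr_r r t).
Proof. by move=> r t r0; have [_ _ [c _] _] := c1v t r0. Qed.
Let cvi_r : cont2 (fun r t => vi_r r t).
Proof. by move=> r t r0; have [_ _ [_ c] _] := c1v t r0. Qed.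
Let cvr_t : cont2 (fun r t => vr_t r t).
Proof. by move=> r t r0; have [_ _ _ [c _]] := c1v t r0. Qed.
Let cvi_t : cont2 (fun r t => vi_t r t).
Proof. by move=> r t r0; have [_ _ _ [_ c]] := c1v t r0. Qed.
Let cvr : cont2 (fun r t => vr r t).
Proof. exact: cont2_partials dvr_r dvr_t cvr_r. Qed.
Let cvi : cont2 (fun r t => vi r t).
Proof. exact: cont2_partials dvi_r dvi_t cvi_r. Qed.

Let cmod_cont2 (f : R -> R -> R[i]) : cont2 (fun r t => complex.Re (f r t)) ->
  cont2 (fun r t => complex.Im (f r t)) -> cont2 (fun r t => cmod (f r t)).
Proof.
move=> cr ci; rewrite (_ : (fun r t => cmod (f r t)) = (fun r t =>
  Num.sqrt (complex.Re (f r t) ^+ 2 + complex.Im (f r t) ^+ 2))).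
  by apply: csqrt; apply: cont2D; exact: cont2X.
by apply/funext => r; apply/funext => t; exact: cmodE.
Qed.

Let japanese_cont2 (c : R) : cont2 (fun r _ : R => japanese r `^ c).
Proof.
apply: cont2_fst => r r0; apply: der_continuous.
have jr : 0 < 1 + r ^+ 2 by rewrite -[X in 0 < X]/(oneDsqr r) oneD_sqr_gt0.
have j0 := japanese_gt0 r; rewrite /japanese in j0 *.
by eapply (@der_powR R (fun x => Num.sqrt (1 + x ^+ 2))) => //; der; reflexivity.
Qed.

Lemma v_norm0_le (N : R) : (v_norm0 beta v <= N%:E)%E ->
  forall r t : R, 0 < r -> 0 <= t <= 2 * pi ->
  japanese r `^ (2 * beta + 1) * cmod (v r t) <= N.
Proof.
apply: Loo_polar_le; apply: cont2M; first exact: japanese_cont2.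
exact: cmod_cont2.
Qed.

Lemma v_norm1_le (N : R) : (v_norm1 beta v <= N%:E)%E ->
  forall r t : R, 0 < r -> 0 <= t <= 2 * pi ->
  japanese r `^ (2 * beta + 2) *
    Num.sqrt (cmod (v_r v r t) ^+ 2 + (r^-1 * cmod (v_t v r t)) ^+ 2) <= N.
Proof.
apply: Loo_polar_le; apply: cont2M; first exact: japanese_cont2.
have c1 : cont2 (fun r t => cmod (v_r v r t)) := cmod_cont2 cvr_r cvi_r.
have c2 : cont2 (fun r t => cmod (v_t v r t)) := cmod_cont2 cvr_t cvi_t.
have c3 : cont2 (fun r t => r^-1 * cmod (v_t v r t)).
  apply: (@cont2M _ (fun r _ => r^-1) (fun r t => cmod (v_t v r t))) => //.
  by apply: cont2_fst => r r0; apply: continuousV; [rewrite gt_eqF|exact: cvg_id].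
exact: (csqrt (cont2D (cont2X (n := 2) c1) (cont2X (n := 2) c3))).
Qed.

Variables (N0 N1 K P : R).
Hypothesis N0_ge0 : 0 <= N0.
Hypothesis N1_ge0 : 0 <= N1.
Hypothesis K_ge0 : 0 <= K.
Hypothesis kappa_S_P : (kappa_S h m <= P%:E)%E.
Hypothesis kappa_oo_K : (kappa_oo beta h m <= K%:E)%E.
Hypothesis v_norm0_N0 : (v_norm0 beta v <= N0%:E)%E.
Hypothesis v_norm1_N1 : (v_norm1 beta v <= N1%:E)%E.

Lemma speed_le_kappa_S t : speed h (derive1 h) t <= P.
Proof.
move: t; apply: periodic_forall => [t|]; first by rewrite -/h1 -/p (perp t).
apply: (@cLnorm_oo_le _ (dgamma h)); first exact: (slice c2p).
  by move=> t; exact: cmod_dgamma.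
by apply: le_trans kappa_S_P; rewrite leeDr// Lnorm_ge0.
Qed.

Let m_K t : 0 <= t <= 2 * pi -> g t * mm t <= K * (p t `^ beta * om t).
Proof.
apply: (@kappa_oo_le R beta K h m p g mm om).
- exact: (slice c2g).
- exact: (slice c2mm).
- move=> s; apply: (@continuous_comp _ _ _ p (fun x => x `^ beta)); first exact: (slice c2p).
  exact: der_continuous (@der_powR R (fun y => y) (p s) 1 beta (p0 s) (der_id (p s))).
- exact: (slice c2om).
- by move=> s; exact: cmod_dgamma.
- exact: gE.
- by [].
- by [].
- exact: p0.
- by move=> s; exact: lt_le_trans ltr01 (g1 s).
- exact: kappa_oo_K.
Qed.

Let NN := N0 + N1.

Let v_t_periodic (r : R) : 0 < r -> periodic2pi (v_t v r).
Proof.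
move=> r0 t; rewrite /v_t /cderive.
have pr : periodic2pi (vr r) by move=> s; rewrite /vr perv.
have pi_ : periodic2pi (vi r) by move=> s; rewrite /vi perv.
have dr s : derivable (vr r) s 1 by have [] := dvr_t s r0.
have di s : derivable (vi r) s 1 by have [] := dvi_t s r0.
by rewrite (periodic_derive1 dr pr) (periodic_derive1 di pi_).
Qed.

Let v_r_periodic (r : R) t : 0 < r -> v_r v r (t + 2 * pi) = v_r v r t.
Proof.
move=> r0; rewrite /v_r /cderive.
have e (u : R[i] -> R) : derive1 (fun x => u (v x (t + 2 * pi))) r = derive1 (fun x => u (v x t)) r.
  rewrite !derive1E; apply: near_eq_derive.
  by near=> x; rewrite perv//; near: x; exact: lt_nbhsr.
by rewrite !e.
Unshelve. all: by end_near. Qed.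

Let v_bound (r t : R) : 0 < r -> cmod (v r t) <= NN * jweight beta r.
Proof.
move=> r0; have j0 : 0 < japanese r `^ (2 * beta + 1) by rewrite powR_gt0// japanese_gt0.
have H : forall t, cmod (v r t) <= N0 * jweight beta r.
  apply: periodic_forall => [s|s sc]; first by rewrite perv.
  by rewrite /jweight ler_pdivlMr// mulrC (v_norm0_le v_norm0_N0).
apply: le_trans (H t) _; rewrite ler_wpM2r ?(ltW (jweight_gt0 _ _))//.
by rewrite /NN lerDl.
Qed.

Let jsplit (r : R) : (japanese r `^ (2 * beta + 2))^-1 = jweight beta r / japanese r.
Proof.
rewrite /jweight -invfM; congr (_^-1).
rewrite -{3}(powRr1 (ltW (japanese_gt0 r))) -powRD; last by rewrite (gt_eqF (japanese_gt0 r)) implybT.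
by congr (_ `^ _); ring.
Qed.

Let grad_bound (r t : R) : 0 < r ->
  Num.sqrt (cmod (v_r v r t) ^+ 2 + (r^-1 * cmod (v_t v r t)) ^+ 2) <=
    NN * jweight beta r / r.
Proof.
move=> r0; have j0 : 0 < japanese r `^ (2 * beta + 2) by rewrite powR_gt0// japanese_gt0.
have H : forall t, Num.sqrt (cmod (v_r v r t) ^+ 2 + (r^-1 * cmod (v_t v r t)) ^+ 2) <=
    N1 * (jweight beta r / japanese r).
  apply: periodic_forall => [s|s sc]; first by rewrite (v_r_periodic s r0) (v_t_periodic r0).
  by rewrite -jsplit ler_pdivlMr// mulrC (v_norm1_le v_norm1_N1).
apply: le_trans (H t) _; rewrite mulrA; have jw := ltW (jweight_gt0 beta r).
apply: ler_pM.
- exact: mulr_ge0.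
- by rewrite invr_ge0 ltW// japanese_gt0.
- by rewrite ler_wpM2r// /NN lerDr.
- by rewrite lef_pV2 ?posrE ?japanese_gt0// le_japanese.
Qed.

Let v_r_bound (r t : R) : 0 < r -> cmod (v_r v r t) <= NN * jweight beta r / r.
Proof.
move=> r0; apply: le_trans (grad_bound t r0).
rewrite -[leLHS]ger0_norm ?cmod_ge0// -sqrtr_sqr ler_wsqrtr// lerDl; exact: sqr_ge0.
Qed.

Let v_t_bound (r t : R) : 0 < r -> cmod (v_t v r t) <= NN * jweight beta r.
Proof.
move=> r0; have H : r^-1 * cmod (v_t v r t) <= NN * jweight beta r / r.
  apply: le_trans (grad_bound t r0).
  rewrite -[leLHS]ger0_norm ?mulr_ge0 ?invr_ge0 ?(ltW r0) ?cmod_ge0//.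
  by rewrite -sqrtr_sqr ler_wsqrtr// lerDr; exact: sqr_ge0.
by move: H; rewrite [leLHS]mulrC ler_pM2r ?invr_gt0.
Qed.

(* The parts of [z * w] as they appear in the parts of the amplitude [v * m]. *)
Let prod_bound (z w : R[i]) (B : R) : cmod z * cmod w <= B ->
  `|complex.Re z * complex.Re w - complex.Im z * complex.Im w| <= B /\
  `|complex.Re z * complex.Im w + complex.Im z * complex.Re w| <= B.
Proof.
have sqE (y : R[i]) : complex.Re y ^+ 2 + complex.Im y ^+ 2 = cmod y ^+ 2.
  by rewrite cmodE sqr_sqrtr// addr_ge0 ?sqr_ge0.
move=> zw; split; apply: (le_trans _ zw).
  rewrite (_ : _ - _ = complex.Re z * complex.Re w + complex.Im z * - complex.Im w); last by ring.
  by apply: cauchy_schwarz2; rewrite ?cmod_ge0// ?sqrrN sqE.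
by apply: cauchy_schwarz2; rewrite ?cmod_ge0// ?sqE// addrC sqE.
Qed.

Let A r t := vr r t * mr t - vi r t * mi t.
Let B r t := vr r t * mi t + vi r t * mr t.
Let Ar r t := vr_r r t * mr t - vi_r r t * mi t.
Let Br r t := vr_r r t * mi t + vi_r r t * mr t.
Let At r t := vr_t r t * mr t - vi_t r t * mi t + (vr r t * mr' t - vi r t * mi' t).
Let Bt r t := vr_t r t * mi t + vi_t r t * mr t + (vr r t * mi' t + vi r t * mr' t).

Let NN0 : 0 <= NN. Proof. exact: addr_ge0. Qed.

Let AB_bound (r t : R) : 0 < r -> `|A r t| + `|B r t| <= 2 * NN * jweight beta r * mm t.
Proof.
move=> r0; have : cmod (v r t) * cmod (m t) <= NN * jweight beta r * mm t.
  by apply: ler_pM; rewrite ?cmod_ge0// v_bound.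
move=> /prod_bound[b1 b2]; rewrite -2!mulrA mulr_natl mulr2n mulrA.
exact: lerD.
Qed.

Let ABr_bound (r t : R) : 0 < r ->
  `|Ar r t| + `|Br r t| <= 2 * NN * jweight beta r * mm t / r.
Proof.
move=> r0; have : cmod (v_r v r t) * cmod (m t) <= NN * jweight beta r / r * mm t.
  by apply: ler_pM; rewrite ?cmod_ge0// v_r_bound.
move=> /prod_bound[b1 b2].
rewrite (_ : 2 * NN * _ * _ / r = NN * jweight beta r / r * mm t + NN * jweight beta r / r * mm t).
  exact: lerD.
by move: r0; move: (jweight beta r) => z r0; field; rewrite gt_eqF.
Qed.

Let ABt_bound (r t : R) : 0 < r ->
  `|At r t| + `|Bt r t| <= 2 * NN * jweight beta r * (mm t + m1 t).
Proof.
move=> r0.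
have : cmod (v_t v r t) * cmod (m t) <= NN * jweight beta r * mm t.
  by apply: ler_pM; rewrite ?cmod_ge0// v_t_bound.
move=> /prod_bound[b1 b2].
have : cmod (v r t) * cmod (cderive m t) <= NN * jweight beta r * m1 t.
  by apply: ler_pM; rewrite ?cmod_ge0// v_bound.
move=> /prod_bound[b3 b4].
rewrite (_ : 2 * NN * _ * _ = (NN * jweight beta r * mm t + NN * jweight beta r * m1 t) +
  (NN * jweight beta r * mm t + NN * jweight beta r * m1 t)); last by ring.
apply: lerD; apply: le_trans (ler_normD _ _) _; exact: lerD.
Qed.

Let dA_r (r t : R) : 0 < r -> is_derive r 1 (A ^~ t) (Ar r t).
Proof.
move=> r0; have d1 := dvr_r t r0; have d2 := dvi_r t r0.
apply: der_eq (derD (derM d1 (der_cst (mr t) r)) (derN (derM d2 (der_cst (mi t) r)))) _.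
by rewrite /Ar; ring.
Qed.
Let dB_r (r t : R) : 0 < r -> is_derive r 1 (B ^~ t) (Br r t).
Proof.
move=> r0; have d1 := dvr_r t r0; have d2 := dvi_r t r0.
apply: der_eq (derD (derM d1 (der_cst (mi t) r)) (derM d2 (der_cst (mr t) r))) _.
by rewrite /Br; ring.
Qed.
Let dA_t (r t : R) : 0 < r -> is_derive t 1 (A r) (At r t).
Proof.
move=> r0; have d1 := dvr_t t r0; have d2 := dvi_t t r0.
apply: der_eq (derD (derM d1 (dmr t)) (derN (derM d2 (dmi t)))) _.
by rewrite /At; ring.
Qed.
Let dB_t (r t : R) : 0 < r -> is_derive t 1 (B r) (Bt r t).
Proof.
move=> r0; have d1 := dvr_t t r0; have d2 := dvi_t t r0.
apply: der_eq (derD (derM d1 (dmi t)) (derM d2 (dmr t))) _.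
by rewrite /Bt; ring.
Qed.
Let cAr : cont2 (fun r t => Ar r t). Proof. by rewrite /Ar; repeat cont2_step. Qed.
Let cBr : cont2 (fun r t => Br r t). Proof. by rewrite /Br; repeat cont2_step. Qed.
Let cAt : cont2 (fun r t => At r t). Proof. by rewrite /At; repeat cont2_step. Qed.
Let cBt : cont2 (fun r t => Bt r t). Proof. by rewrite /Bt; repeat cont2_step. Qed.
Let perA (r t : R) : 0 < r -> A r (t + 2 * pi) = A r t.
Proof. by move=> r0; rewrite /A /vr /vi /mr /mi perv// pm. Qed.
Let perB (r t : R) : 0 < r -> B r (t + 2 * pi) = B r t.
Proof. by move=> r0; rewrite /B /vr /vi /mr /mi perv// pm. Qed.

Let mm_bounded : exists M, forall t, mm t <= M.
Proof.
have [M _ HM] := cont2_bounded 1 0 (2 * pi) c2mm ltr01.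
exists M; apply: periodic_forall => [t|t tc]; first by rewrite permm.
by apply: le_trans (ler_norm _) (HM 1 t _ tc); rewrite lexx.
Qed.

Let m_K_all t : g t * mm t <= K * (p t `^ beta * om t).
Proof.
have perom : periodic2pi om.
  move=> s; rewrite /om; congr (`|_|).
  rewrite (dWE sh (s + 2 * pi)) (dWE sh s) !(Re_dgamma sh) !(Im_dgamma sh).
  rewrite -/h1 -/h2 -/p (perp s) (ph s) (perh1 s) (perh2 s) (mulr_natl (pi : R) 2).
  by rewrite cosD2pi sinD2pi.
move: t; apply: periodic_forall; last exact: m_K.
by move=> t; rewrite (permm t) (perom t) /g (perp t) (perq t).
Qed.

Let bound := osc_bound beta rho alpha (2 * NN) K h h1 h2 mm ff om.

Let Re_bound : `|complex.Re (Iint h m v rho alpha)| <= \int[mu]_(t in `[0, 2 * pi]) bound t.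
Proof.
have [M mM] := mm_bounded.
have ab_b (r t : R) : 0 < r -> `|A r t| + `|- B r t| <= 2 * NN * jweight beta r * mm t.
  by move=> r0; rewrite normrN; exact: AB_bound.
have abr_b (r t : R) : 0 < r -> `|Ar r t| + `|- Br r t| <= 2 * NN * jweight beta r * mm t / r.
  by move=> r0; rewrite normrN; exact: ABr_bound.
have abt_b (r t : R) : 0 < r -> `|At r t| + `|- Bt r t| <= 2 * NN * jweight beta r * (mm t + m1 t).
  by move=> r0; rewrite normrN; exact: ABt_bound.
have N2 : 0 <= 2 * NN by rewrite mulr_ge0.
have := @oscillatory_bound R beta rho alpha delta0 (2 * NN) K M h h1 h2 mm m1 ff om
  A Ar At (fun r t => - B r t) (fun r t => - Br r t) (fun r t => - Bt r t)
  hbeta rho0 hdelta0 N2 K_ge0 dh dh1 ch2 ph perh1 delta_speed (slice c2mm) (slice c2ff) (slice c2om)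
  (fun t => cmod_ge0 _) (fun t => cmod_ge0 _) (fun t => normr_ge0 _) mM m1_ff m_K_all
  dA_r dA_t (fun r t r0 => derN (dB_r t r0)) (fun r t r0 => derN (dB_t t r0))
  cAr cAt (cont2N cBr) (cont2N cBt) perA (fun r t r0 => congr1 -%R (perB t r0)) ab_b abr_b abt_b.
rewrite (_ : complex.Re (Iint h m v rho alpha) = \int[mu]_(t in @circle R)
   \int[mu]_(r in @half_line R) (cos (Psi h rho alpha r t) * A r t +
      sin (Psi h rho alpha r t) * - B r t)); first by [].
rewrite /Iint /cintegral /=; apply: eq_Rintegral => t _; apply: eq_Rintegral => r _.
rewrite /A /B /vr /vi /mr /mi; case: (v r t) => x y; case: (m t) => z w /=.
by ring.
Qed.

Let Im_bound : `|complex.Im (Iint h m v rho alpha)| <= \int[mu]_(t in `[0, 2 * pi]) bound t.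
Proof.
have [M mM] := mm_bounded.
have ab_b (r t : R) : 0 < r -> `|B r t| + `|A r t| <= 2 * NN * jweight beta r * mm t.
  by move=> r0; rewrite addrC; exact: AB_bound.
have abr_b (r t : R) : 0 < r -> `|Br r t| + `|Ar r t| <= 2 * NN * jweight beta r * mm t / r.
  by move=> r0; rewrite addrC; exact: ABr_bound.
have abt_b (r t : R) : 0 < r -> `|Bt r t| + `|At r t| <= 2 * NN * jweight beta r * (mm t + m1 t).
  by move=> r0; rewrite addrC; exact: ABt_bound.
have N2 : 0 <= 2 * NN by rewrite mulr_ge0.
have := @oscillatory_bound R beta rho alpha delta0 (2 * NN) K M h h1 h2 mm m1 ff om
  B Br Bt A Ar At
  hbeta rho0 hdelta0 N2 K_ge0 dh dh1 ch2 ph perh1 delta_speed (slice c2mm) (slice c2ff) (slice c2om)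
  (fun t => cmod_ge0 _) (fun t => cmod_ge0 _) (fun t => normr_ge0 _) mM m1_ff m_K_all
  dB_r dB_t dA_r dA_t cBr cBt cAr cAt perB perA ab_b abr_b abt_b.
rewrite (_ : complex.Im (Iint h m v rho alpha) = \int[mu]_(t in @circle R)
   \int[mu]_(r in @half_line R) (cos (Psi h rho alpha r t) * B r t +
      sin (Psi h rho alpha r t) * A r t)); first by [].
rewrite /Iint /cintegral /=; apply: eq_Rintegral => t _; apply: eq_Rintegral => r _.
rewrite /A /B /vr /vi /mr /mi; case: (v r t) => x y; case: (m t) => z w /=.
by ring.
Qed.

Let B0 := 96 / (2 * beta - 1).
Let L := ln (rho + 2).
Let c3 := 96 * (3 / 2) `^ beta * (K * (rho `^ beta * ((rho + 1) / rho))) * pi.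

Let width_gt0 t : 0 < angle_width rho (rho / (rho + 2)) (cosine alpha h h1 t).
Proof.
rewrite sqrtr_gt0; apply: angle_width_arg_gt0; first by rewrite divr_gt0// addr_gt0.
exact: (cosine_le1 alpha hdelta0 delta_speed).
Qed.

Let bound_integral : \int[mu]_(t in `[0, 2 * pi]) bound t <=
  2 * NN * (B0 * ((1 + ln (P / delta0)) * I1) + ((B0 + 54 * L) * I1
    + c3 * (n.+1%:R * (6 * L / rho)))).
Proof.
pose f1 t := g t * mm t / p t.
pose f2 t := ff t / p t.
pose f3 t := om t * (Num.max (cosine alpha h h1 t) 0 /
  angle_width rho (rho / (rho + 2)) (cosine alpha h h1 t)).
have c2t : cont2 (fun _ t : R => t) by apply: cont2_snd => t; exact: cvg_id.
have c2c : cont2 (fun _ t => cosine alpha h h1 t).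
  have c2sV : cont2 (fun _ t => (speed h h1 t)^-1) := c2pV.
  by rewrite /cosine; repeat cont2_step.
have c2m : cont2 (fun _ t => Num.max (cosine alpha h h1 t) 0).
  apply: cont2_snd => t; apply: continuous_max; first exact: (slice c2c).
  exact: cst_continuous.
have c2w : cont2 (fun _ t => (angle_width rho (rho / (rho + 2)) (cosine alpha h h1 t))^-1).
  apply: cont2V; first by apply: csqrt; repeat cont2_step.
  by move=> _ t _; rewrite gt_eqF.
have cf1 : cont2 (fun _ t => f1 t) by rewrite /f1; repeat cont2_step.
have cf2 : cont2 (fun _ t => f2 t) by rewrite /f2; repeat cont2_step.
have cf3 : cont2 (fun _ t => f3 t) by rewrite /f3; repeat cont2_step.
have bn : 2 * beta - 1 != 0 by rewrite gt_eqF// subr_gt0 (half_lt_double hbeta).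
have rhon : rho != 0 by rewrite gt_eqF.
have -> : \int[mu]_(t in `[0, 2 * pi]) bound t =
   \int[mu]_(t in `[0, 2 * pi]) (2 * NN * (B0 * f1 t + ((B0 + 54 * L) * f2 t + c3 * f3 t))).
  apply: eq_Rintegral => t _; rewrite /bound /osc_bound /f1 /f2 /f3 -/(p t) -/(q t) -/(g t) -/L.
  have := p0 t; have := width_gt0 t; rewrite /B0 /c3.
  move: (angle_width _ _ _) (p t) (pi : R) => z y pi_ z0 y0.
  by field; rewrite bn rhon !gt_eqF.
have cs c f : cont2 (fun _ t => f t) -> cont2 (fun _ t => c * f t).
  by move=> cf; apply: cont2M => //; exact: cont2_cst.
rewrite RintegralZl_continuous; last first.
  by apply: slice; apply: cont2D; [exact: cs|apply: cont2D; exact: cs].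
rewrite ler_wpM2l ?mulr_ge0//.
rewrite RintegralD_continuous; [|apply: slice; exact: cs|]; last first.
  by apply: slice; apply: cont2D; exact: cs.
rewrite RintegralD_continuous; [|apply: slice; exact: cs|apply: slice; exact: cs].
rewrite !RintegralZl_continuous; [|exact: slice|exact: slice|exact: slice].
have B00 : 0 <= B0 by rewrite /B0 divr_ge0// subr_ge0 ltW// (half_lt_double hbeta).
apply: lerD; first by rewrite ler_wpM2l// (weighted_circle speed_le_kappa_S).
rewrite lerD2l ler_wpM2l; first by [].
  rewrite /c3 mulr_ge0 ?(ltW (pi_gt0 R))// !mulr_ge0 ?powR_ge0 ?invr_ge0 ?(ltW rho0)//.
  by rewrite addr_ge0// ltW.
exact: (angle_bound alpha rho0 sh p0 winding n_to_1).
Qed.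

(** The real and imaginary parts are oscillatory integrals with amplitudes
    [(Re (v m), - Im (v m))] and [(Im (v m), Re (v m))], which accounts for the
    factor [4]; then [angle_bound] and [weighted_circle] integrate the angular
    majorant. *)
Lemma finite_bound : cmod (Iint h m v rho alpha) <=
  4 * NN * (B0 * ((1 + ln (P / delta0)) * I1) + ((B0 + 54 * L) * I1
    + c3 * (n.+1%:R * (6 * L / rho)))).
Proof.
apply: le_trans (_ : `|complex.Re (Iint h m v rho alpha)| + `|complex.Im (Iint h m v rho alpha)| <= _).
  rewrite cmodE; move: (complex.Re _) (complex.Im _) => x y.
  apply: le_of_sqr; first exact: addr_ge0.
  rewrite sqr_sqrtr ?addr_ge0 ?sqr_ge0// sqrrD !real_normK ?num_real//.
  by rewrite -addrA lerD2l lerDr mulrn_wge0// mulr_ge0.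
apply: le_trans (lerD Re_bound Im_bound) _.
apply: le_trans (lerD bound_integral bound_integral) _.
by rewrite le_eqVlt; apply/orP; left; apply/eqP; ring.
Qed.

End Finite.

(** * Constants and degenerate cases *)

Lemma Iint_eq0 (R : realType) (h : R -> R) (m : R -> R[i]) (v : R -> R -> R[i])
    (rho alpha : R) :
  (forall r t, 0 < r -> 0 <= t <= 2 * pi -> v r t * m t = 0) ->
  Iint h m v rho alpha = 0.
Proof.
move=> vm0.
have R0 (D : set R) (u : R -> R) : (forall x, D x -> u x = 0) ->
    Rintegral lebesgue_measure D u = 0.
  by move=> u0; rewrite /Rintegral integral0_eq// => x Dx; rewrite u0.
have I0 (D : set R) (f : R -> R[i]) : (forall x, D x -> f x = 0) -> cintegral D f = 0.
  by move=> f0; rewrite /cintegral !R0// => x /f0 ->.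
apply: (I0) => t tc; apply: I0 => r r0.
by rewrite -mulrA vm0// mulr0.
Qed.

Lemma collect_constants (R : realType) (B a C3 K1 T L Z D x : R) :
  0 <= B -> 0 <= a -> 0 <= C3 -> 0 <= K1 -> 0 <= T -> 0 <= L -> 0 <= Z ->
  x <= Z + D -> B * (2 + D) <= a * L ->
  B * ((1 + x) * K1) + (B + 54 * L) * K1 + C3 * T * L <=
  (a + 54 + B + C3) * ((T + K1) * L + K1 * Z).
Proof.
move=> B0 a0 c0 K0 T0 L0 Z0 xZ aL.
have h1 : B * (1 + x) + B <= a * L + B * Z.
  apply: le_trans (_ : B * (1 + (Z + D)) + B <= _).
    by rewrite lerD2r ler_wpM2l// lerD2l.
  by rewrite [leLHS](_ : _ = B * (2 + D) + B * Z); [rewrite lerD2r|ring].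
have h2 : (B * (1 + x) + B) * K1 <= (a * L + B * Z) * K1 by rewrite ler_wpM2r.
rewrite -subr_ge0 [leRHS](_ : _ = ((a * L + B * Z) * K1 - (B * (1 + x) + B) * K1)
  + (a * (T * L) + a * (K1 * Z) + 54 * (T * L) + 54 * (K1 * Z) + B * (T * L) + B * (K1 * L)
  + C3 * (K1 * L) + C3 * (K1 * Z))); last by ring.
by rewrite addr_ge0 ?subr_ge0// !addr_ge0 ?mulr_ge0.
Qed.

Section Constants.
Variable R : realType.
Variables (beta delta0 : R) (n : nat).
Hypotheses (hbeta : 1 / 2 < beta) (hdelta0 : 0 < delta0).

Let B0 : R := 96 / (2 * beta - 1).
Let C3 : R := 576 * (3 / 2) `^ beta * pi * n.+1%:R.

(** Only [rho]-independent factors are left here: [54 = 9 * 6] and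
    [576 = 96 * 6] come from the logarithmic primitives, and the division by
    [ln 2] lets [ln (rho + 2)] absorb the terms without logarithm. *)
Definition oscillation_constant : R :=
  4 * (B0 * (2 + `|ln delta0|) / ln 2 + 54 + B0 + C3).

Let B00 : 0 < B0.
Proof. by rewrite divr_gt0// subr_gt0 half_lt_double. Qed.

Let C30 : 0 <= C3.
Proof.
apply: mulr_ge0 (ler0n _ _); apply: mulr_ge0 (pi_ge0 R).
exact: mulr_ge0 (ler0n _ _) (powR_ge0 _ _).
Qed.

Let ln20 : 0 < ln (2 : R).
Proof. by rewrite ln_gt0// ltr1n. Qed.

Lemma oscillation_constant_gt0 : 0 < oscillation_constant.
Proof.
rewrite mulr_gt0// ltr_wpDr// ltr_wpDr ?(ltW B00)//.
by rewrite ltr_wpDl// mulr_ge0 ?invr_ge0 ?(ltW ln20)// mulr_ge0 ?(ltW B00)// addr_ge0.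
Qed.

Lemma finite_bound_le (rho NN K1 K P : R) : 0 < rho -> 0 <= NN -> 0 <= K1 -> 0 <= K ->
  delta0 <= P ->
  4 * NN * (B0 * ((1 + ln (P / delta0)) * K1) + ((B0 + 54 * ln (rho + 2)) * K1
    + 96 * (3 / 2) `^ beta * (K * (rho `^ beta * ((rho + 1) / rho))) * pi *
       (n.+1%:R * (6 * ln (rho + 2) / rho)))) <=
  oscillation_constant *
    ((rho `^ (beta - 1) * (1 + rho^-1) * K + K1) * ln (rho + 2)
      + K1 * Num.max 0 (ln (rho^-1 + 2) + ln P)) * NN.
Proof.
move=> rho0 NN0 K10 K0 dP; have P0 : 0 < P by exact: lt_le_trans dP.
set L := ln (rho + 2); set Z := Num.max _ _; set S := rho `^ (beta - 1) * _.
have S0 : 0 <= S by rewrite mulr_ge0 ?powR_ge0// addr_ge0 ?invr_ge0 ?ltW.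
have LL : ln 2 <= L by rewrite ler_ln ?posrE ?addr_gt0// lerDr ltW.
have ZP : ln P <= Z.
  rewrite le_max lerDr ln_ge0 ?orbT//.
  by rewrite (le_trans (ler1n _ 2 : 1 <= 2%:R :> R))// lerDr invr_ge0 ltW.
have Z0 : 0 <= Z by rewrite le_max lexx.
have SE : rho `^ beta * ((rho + 1) / rho) / rho = S.
  have -> : rho `^ beta = rho `^ (beta - 1) * rho.
    by rewrite -{3}(powRr1 (ltW rho0)) -powRD ?subrK// (gt_eqF rho0) implybT.
  by rewrite /S; move: (rho `^ _) => z; field; rewrite gt_eqF.
rewrite ln_div ?posrE//.
rewrite [leLHS](_ : _ = NN * (4 * (B0 * ((1 + (ln P - ln delta0)) * K1)
   + (B0 + 54 * L) * K1 + C3 * S * K * L))); last first.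
  rewrite -SE /C3; move: (rho `^ beta) (pi : R) ((3 / 2) `^ beta) => x y z; field.
  by rewrite gt_eqF.
rewrite [leRHS]mulrC ler_wpM2l// -[in leRHS]mulrA ler_pM2l//.
have dn := ler_norm (- ln delta0); rewrite normrN in dn.
set D := `|ln delta0| in dn *; have D0 : 0 <= D by exact: normr_ge0.
have aL : B0 * (2 + D) <= B0 * (2 + D) / ln 2 * L.
  rewrite -[leRHS]mulrA; apply: ler_peMr; first by rewrite mulr_ge0 ?(ltW B00)// addr_ge0.
  by rewrite ler_pdivlMl// mulr1.
set a := B0 * (2 + D) / ln 2 in aL *.
have a0 : 0 <= a by rewrite mulr_ge0 ?invr_ge0 ?(ltW ln20)// mulr_ge0 ?(ltW B00)// addr_ge0.
have L0 : 0 <= L := le_trans (ltW ln20) LL.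
rewrite [leLHS](_ : _ = B0 * ((1 + (ln P - ln delta0)) * K1) + (B0 + 54 * L) * K1
  + C3 * (S * K) * L); last by ring.
apply: (@collect_constants _ _ _ _ _ _ _ _ D) => //; [exact: ltW|exact: mulr_ge0|exact: lerD].
Qed.

End Constants.

Section Extended.
Variable R : realType.
Implicit Types k N : \bar R.

(** As soon as [K1] and [N] are positive, none of the infinities on the right
    can be multiplied by zero, so that any infinite quantity makes the bound
    trivial. *)
Lemma reduce_to_finite (I C S L l K1 : R) (koo kS N : \bar R) :
  0 < C -> 0 < S -> 0 < L -> 0 < K1 -> (0 <= koo)%E -> (0 < N)%E -> kS != -oo%E ->
  (forall K P Nr : R, koo = K%:E -> kS = P%:E -> N = Nr%:E ->
     I%:E <= C%:E * ((S%:E * koo + K1%:E) * L%:E + K1%:E * maxe 0 (l%:E + lne kS)) * N)%E ->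
  (I%:E <= C%:E * ((S%:E * koo + K1%:E) * L%:E + K1%:E * maxe 0 (l%:E + lne kS)) * N)%E.
Proof.
move=> C0 S0 L0 K10 koo0 N0 kS0 H.
have [E|] := eqVneq (C%:E * ((S%:E * koo + K1%:E) * L%:E + K1%:E * maxe 0 (l%:E + lne kS)) * N)%E +oo%E.
  by rewrite E leey.
set Z := maxe _ _ => E; have Z0 : (0 <= Z)%E by rewrite le_max lexx.
have Br0 : (0 < (S%:E * koo + K1%:E) * L%:E + K1%:E * Z)%E.
  apply: lt_le_trans (leeDl _ (mule_ge0 _ Z0)); last by rewrite lee_fin ltW.
  apply: mule_gt0; last by rewrite lte_fin.
  by apply: lt_le_trans (leeDr _ (mule_ge0 _ koo0)); rewrite ?lte_fin ?lee_fin// ltW.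
have CBr0 : (0 < C%:E * ((S%:E * koo + K1%:E) * L%:E + K1%:E * Z))%E by rewrite mule_gt0.
apply: (H (fine koo) (fine kS) (fine N)).
- move: E; case: koo koo0 {H Br0 CBr0} => [k| |]//= _.
  rewrite gt0_muley ?lte_fin// addye// gt0_mulye ?lte_fin// addye//.
    by rewrite gt0_muley ?lte_fin// gt0_mulye ?eqxx.
  by rewrite gt_eqF// (lt_le_trans ltNy0)// mule_ge0// lee_fin ltW.
- move: E kS0; rewrite /Z; case: kS {H Z Z0 Br0 CBr0} => [k| |]//= E _; exfalso; move: E.
  rewrite addey// maxey gt0_muley ?lte_fin// addey.
    by rewrite gt0_muley ?lte_fin// gt0_mulye ?eqxx.
  rewrite gt_eqF// (lt_le_trans ltNy0)//; apply: mule_ge0; last by rewrite lee_fin ltW.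
  by apply: adde_ge0; [apply: mule_ge0 => //|]; rewrite lee_fin ltW.
- move: E N0; case: N {H} => [k| |]//= E _; exfalso; move: E.
  by rewrite gt0_muley ?eqxx.
Qed.

End Extended.

Theorem lemma3p1 (R : realType) (beta delta0 : R) (n : nat)
    (hbeta : 1 / 2 < beta) (hdelta0 : 0 < delta0) :
  exists2 C : R, 0 < C &
    forall (h : R -> R) (m : R -> R[i]) (v : R -> R -> R[i]) (rho alpha : R),
      smooth h -> periodic2pi h ->
      csmooth m -> periodic2pi m ->
      (forall t, delta0 <= cmod (dgamma h t)) ->
      (exists2 w : int, is_winding_number (dgamma h) w & absz w = n) ->
      arg_n_to_1 (dgamma h) n ->
      C1_polar v ->
      0 < rho ->
      ((cmod (Iint h m v rho alpha))%:E <=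
        C%:E *
        (((rho `^ (beta - 1) * (1 + rho^-1))%:E * kappa_oo beta h m
            + kappa_1 h m) * (ln (rho + 2))%:E
         + kappa_1 h m *
             maxe 0 ((ln (rho^-1 + 2))%:E + lne (kappa_S h m))) *
        (v_norm0 beta v + v_norm1 beta v))%E.
Proof.
have C0 := oscillation_constant_gt0 delta0 n hbeta.
exists (oscillation_constant beta delta0 n); first by [].
set C := oscillation_constant _ _ _ in C0 *.
move=> h m v rho alpha sh ph sm pm dg winding n_to_1 c1v rho0.
have k1E := kappa_1E hdelta0 sh sm dg.
set K1 := (\int[_]_(_ in _) _) in k1E.
have k1_ge0 : (0 <= kappa_1 h m)%E by exact: Lnorm_ge0.
have koo0 : (0 <= kappa_oo beta h m)%E by exact: Lnorm_ge0.
have v00 : (0 <= v_norm0 beta v)%E by exact: Lnorm_ge0.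
have v10 : (0 <= v_norm1 beta v)%E by exact: Lnorm_ge0.
have kS0 : (0 <= kappa_S h m)%E by rewrite adde_ge0// Lnorm_ge0.
have L0 : 0 < ln (rho + 2) by rewrite ln_gt0// ltr_wpDl ?(ltW rho0)// ltr1n.
have S0 : 0 < rho `^ (beta - 1) * (1 + rho^-1).
  by rewrite mulr_gt0 ?powR_gt0// addr_gt0 ?invr_gt0.
have rhs_ge0 : (0 <= C%:E *
        (((rho `^ (beta - 1) * (1 + rho^-1))%:E * kappa_oo beta h m
            + kappa_1 h m) * (ln (rho + 2))%:E
         + kappa_1 h m *
             maxe 0 ((ln (rho^-1 + 2))%:E + lne (kappa_S h m))) *
        (v_norm0 beta v + v_norm1 beta v))%E.
  apply: mule_ge0; last exact: adde_ge0.
  apply: mule_ge0; first by rewrite lee_fin ltW.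
  apply: adde_ge0; apply: mule_ge0 => //.
  - by apply: adde_ge0 => //; apply: mule_ge0 => //; rewrite lee_fin ltW.
  - by rewrite lee_fin ltW.
  - by rewrite le_max lexx.
have vanish : (forall r t, 0 < r -> 0 <= t <= 2 * pi -> v r t * m t = 0) ->
    cmod (Iint h m v rho alpha) = 0.
  by move=> vm; rewrite Iint_eq0// cmodE /= expr0n addr0 sqrtr0.
have [k10|k1N] := eqVneq (kappa_1 h m) 0%E.
  rewrite vanish// => r t _ _.
  by rewrite (kappa_1_eq0 hdelta0 sh ph sm pm dg k10) mulr0.
have [v0|vN] := eqVneq (v_norm0 beta v) 0%E.
  rewrite vanish// => r t r0 tc.
  have v0_le : (v_norm0 beta v <= 0%:E)%E by rewrite v0.
  have := v_norm0_le c1v v0_le r0 tc.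
  rewrite pmulr_rle0; last by rewrite powR_gt0// japanese_gt0.
  move=> vt; rewrite (ComplexField.Normc.eq0_normc (x := v r t)) ?mul0r//.
  by apply/eqP; rewrite eq_le vt; exact: cmod_ge0.
have K10 : 0 < K1 by rewrite -lte_fin -k1E lt_def k1N.
have N_gt0 : (0 < v_norm0 beta v + v_norm1 beta v)%E.
  by rewrite (@lt_le_trans _ _ (v_norm0 beta v))// ?leeDl// lt_def vN.
rewrite k1E; apply: reduce_to_finite => //; first by rewrite gt_eqF// (lt_le_trans ltNy0).
move=> K P N kooE kSE NE.
have v0f : v_norm0 beta v \is a fin_num.
  by rewrite ge0_fin_numE// (@le_lt_trans _ _ N%:E) ?ltry// -NE leeDl.
have v1f : v_norm1 beta v \is a fin_num.
  by rewrite ge0_fin_numE// (@le_lt_trans _ _ N%:E) ?ltry// -NE leeDr.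
set N0 := fine (v_norm0 beta v); set N1 := fine (v_norm1 beta v).
have N00 : 0 <= N0 by exact: fine_ge0.
have N10 : 0 <= N1 by exact: fine_ge0.
have NNE : N = N0 + N1 by apply: EFin_inj; rewrite -NE EFinD !fineK.
have K0 : 0 <= K by rewrite -lee_fin -kooE.
have dP : delta0 <= P.
  apply: le_trans (delta_speed sh dg 0) _.
  by apply: (speed_le_kappa_S sh ph (m := m)); rewrite kSE.
rewrite kooE kSE NE lne_EFin; last exact: lt_le_trans dP.
rewrite -EFinD -EFin_max -!(EFinM, EFinD) lee_fin.
have H := finite_bound alpha hbeta hdelta0 rho0 sh ph sm pm dg winding n_to_1 c1v
  (N0 := N0) (N1 := N1) (K := K) (P := P) N00 N10 K0.
apply: le_trans (H _ _ _ _) _; [by rewrite kSE|by rewrite kooE|by rewrite fineK|by rewrite fineK|].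
rewrite -/K1 -NNE; apply: finite_bound_le => //; first by rewrite NNE addr_ge0.
exact: ltW.
Qed.
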